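(* Let $X=\mathbb{R}^2/\Lambda$ be a tropical abelian surface and let $D$ be a divisor on $X$. Then the Riemann–Roch inequality $$h^{0}(X,D)+h^{0}(X,-D)\geq\tfrac{1}{2}D^{2}$$ holds. More precisely, write $Q=c_{1}(\mathcal{O}(D))$ and $\mathcal{O}(D)=L(Q,\alpha)$ with $\alpha\in(\mathbb{R}^2)^*$, let $q:\Lambda\to(\mathbb{Z}^2)^*$ be the linear map given by $Q$ and $q_{\mathbb{R}}:\mathbb{R}^2\to(\mathbb{R}^2)^*$ its linear extension. Then: (1) If $Q$ is positive or negative definite, then $h^{0}(X,D)+h^{0}(X,-D)=\frac12D^{2}=\det Q$. (2) Suppose $Q$ is positive or negative semidefinite and has $0$ as an eigenvalue. - If $Q\neq0$ and $\alpha\in\operatorname{Im}q_{\mathbb{R}}+(\mathbb{Z}^2)^*$, then $\left|\text{the torsion part of }\operatorname{Cok}(q)\right|=h^{0}(X,D)+h^{0}(X,-D)>\frac12D^{2}=0$. - If $Q=0$ and $\alpha\in(\mathbb{Z}^2)^*$, then $2=h^{0}(X,D)+h^{0}(X,-D)>\frac12D^{2}=0$. - If $\alpha\notin\operatorname{Im}q_{\mathbb{R}}+(\mathbb{Z}^2)^*$, then $h^{0}(X,D)+h^{0}(X,-D)=\frac12D^{2}=0$. (3) If $Q$ is indefinite, then $0=h^{0}(X,D)+h^{0}(X,-D)>\frac12D^{2}=\det Q$.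
   Context: Tropical torus: $X=\mathbb{R}^n/\Lambda$, where $\Lambda\subset\mathbb{R}^n$ is a lattice of rank $n$; its integral affine structure comes from the standard lattice $\mathbb{Z}^n\subset\mathbb{R}^n$ (not from $\Lambda$). It is a tropical abelian variety (surface if $n=2$) if there is a bilinear form $\Lambda\times\mathbb{Z}^n\to\mathbb{Z}$ whose $\mathbb{R}$-bilinear extension to $\mathbb{R}^n\times\mathbb{R}^n$ is symmetric and positive definite. A $\mathbb{Z}$-affine linear function is (locally) $x\mapsto a\cdot x+c$ with $a\in(\mathbb{Z}^n)^*$, $c\in\mathbb{R}$. A real-valued regular function is a continuous function that is locally a maximum of finitely many $\mathbb{Z}$-affine linear functions; a (real-valued) rational function is a continuous function that is locally a difference of two regular functions. A divisor $D$ on $X$ is given by local data $\{(U_i,f_i)\}$ with $\{U_i\}$ an open cover of $X$ and $f_i:U_i\to\mathbb{R}$ rational such that $f_i-f_j$ is $\mathbb{Z}$-affine linear on $U_i\cap U_j$; data $\{(U_i,f_i)\}$, $\{(V_j,g_j)\}$ define the same divisor iff all $f_i-g_j$ are $\mathbb{Z}$-affine linear on overlaps. Equivalently, $D$ is the balanced weighted rational polyhedral complex of pure dimension $n-1$ (up to subdivision and deletion of weight-zero cells) supported on the locus where the $f_i$ are not locally affine, the weight of an $(n-1)$-cell being plus (if $f_i$ is convex there) or minus (if concave) the lattice length (largest integer divisor) of the difference in $(\mathbb{Z}^n)^*$ of the slopes of $f_i$ on the two sides. $-D$ is given by $\{(U_i,-f_i)\}$. $D,D'$ are linearly equivalent if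 $D-D'$ is the divisor of a global rational function $X\to\mathbb{R}$. A divisor is effective if it has local data consisting of regular functions; $|D|$ is the set of effective divisors linearly equivalent to $D$; a divisor passes through $p$ if $p$ is in its support. $h^0(X,D)$ is the minimum of the integers $k\ge0$ such that there exist $k$ points $p_1,\dots,p_k\in X$ for which no $E\in|D|$ passes through all of $p_1,\dots,p_k$ (and $\infty$ if no such $k$ exists); so $h^0(X,D)=0$ iff $|D|=\emptyset$. Line bundles: for a bilinear form $Q:\Lambda\times\mathbb{Z}^n\to\mathbb{Z}$ whose real extension $Q_{\mathbb{R}}$ to $\mathbb{R}^n\times\mathbb{R}^n$ is symmetric, and $\alpha\in(\mathbb{R}^n)^*$, $L(Q,\alpha)$ is the quotient of $\mathbb{R}^n\times(\mathbb{R}\cup\{-\infty\})$ by $\lambda\cdot(x,t)=(x+\lambda,t+Q_{\mathbb{R}}(\lambda,x)+\tfrac12Q_{\mathbb{R}}(\lambda,\lambda)+\alpha(\lambda))$, $\lambda\in\Lambda$. Every tropical line bundle on $X$ is isomorphic to some $L(Q,\alpha)$; $Q=c_1(L(Q,\alpha))$ is determined by the bundle, and $\alpha$ is determined modulo $(\mathbb{Z}^n)^*$. $\mathcal{O}(D)$ is the line bundle associated with $D$, normalized so that the $f_i$ form a rational section: $\mathcal{O}(D)\cong L(Q,\alpha)$ iff $D$ is the divisor induced on $X$ by a rational function $F:\mathbb{R}^n\to\mathbb{R}$ with $F(x+\lambda)=F(x)+Q_{\mathbb{R}}(\lambda,x)+\tfrac12Q_{\mathbb{R}}(\lambda,\lambda)+\alpha(\lambda)$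 for all $\lambda\in\Lambda$, $x\in\mathbb{R}^n$. Here $q(\lambda)=Q(\lambda,\cdot)$, $\operatorname{Cok}(q)=(\mathbb{Z}^n)^*/q(\Lambda)$, (semi)definiteness refers to $Q_{\mathbb{R}}$, and $\det Q=\det(Q(\lambda_i,e_j))_{i,j}$ for bases $(\lambda_i)$ of $\Lambda$ and $(e_j)$ of $\mathbb{Z}^n$ with the same orientation. Intersection number of divisors $D_1,\dots,D_n$ on $X$: subdivide the $D_i$ so that $\bigcap_i D_i$ is a subcomplex of each, and let $S$ be the finite set of its vertices. For $p\in S$ choose an open neighborhood $U_i$ of $p$ in $D_i$ contained in the open star of $p$ (so $p$ is the only vertex in $\bigcap_iU_i$), and translate $U_i$ by generic sufficiently small vectors $v_i\in\mathbb{R}^n$, so that the translates either have empty common intersection or meet transversally in finitely many points, each lying in the relative interior of $(n-1)$-cells $E_1,\dots,E_n$ of the translates. Such a point has multiplicity $w_1\cdots w_n|\det(u_1,\dots,u_n)|$, where $w_i$ is the weight of $E_i$ and $u_i$ is a primitive integral vector orthogonal to $E_i$. The multiplicity of $p$ is the sum of these multiplicities ($0$ if the intersection is empty; it is independent of choices), and $D_1.\cdots.D_n$ is the sum of the multiplicities over $p\in S$. $D^2=D.D$ when $n=2$. *)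

(* Defs.v *)
From HB Require Import structures.
From mathcomp Require Import all_boot all_order all_algebra.
From mathcomp Require Import finmap.
From mathcomp Require Import all_classical all_reals all_analysis.

Set Implicit Arguments.
Unset Strict Implicit.
Unset Printing Implicit Defensive.

Import Order.TTheory GRing.Theory Num.Theory numFieldNormedType.Exports.

Local Open Scope classical_set_scope.
Local Open Scope quotient_scope.
Local Open Scope ring_scope.

(* Vectors of R^n, of Z^n and covectors are all row vectors.  The integral
   affine structure is always the one of the standard lattice Z^n. *)

Definition toR {R : nzRingType} {m n : nat} (A : 'M[int]_(m, n)) : 'M[R]_(m, n) :=
  map_mx intr A.

Definition pairing {R : nzRingType} {n : nat} (a x : 'rV[R]_n) : R :=
  \sum_j a 0 j * x 0 j.

Definition int_span {A : nzRingType} {m n : nat} (M : 'M[A]_(m, n)) :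
    {pred 'rV[A]_n} :=
  fun x => `[< exists c : 'rV[int]_m, x = toR c *m M >].

Lemma int_span_zmod_closed {A : nzRingType} {m n : nat} (M : 'M[A]_(m, n)) :
  zmod_closed (int_span M).
Proof.
split; first by apply/asboolP; exists 0; rewrite /toR map_mx0 mul0mx.
move=> x y /asboolP[c ->] /asboolP[d ->]; apply/asboolP; exists (c - d).
by rewrite -mulmxBl /toR map_mxB.
Qed.

HB.instance Definition _ (A : nzRingType) (m n : nat) (M : 'M[A]_(m, n)) :=
  GRing.isZmodClosed.Build _ (int_span M) (int_span_zmod_closed M).

(* Local notions on R^n: each is a condition on the germ of f at x. *)

Section Functions.
Context {R : realType} {n : nat}.
Implicit Types (f g h F : 'rV[R]_n -> R) (x y : 'rV[R]_n).

Definition affine_fun (m : 'rV[int]_n * R) y : R := pairing (toR m.1) y + m.2.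

Definition Zaffine_at f x := exists m, \forall y \near x, f y = affine_fun m y.

Definition regular_at f x :=
  {for x, continuous f} /\
  exists m (s : seq ('rV[int]_n * R)), \forall y \near x,
    f y = \big[Num.max/affine_fun m y]_(i <- s) affine_fun i y.

Definition rational_at f x :=
  {for x, continuous f} /\
  exists g h, \forall y \near x,
    [/\ regular_at g y, regular_at h y & f y = g y - h y].

End Functions.

(* Lambda is the lattice spanned by the rows of B; it has rank n when
   B \in unitmx. *)

Definition torus {R : realType} {n : nat} (B : 'M[R]_n) :=
  quotient_topology (Quotient.quot (int_span B)).

Section Divisors.
Context {R : realType} {n : nat} (B : 'M[R]_n).
Local Notation X := (torus B).
Local Notation proj := (\pi_X : 'rV[R]_n -> X).

(* A function on an open subset U of X is represented by a total function on
   X, of which only the values on U are ever used; it is studied through its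
   composite with R^n -> X, the restrictions of which are the charts of X. *)

Definition local_data := set (set X * (X -> R)).
Implicit Types (D E : local_data) (U V : set X) (f g : X -> R).

Definition Zaffine_on U f :=
  forall x, U (proj x) -> Zaffine_at (f \o proj) x.
Definition regular_on U f :=
  forall x, U (proj x) -> regular_at (f \o proj) x.
Definition rational_on U f :=
  forall x, U (proj x) -> rational_at (f \o proj) x.

Definition same_divisor D E :=
  forall U f V g, D (U, f) -> E (V, g) ->
    Zaffine_on (U `&` V) (fun p => f p - g p).

(* Divisors are handled as local data, up to same_divisor. *)
Definition is_divisor D :=
  [/\ forall U f, D (U, f) -> open U /\ rational_on U f,
      forall p, exists U f, D (U, f) /\ U p
    & same_divisor D D].

Definition div_opp D : local_data :=
  [set c | exists U f, D (U, f) /\ c = (U, fun p => - f p)].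

Definition div_sub D E : local_data :=
  [set c | exists U f V g,
     [/\ D (U, f), E (V, g) & c = (U `&` V, fun p => f p - g p)]].

Definition div_of_fun h : local_data := [set (setT, h)].

Definition lin_equiv D E :=
  exists h, rational_on setT h /\ same_divisor (div_sub D E) (div_of_fun h).

Definition effective D :=
  exists E, [/\ is_divisor E, same_divisor D E
    & forall U f, E (U, f) -> regular_on U f].

Definition linear_system D : set local_data :=
  [set E | [/\ is_divisor E, effective E & lin_equiv E D]].

(* The inverse image in R^n of the support of D. *)
Definition support_lift D : set 'rV[R]_n :=
  [set x | exists U f,
     [/\ D (U, f), U (proj x) & ~ Zaffine_at (f \o proj) x]].

Definition support D : set X := proj @` support_lift D.

Definition avoidable D (k : nat) :=
  exists p : 'I_k -> X,
    forall E, linear_system D E -> ~ (forall i, support E (p i)).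

(* The minimum, as the infimum of a set of natural numbers; it is +oo when
   this set is empty. *)
Definition h0 D : \bar R := ereal_inf [set k%:R%:E | k in avoidable D].

(* Largest integer divisor of d. *)
Definition lattice_length (d : 'rV[int]_n) : nat :=
  \big[gcdn/0%N]_j absz (d 0 j).

(* (The projection of) x is in the relative interior of an (n-1)-cell of D,
   of weight w, and u is a primitive integral vector orthogonal to this cell.
   The function is convex across the cell in the first case, concave in the
   second; a and b are its slopes on the two sides. *)
Definition facet D (x : 'rV[R]_n) (w : int) (u : 'rV[int]_n) :=
  exists U f (a b : 'rV[int]_n),
  [/\ D (U, f) /\ U (proj x), a != b,
      b - a = (lattice_length (b - a))%:Z *: u
    & ((\forall y \near x, f (proj y) = f (proj x) +
          Num.max (pairing (toR a) (y - x)) (pairing (toR b) (y - x))) /\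
       w = (lattice_length (b - a))%:Z)
   \/ ((\forall y \near x, f (proj y) = f (proj x) +
          Num.min (pairing (toR a) (y - x)) (pairing (toR b) (y - x))) /\
       w = - (lattice_length (b - a))%:Z)].

(* A bilinear form Q : Lambda x Z^n -> Z is given by its matrix in the basis
   of Lambda formed by the rows of B and the standard basis of Z^n; [gram Q]
   is the matrix of its real extension in the standard basis of R^n. *)
Implicit Types (Q : 'M[int]_n) (alpha : 'rV[R]_n).

Definition gram Q : 'M[R]_n := invmx B *m toR Q.

Definition real_ext Q (x y : 'rV[R]_n) : R := (x *m gram Q *m y^T) 0 0.

Definition symmetric_form Q := forall x y, real_ext Q x y = real_ext Q y x.
Definition positive_definite Q := forall x, x != 0 -> 0 < real_ext Q x x.
Definition negative_definite Q := forall x, x != 0 -> real_ext Q x x < 0.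
Definition positive_semidefinite Q := forall x, 0 <= real_ext Q x x.
Definition negative_semidefinite Q := forall x, real_ext Q x x <= 0.
Definition indefinite Q :=
  (exists x, 0 < real_ext Q x x) /\ (exists y, real_ext Q y y < 0).

Definition tropical_abelian := exists Q, symmetric_form Q /\ positive_definite Q.

(* The rows of B and the standard basis have the same orientation iff
   0 < \det B; if not, one of the rows must be replaced by its opposite. *)
Definition form_det Q : int := sgz (\det B) * \det Q.

(* q(Lambda) is generated by the covectors Q(lambda_i, -), the rows of Q. *)
Definition cokernel Q := Quotient.quot (int_span Q).

Definition torsion_part Q : set (cokernel Q) :=
  [set z | exists2 k, (0 < k)%N & z *+ k = 0].

Definition torsion_order Q : nat := #|` fset_set (@torsion_part Q)|%fset.

Definition in_image_plus_int Q alpha :=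
  exists (x : 'rV[R]_n) (a : 'rV[int]_n), alpha = x *m gram Q + toR a.

(* F is a rational section of the line bundle L(Q, alpha). *)
Definition section_of Q alpha (F : 'rV[R]_n -> R) :=
  (forall x, rational_at F x) /\
  forall l x, l \in int_span B ->
    F (x + l) = F x + real_ext Q l x + real_ext Q l l / 2 + pairing alpha l.

Definition induced_by D (F : 'rV[R]_n -> R) :=
  forall U f, D (U, f) -> forall x, U (proj x) ->
    Zaffine_at (fun y => F y - f (proj y)) x.

(* The line bundle O(D) is isomorphic to L(Q, alpha), that is, L(Q, alpha)
   has a rational section with divisor D. *)
Definition line_bundle_iso D Q alpha :=
  symmetric_form Q /\ exists F, section_of Q alpha F /\ induced_by D F.

End Divisors.

Section Intersection.
Context {R : realType} (B : 'M[R]_2).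
Local Notation X := (torus B).
Local Notation proj := (\pi_X : 'rV[R]_2 -> X).
Implicit Types (D : local_data B) (x y v : 'rV[R]_2).

(* The translate by v of the neighborhood of x in D cut out by the ball of
   radius r. *)
Definition translate D x (r : R) v : set 'rV[R]_2 :=
  [set y | support_lift D (y - v) /\ ball x r (y - v)].

Definition meeting D1 D2 x r v1 v2 :=
  translate D1 x r v1 `&` translate D2 x r v2.

Definition transversal D1 D2 x r v1 v2 :=
  finite_set (meeting D1 D2 x r v1 v2) /\
  forall y, meeting D1 D2 x r v1 v2 y -> exists w1 u1 w2 u2,
    [/\ facet D1 (y - v1) w1 u1, facet D2 (y - v2) w2 u2
      & \det (col_mx u1 u2) != 0].

(* w1 * w2 * |det (u1, u2)| at a transversal point y of the translates. *)
Definition transversal_mult D1 D2 v1 v2 y : int :=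
  xget 0 [set m | exists w1 u1 w2 u2,
    [/\ facet D1 (y - v1) w1 u1, facet D2 (y - v2) w2 u2
      & m = w1 * w2 * `|\det (col_mx u1 u2)|]].

(* For r small enough, the balls of radius r centered at x cut out
   neighborhoods contained in the open stars of x. *)
Definition is_multiplicity D1 D2 x (m : int) :=
  \forall r \near 0^'+, \forall v1 \near (0 : 'rV[R]_2) & v2 \near (0 : 'rV[R]_2),
    transversal D1 D2 x r v1 v2 ->
    m = \sum_(y \in meeting D1 D2 x r v1 v2) transversal_mult D1 D2 v1 v2 y.

Definition multiplicity D1 D2 x : int := xget 0 (is_multiplicity D1 D2 x).

(* The vertices of the intersection of D1 and D2: the points of the
   intersection which are not in the relative interior of a common edge.
   Subdividing further would only add vertices of multiplicity 0. *)
Definition vertices D1 D2 : set X :=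
  proj @` [set x | [/\ support_lift D1 x, support_lift D2 x
    & ~ exists w1 u1 w2 u2, [/\ facet D1 x w1 u1, facet D2 x w2 u2
                              & \det (col_mx u1 u2) = 0]]].

Definition intersection_number D1 D2 : int :=
  \sum_(p \in vertices D1 D2) multiplicity D1 D2 (repr p).

End Intersection.

(* Main.v *)
(* A divisor D with O(D) = L(Q, alpha) is induced by a quasi-periodic rational function F
   on R^2 (glue local equations over growing squares), and E in |D| corresponds to a regular
   F with the same quasi-periodicity.

   D^2 = 2 det Q: the multiplicity of a vertex x is the sum, over the rays e of the germ of F
   at x, of the jump of the gradient of F across e times the slope of F along e.  In a
   fundamental parallelogram the contributions of both ends of an edge cancel, and what remains
   comes from the edges crossing the sides, where quasi-periodicity turns it into 2 det Q.

   h^0(D): for F regular, phi(x) = F(x) - Q(x, x)/2 - alpha(x) is periodic, hence has a maximum.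
   As F is midpoint convex, this forces Q to be positive semidefinite.  At a maximum x the
   convex function F is touched from above by a paraboloid, hence it is affine near x, with slope
   Q(x, -) + alpha, so this covector is integral; moreover phi is also maximal at x + v if
   Q(v, -) = 0.  Consequently F is affine at one point of any family representing the classes,
   modulo Lambda and the kernel, of the x with Q(x, -) + alpha integral; if there are no such
   classes, then there is no F.  Conversely every class carries a theta function, all the slopes
   of which are in one coset of q(Lambda), and different classes have different cosets.  Given
   fewer points than classes, tropical linear algebra provides constants such that, in the
   maximum of the theta functions shifted by them, two classes are tied at each point, so that
   the maximum is not affine there.  Hence h^0(D) is the number of classes, which form a torsor
   under the torsion part of Cok(q). *)

Require Import Defs.
From mathcomp Require Import all_boot all_order all_algebra.
From mathcomp Require Import finmap ring lra zify.
From mathcomp Require Import all_classical all_reals all_analysis.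

Set Implicit Arguments.
Unset Strict Implicit.
Unset Printing Implicit Defensive.

Import Order.TTheory GRing.Theory Num.Theory numFieldNormedType.Exports.

Local Open Scope classical_set_scope.
Local Open Scope ring_scope.

(** No cell complex is ever built: a divisor is studied through the germs of F, positively
    homogeneous functions described along each ray by two integral covectors. Finiteness comes from
    Cousin's lemma, and sums over edges from telescoping one-sided values along lines.

    Why the multiplicity of a vertex has the stated form: after a translation by v, the ray of e in
    one copy of the germ G meets the other copy where s -> G(v + s e) bends. The weighted crossings
    on this ray add up to jump(e) times the total change of slope. The slope starts at a value
    linear in e, as G is linear near v, and ends at G(e). Summed over e, the linear term vanishes by
    the balancing condition, so what remains does not depend on v.

    Two devices avoid choices of orientation: the sum G(h) + G(-h) determines an edge germ up to a
    linear form, and a direction d transverse to all edges normalizes every ray by det(d, e) = 1 or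
    -1. *)

(** * Cousin's lemma and telescoping sums *)

Section Intervals.
Context {R : realType}.
Implicit Types (a b t s : R).

(** Least upper bound of the good right endpoints. The lemma stands in for compactness: finite
    subdivisions only appear as finite data inside [P]. *)
Lemma cousin (P : R -> R -> Prop) :
  (forall a b c, a < b -> b < c -> P a b -> P b c -> P a c) ->
  (forall t, exists2 e, 0 < e & forall a b, a < b -> a <= t <= b ->
     t - e < a -> b < t + e -> P a b) ->
  forall a b, a < b -> P a b.
Proof.
move=> Pcat Ploc a b ab.
pose A := [set x | a < x <= b /\ P a x].
have [e e0 Pa] := Ploc a.
pose x0 := Num.min (a + e / 2) b.
have x0P : A x0.
  have ax0 : a < x0 by rewrite lt_min ab andbT; lra.
  have x0b : x0 <= b by rewrite ge_min lexx orbT.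
  have x0e : x0 <= a + e / 2 by rewrite ge_min lexx.
  split; first by rewrite ax0.
  by apply: Pa => //; [rewrite lexx ltW|lra|lra].
have Aub : ubound A b by move=> x [/andP[]].
have supA : has_sup A by split; [exists x0|exists b].
set m := sup A.
have mb : m <= b by apply: ge_sup => //; exists x0.
have am : a < m.
  by apply: (@lt_le_trans _ _ x0); [case: x0P => /andP[]|exact: ub_le_sup supA.2 _ x0P].
have [d d0 Pm] := Ploc m.
have [x [/andP[ax xb] Pax] mx] := sup_adherent d0 supA.
have xm : x <= m by apply: (ub_le_sup supA.2); split=> //; rewrite ax.
have key y : m <= y -> x < y -> y < m + d -> P a y.
  move=> my xy yd; apply: (Pcat a x y) => //.
  by apply: Pm => //; rewrite xm.
have [mb'|bm] := ltP m b; last first.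
  have {bm mb}mb : m = b by apply/eqP; rewrite eq_le mb.
  have [xlt|bx] := ltP x b; first by apply: key; rewrite ?mb // ltrDl.
  by have -> : b = x by apply/eqP; rewrite eq_le bx xb.
pose y := Num.min (m + d / 2) b.
have my : m < y by rewrite lt_min mb' andbT; lra.
have yb : y <= b by rewrite ge_min lexx orbT.
have yd : y <= m + d / 2 by rewrite ge_min lexx.
have Ay : A y.
  split; first by rewrite yb andbT (lt_trans am).
  by apply: key; [exact: ltW|exact: le_lt_trans my|lra].
by have := ub_le_sup supA.2 Ay; rewrite leNgt my.
Qed.

(** A tube argument: for a fixed first coordinate, Cousin's lemma in the second one yields a common
    width around it, which is the local hypothesis for the first coordinate. *)
Lemma cousin2 (P : R -> R -> R -> R -> Prop) :
  (forall a b c s1 s2, a < b -> b < c -> s1 < s2 ->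
     P a b s1 s2 -> P b c s1 s2 -> P a c s1 s2) ->
  (forall a b s1 s2 s3, a < b -> s1 < s2 -> s2 < s3 ->
     P a b s1 s2 -> P a b s2 s3 -> P a b s1 s3) ->
  (forall t s, exists2 e, 0 < e & forall a b s1 s2, a < b -> s1 < s2 ->
     a <= t <= b -> s1 <= s <= s2 -> t - e < a -> b < t + e ->
     s - e < s1 -> s2 < s + e -> P a b s1 s2) ->
  forall a b s1 s2, a < b -> s1 < s2 -> P a b s1 s2.
Proof.
move=> Pt Ps Ploc a b s1 s2 ab s12; move: a b ab.
apply: cousin => [a b c ab bc|t]; first exact: Pt.
pose Q u1 u2 := exists2 e, 0 < e & forall a b, a < b -> a <= t <= b ->
  t - e < a -> b < t + e -> P a b u1 u2.
suff : forall u1 u2, u1 < u2 -> Q u1 u2 by exact.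
apply: cousin => [u1 u2 u3 u12 u23 [e e0 Pe] [d d0 Pd]|s].
  exists (Num.min e d); first by rewrite lt_min e0.
  move=> a b ab atb; have me : Num.min e d <= e by rewrite ge_min lexx.
  have md : Num.min e d <= d by rewrite ge_min lexx orbT.
  move=> ta bt; apply: (Ps _ _ _ u2) => //.
    by apply: Pe => //; lra.
  by apply: Pd => //; lra.
have [e e0 Pe] := Ploc t s; exists e => // u1 u2 u12 sb su1 su2.
by exists e => // a b ab tb ta bt; exact: Pe.
Qed.

(** [Pp t] and [Pm t] are the right and left values at t of a step function, constant on each side
    of t near t. So there are finitely many discontinuities and their sum telescopes. Slopes,
    gradients and clipped multiplicities along a line are all summed in this way. *)
Lemma telescope_jumps (W : zmodType) (Pp Pm : R -> W) :
  (forall t, exists2 e, 0 < e & forall d, 0 < d -> d < e ->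
     [/\ Pp (t + d) = Pp t, Pm (t + d) = Pp t,
         Pp (t - d) = Pm t & Pm (t - d) = Pm t]) ->
  forall a b, a < b -> exists S : seq R,
    [/\ uniq S, forall t, t \in S -> a < t < b,
        forall t, a < t < b -> t \notin S -> Pp t = Pm t
      & \sum_(t <- S) (Pp t - Pm t) = Pm b - Pp a].
Proof.
move=> loc; apply: cousin => [a b c ab bc|t].
  move=> [S [uS abS supS sumS]] [S' [uS' bcS' supS' sumS']].
  exists (S ++ b :: S'); split.
  - rewrite cat_uniq cons_uniq uS uS' andbT andTb; apply/andP; split; last first.
      by apply/negP => /bcS'; rewrite ltxx.
    apply/hasPn => x; rewrite inE => /orP[/eqP->|/bcS'/andP[bx _]].
      by apply/negP => /abS; rewrite ltxx andbF.
    by apply/negP => /abS/andP[_ /(lt_trans bx)]; rewrite ltxx.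
  - move=> x; rewrite mem_cat inE => /or3P[/abS/andP[-> /lt_trans->//]|/eqP->|].
      by rewrite ab bc.
    by move=> /bcS'/andP[/(lt_trans ab)-> ->].
  - move=> x /andP[ax xc]; rewrite mem_cat inE !negb_or => /and3P[xS xb xS'].
    have [xltb|bltx|xeb] := ltgtP x b.
    + by apply: supS => //; rewrite ax.
    + by apply: supS' => //; rewrite bltx.
    + by rewrite xeb eqxx in xb.
  - rewrite big_cat big_cons /= sumS sumS'.
    by rewrite [Pp b - _ + _]addrC subrKA addrC subrKA.
have [e e0 le] := loc t; exists e => // a b ab /andP[at_ tb] ta bt.
have Pa : a < t -> Pp a = Pm t /\ Pm a = Pm t.
  move=> alt; have [||_ _] := le (t - a); [lra|lra|].
  by rewrite subKr => -> ->.
have Pb : t < b -> Pp b = Pp t /\ Pm b = Pp t.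
  move=> blt; have [||] := le (b - t); [lra|lra|].
  by rewrite addrC subrK => -> -> _ _.
have off x : a < x < b -> x != t -> Pp x = Pm x.
  move=> /andP[ax xb]; rewrite neq_lt => /orP[xt|tx].
    by have [||_ _] := le (t - x); [lra|lra|]; rewrite subKr => -> ->.
  by have [||] := le (x - t); [lra|lra|]; rewrite addrC subrK => -> ->.
have [alt|tlea] := ltP a t; last first.
  have {at_ tlea}eta : t = a by apply/eqP; rewrite eq_le tlea at_.
  exists [::]; split=> //.
    by move=> x axb _; apply: off => //; case/andP: axb => ax _; rewrite eta gt_eqF.
  by rewrite big_nil (Pb _).2 eta ?subrr // -eta.
have [blt|bltet] := ltP t b; last first.
  have {tb bltet}etb : t = b by apply/eqP; rewrite eq_le tb bltet.
  exists [::]; split=> //.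
    by move=> x axb _; apply: off => //; case/andP: axb => _ xb; rewrite etb lt_eqF.
  by rewrite big_nil (Pa _).1 etb ?subrr // -etb.
exists [:: t]; split=> //.
- by move=> x; rewrite inE => /eqP->; rewrite alt.
- by move=> x axb; rewrite inE => xt; exact: off.
- by rewrite big_seq1 (Pa alt).1 (Pb blt).2.
Qed.

End Intervals.

(** Lists of jump points are only known to exist; this makes the sums independent of the list. *)
Lemma sum_over_support (T : eqType) (W : nmodType) (s1 s2 : seq T) (f : T -> W) :
  uniq s1 -> uniq s2 ->
  (forall x, f x != 0 -> (x \in s1) = (x \in s2)) ->
  \sum_(x <- s1) f x = \sum_(x <- s2) f x.
Proof.
move=> u1 u2 h.
rewrite (bigID (fun x => f x != 0)) /= [X in _ + X]big1 ?addr0; last first.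
  by move=> x /negPn/eqP.
rewrite [RHS](bigID (fun x => f x != 0)) /= [X in _ + X]big1 ?addr0; last first.
  by move=> x /negPn/eqP.
rewrite -big_filter -[RHS]big_filter; apply: perm_big; apply: uniq_perm.
- exact: filter_uniq.
- exact: filter_uniq.
by move=> x; rewrite !mem_filter; case: (boolP (f x != 0)) => //= /h.
Qed.

(** * The plane: area form, pairing, sup norm *)

Section Plane.
Context {R : realType}.
Local Notation V := 'rV[R]_2.
Implicit Types (a b e h x y : V).

Definition det2 (e h : V) : R := e 0 0 * h 0 1 - e 0 1 * h 0 0.

Definition vec2 (a b : R) : V := \row_(j < 2) if j == 0 then a else b.

Lemma vec20 (a b : R) : vec2 a b 0 0 = a. Proof. by rewrite mxE. Qed.
Lemma vec21 (a b : R) : vec2 a b 0 1 = b. Proof. by rewrite mxE. Qed.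

Lemma row2P x y : x 0 0 = y 0 0 -> x 0 1 = y 0 1 -> x = y.
Proof.
move=> h0 h1; apply/rowP => j; case: j => -[|[|//]] lt_j.
  by have -> : Ordinal lt_j = 0 by exact: val_inj.
by have -> : Ordinal lt_j = 1 by exact: val_inj.
Qed.

Lemma pairing2 a x : pairing a x = a 0 0 * x 0 0 + a 0 1 * x 0 1.
Proof.
rewrite /pairing !big_ord_recl big_ord0 addr0.
by have -> : lift ord0 ord0 = 1 :> 'I_2 by exact: val_inj.
Qed.

Lemma pairingDl a b x : pairing (a + b) x = pairing a x + pairing b x.
Proof. by rewrite !pairing2 !mxE; ring. Qed.
Lemma pairingDr a x y : pairing a (x + y) = pairing a x + pairing a y.
Proof. by rewrite !pairing2 !mxE; ring. Qed.
Lemma pairingNl a x : pairing (- a) x = - pairing a x.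
Proof. by rewrite !pairing2 !mxE; ring. Qed.
Lemma pairingNr a x : pairing a (- x) = - pairing a x.
Proof. by rewrite !pairing2 !mxE; ring. Qed.
Lemma pairingBl a b x : pairing (a - b) x = pairing a x - pairing b x.
Proof. by rewrite !pairing2 !mxE; ring. Qed.
Lemma pairingBr a x y : pairing a (x - y) = pairing a x - pairing a y.
Proof. by rewrite !pairing2 !mxE; ring. Qed.
Lemma pairingZl k a x : pairing (k *: a) x = k * pairing a x.
Proof. by rewrite !pairing2 !mxE; ring. Qed.
Lemma pairingZr k a x : pairing a (k *: x) = k * pairing a x.
Proof. by rewrite !pairing2 !mxE; ring. Qed.
Lemma pairing0l x : pairing 0 x = 0.
Proof. by rewrite !pairing2 !mxE; ring. Qed.
Lemma pairing0r a : pairing a 0 = 0.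
Proof. by rewrite !pairing2 !mxE; ring. Qed.

Lemma pairing_inj a b : (forall x, pairing a x = pairing b x) -> a = b.
Proof.
move=> h; apply: row2P.
  by have := h (vec2 1 0); rewrite !pairing2 vec20 vec21; lra.
by have := h (vec2 0 1); rewrite !pairing2 vec20 vec21; lra.
Qed.

Lemma det2Dl a b x : det2 (a + b) x = det2 a x + det2 b x.
Proof. by rewrite /det2 !mxE; ring. Qed.
Lemma det2Dr a x y : det2 a (x + y) = det2 a x + det2 a y.
Proof. by rewrite /det2 !mxE; ring. Qed.
Lemma det2Nl a x : det2 (- a) x = - det2 a x.
Proof. by rewrite /det2 !mxE; ring. Qed.
Lemma det2Nr a x : det2 a (- x) = - det2 a x.
Proof. by rewrite /det2 !mxE; ring. Qed.
Lemma det2Zl k a x : det2 (k *: a) x = k * det2 a x.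
Proof. by rewrite /det2 !mxE; ring. Qed.
Lemma det2Zr k a x : det2 a (k *: x) = k * det2 a x.
Proof. by rewrite /det2 !mxE; ring. Qed.
Lemma det2vv a : det2 a a = 0.
Proof. by rewrite /det2; ring. Qed.
Lemma det2C a b : det2 a b = - det2 b a.
Proof. by rewrite /det2; ring. Qed.

Lemma norm2_le x : `|x 0 0| <= `|x| /\ `|x 0 1| <= `|x|.
Proof.
by split; rewrite [leRHS]/Num.norm /= mx_normrE;
   apply: (le_bigmax _ (fun i : 'I_1 * 'I_2 => `|x i.1 i.2|) (0, _)).
Qed.

Lemma norm2_lt x (r : R) : 0 < r -> (`|x| < r) = (`|x 0 0| < r) && (`|x 0 1| < r).
Proof.
move=> r0; apply/idP/idP => [xr|/andP[x0 x1]].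
  by have [x0 x1] := norm2_le x; rewrite (le_lt_trans x0) // (le_lt_trans x1).
rewrite /Num.norm /= mx_normrE; apply: bigmax_lt => //= -[i j] _ /=.
rewrite (ord1 i); case: j => -[|[|//]] lt_j.
  by have -> : Ordinal lt_j = 0 by exact: val_inj.
by have -> : Ordinal lt_j = 1 by exact: val_inj.
Qed.

Lemma nearE (P : V -> Prop) x :
  (\forall y \near x, P y) <-> exists2 e, 0 < e & forall h, `|h| < e -> P (x + h).
Proof.
split=> [/nbhs_normP[e /= e0 he]|[e e0 he]].
  exists e => // h hh; apply: he => /=.
  by rewrite opprD addrA subrr add0r normrN.
apply/nbhs_normP; exists e => //= y /= xy.
by have := he (y - x); rewrite [x + _]addrC subrK; apply; rewrite distrC.
Qed.

End Plane.

(** * Germs of piecewise linear functions *)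

Section Germs.
Context {R : realType}.
Local Notation V := 'rV[R]_2.
Implicit Types (a b e h k x y : V) (F G : V -> R).

(** The vector orthogonal to e with [det2 e (nrm e) = 1]. It scales inversely to e, which makes the
    product of a jump across e and a slope along e independent of the length of e. *)
Definition nrm e : V := (e 0 0 ^+ 2 + e 0 1 ^+ 2)^-1 *: vec2 (- e 0 1) (e 0 0).

Lemma sqnorm_neq0 e : e != 0 -> e 0 0 ^+ 2 + e 0 1 ^+ 2 != 0.
Proof.
apply: contra; rewrite paddr_eq0 ?sqr_ge0 // !sqrf_eq0 => /andP[/eqP e0 /eqP e1].
by apply/eqP/row2P; rewrite mxE.
Qed.

Lemma det2_nrm e : e != 0 -> det2 e (nrm e) = 1.
Proof.
move=> /sqnorm_neq0 e0; rewrite /det2 /nrm !mxE /=.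
by field.
Qed.

Lemma nrmN e : nrm (- e) = - nrm e.
Proof. by apply: row2P; rewrite /nrm !mxE /= !sqrrN ?mulrN //; ring. Qed.

Lemma ortho_jump a b e h : e != 0 -> pairing a e = pairing b e ->
  pairing b h - pairing a h = pairing (b - a) (nrm e) * det2 e h.
Proof.
move=> /sqnorm_neq0 e0; rewrite !pairing2 /det2 /nrm !mxE /= => abe.
set N := _ + _ in e0 *.
(* Lagrange's identity for b - a, e and h; its second term vanishes, as a and b agree on e. *)
transitivity (N^-1 * (N * ((b 0 0 - a 0 0) * h 0 0 + (b 0 1 - a 0 1) * h 0 1)
  - (b 0 0 * e 0 0 + b 0 1 * e 0 1 - (a 0 0 * e 0 0 + a 0 1 * e 0 1))
    * (e 0 0 * h 0 0 + e 0 1 * h 0 1))).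
  by rewrite abe subrr mul0r subr0 mulrA mulVf // mul1r; ring.
by rewrite /N; ring.
Qed.

Lemma covector_eq a b e : e != 0 -> pairing a e = pairing b e ->
  pairing a (nrm e) = pairing b (nrm e) -> a = b.
Proof.
move=> e0 abe abn; apply: pairing_inj => h; apply/eqP.
rewrite eq_sym -subr_eq0 (ortho_jump _ e0 abe) pairingBl abn subrr.
by rewrite mul0r.
Qed.

Lemma parallel_det2 e h : e != 0 -> det2 e h = 0 -> exists k : R, h = k *: e.
Proof.
move=> /sqnorm_neq0 e0 eh; set N := _ + _ in e0.
exists (N^-1 * pairing e h); apply: row2P; rewrite !mxE pairing2.
  apply: (mulfI e0); rewrite !mulrA divff // mul1r /N; move: eh; rewrite /det2.
  move=> eh; apply/eqP; rewrite -subr_eq0.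
  rewrite (_ : _ - _ = - e 0 1 * (e 0 0 * h 0 1 - e 0 1 * h 0 0)); last by ring.
  by rewrite eh mulr0.
apply: (mulfI e0); rewrite !mulrA divff // mul1r /N; move: eh; rewrite /det2.
move=> eh; apply/eqP; rewrite -subr_eq0.
rewrite (_ : _ - _ = e 0 0 * (e 0 0 * h 0 1 - e 0 1 * h 0 0)); last by ring.
by rewrite eh mulr0.
Qed.

Lemma pairing_bound a : exists2 C, 0 < C & forall h, `|pairing a h| <= C * `|h|.
Proof.
exists (`|a 0 0| + `|a 0 1| + 1) => [|h].
  by rewrite ltr_wpDl // addr_ge0.
have [h0 h1] := norm2_le h.
rewrite pairing2 (le_trans (ler_normD _ _)) // !normrM !mulrDl.
rewrite -[leLHS]addr0 !lerD ?ler_wpM2l ?mul1r //.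
Qed.

(** The germ of an edge of direction e, with b on its left and a on its right. Giving the line of e
    itself to b makes no difference when a and b agree on e. *)
Definition edge a b e h : R := if 0 <= det2 e h then pairing b h else pairing a h.

Definition homogeneous G := forall (k : R) h, 0 <= k -> G (k *: h) = k * G h.

Lemma homogeneous0 G : homogeneous G -> G 0 = 0.
Proof. by move=> hG; have := hG 0 0 (lexx _); rewrite scale0r mul0r. Qed.

Lemma edge_homogeneous a b e : homogeneous (edge a b e).
Proof.
move=> k h; rewrite le_eqVlt => /orP[/eqP<-|k0].
  by rewrite scale0r mul0r /edge !pairing0r if_same.
by rewrite /edge det2Zr pmulr_rge0 // !pairingZr; case: ifP.
Qed.

Lemma edge_bound a b e : exists2 C, 0 < C & forall h, `|edge a b e h| <= C * `|h|.
Proof.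
have [C C0 Ca] := pairing_bound a; have [D D0 Db] := pairing_bound b.
exists (C + D) => [|h]; first exact: addr_gt0.
rewrite /edge mulrDl; case: ifP => _.
  by rewrite (le_trans (Db h)) // lerDr mulr_ge0 // ltW.
by rewrite (le_trans (Ca h)) // lerDl mulr_ge0 // ltW.
Qed.

Lemma edge_shift a b e (k : R) h : pairing a e = pairing b e ->
  edge a b e (k *: e + h) = k * pairing a e + edge a b e h.
Proof.
move=> abe; rewrite /edge det2Dr det2Zr det2vv mulr0 add0r !pairingDr !pairingZr abe.
by case: ifP.
Qed.

Lemma edge_same a e h : edge a a e h = pairing a h.
Proof. by rewrite /edge if_same. Qed.

Lemma edgeN a b e h : e != 0 -> pairing a e = pairing b e ->
  edge b a (- e) h = edge a b e h.
Proof.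
move=> e0 abe; rewrite /edge det2Nl oppr_ge0.
have [//|//|eh] := ltgtP (det2 e h) 0.
by apply/eqP; rewrite eq_sym -subr_eq0 (ortho_jump _ e0 abe) eh mulr0.
Qed.

Definition germ_at F x G := homogeneous G /\
  exists2 r, 0 < r & forall h, `|h| < r -> F (x + h) = F x + G h.

Lemma scale_small h (r : R) : 0 < r -> exists2 k : R, 0 < k & `|k *: h| < r.
Proof.
move=> r0; exists (r / (`|h| + 1)); first by rewrite divr_gt0 // ltr_wpDl.
rewrite normrZ ger0_norm ?divr_ge0 ?ltW // ?ltr_wpDl //.
rewrite mulrAC ltr_pdivrMr ?ltr_wpDl // ltr_pM2l // ltrDl //.
Qed.

Lemma scale_small_le h (r : R) : 0 < r -> exists2 k : R, 0 < k &
  forall l, 0 <= l -> l <= k -> `|l *: h| < r.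
Proof.
move=> r0; have [k k0 kh] := scale_small h r0; exists k => // l l0 lk.
by apply: le_lt_trans kh; rewrite !normrZ !ger0_norm ?ler_wpM2r // ltW.
Qed.

Lemma germ_at_unique F x G G' : germ_at F x G -> germ_at F x G' -> G = G'.
Proof.
move=> [hG [r r0 FG]] [hG' [r' r'0 FG']]; apply: funext => h.
have rr : 0 < Num.min r r' by rewrite lt_min r0.
have [k k0] := scale_small h rr; rewrite lt_min => /andP[kr kr'].
apply: (mulfI (lt0r_neq0 k0)); rewrite -hG ?ltW // -hG' ?ltW //.
by apply: (@addrI _ (F x)); rewrite -FG // FG'.
Qed.

Definition germ F x : V -> R := xget (fun=> 0) [set G | germ_at F x G].

Lemma germE F x G : germ_at F x G -> germ F x = G.
Proof.
move=> FG; apply: xget_unique => //= G' FG'.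
exact: germ_at_unique FG' FG.
Qed.

(** A condition near the single point e is enough: for homogeneous G it extends to the whole ray. *)
Definition edge_at G e a b := pairing a e = pairing b e /\
  exists2 r, 0 < r & forall h, `|h| < r -> G (e + h) = edge a b e (e + h).

Lemma edge_at_val G e a b : edge_at G e a b -> G e = pairing a e.
Proof.
move=> [abe [r r0 Ge]]; have := Ge 0; rewrite normr0 addr0 => -> //.
by rewrite /edge det2vv lexx.
Qed.

Lemma edge_at_germ G e a b : edge_at G e a b -> germ_at G e (edge a b e).
Proof.
move=> Gab; have Gev := edge_at_val Gab; case: Gab => abe [r r0 Ge].
split; first exact: edge_homogeneous.
by exists r => // h /Ge->; rewrite -[X in X + h]scale1r edge_shift // mul1r Gev.
Qed.

Lemma edge_inj a b a' b' e : e != 0 -> pairing a e = pairing b e ->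
  pairing a' e = pairing b' e ->
  edge a b e = edge a' b' e -> a = a' /\ b = b'.
Proof.
move=> e0 abe abe' eqe.
have be : pairing b e = pairing b' e.
  by have := congr1 (fun f => f e) eqe; rewrite /edge det2vv lexx.
have bn : pairing b (nrm e) = pairing b' (nrm e).
  by have := congr1 (fun f => f (nrm e)) eqe; rewrite /edge det2_nrm // ler01.
have an : pairing a (nrm e) = pairing a' (nrm e).
  have := congr1 (fun f => f (- nrm e)) eqe.
  by rewrite /edge det2Nr det2_nrm // oppr_ge0 ler10 !pairingNr => /oppr_inj.
by split; apply: covector_eq e0 _ _ => //; rewrite abe abe'.
Qed.

Lemma edge_at_unique G e a b a' b' : e != 0 -> edge_at G e a b ->
  edge_at G e a' b' -> a = a' /\ b = b'.
Proof.
move=> e0 Gab Gab'.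
apply: (@edge_inj _ _ _ _ e) => //; [by case: Gab|by case: Gab'|].
exact: germ_at_unique (edge_at_germ Gab) (edge_at_germ Gab').
Qed.

(** Finiteness of the breaks of G: [E] contains a nonzero vector on every line that carries one.
    Such a list may be too long, so the same [E] can serve all the points of the plane at once. *)
Definition fan (E : seq V) G := homogeneous G /\
  forall e, e != 0 -> exists a b : 'rV[int]_2, edge_at G e (toR a) (toR b) /\
    (a != b -> exists2 u, u \in E & u != 0 /\ det2 u e = 0).

Definition gradients G e : V * V := xget (0, 0) [set ab | edge_at G e ab.1 ab.2].

Lemma gradientsE G e a b : e != 0 -> edge_at G e a b -> gradients G e = (a, b).
Proof.
move=> e0 Gab; apply: xget_unique => //= -[a' b'] /= Gab'.
by have [-> ->] := edge_at_unique e0 Gab' Gab.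
Qed.

(** The difference of the two gradients is this number times e rotated by a right angle. For a
    primitive integral e it is the weight of the edge, positive where G is convex. *)
Definition jump G e : R := pairing ((gradients G e).2 - (gradients G e).1) (nrm e).

Lemma jumpE G e a b : e != 0 -> edge_at G e a b ->
  jump G e = pairing (b - a) (nrm e).
Proof. by move=> e0 Gab; rewrite /jump (gradientsE e0 Gab). Qed.

Lemma jump_det2 G e a b h : e != 0 -> edge_at G e a b ->
  pairing b h - pairing a h = jump G e * det2 e h.
Proof. by move=> e0 Gab; rewrite (jumpE e0 Gab) -ortho_jump //; case: Gab. Qed.

Lemma jump_eq0 G e a b : e != 0 -> edge_at G e a b -> (jump G e == 0) = (a == b).
Proof.
move=> e0 Gab; apply/eqP/eqP => [j0|eab]; last first.
  by rewrite (jumpE e0 Gab) eab subrr pairing0l.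
apply: pairing_inj => h; apply/eqP; rewrite eq_sym -subr_eq0.
by rewrite (jump_det2 _ e0 Gab) j0 mul0r.
Qed.

Lemma edge_at_scale G e a b (k : R) : homogeneous G -> 0 < k ->
  edge_at G e a b -> edge_at G (k *: e) a b.
Proof.
move=> hG k0 [abe [r r0 Ge]]; split; first by rewrite !pairingZr abe.
exists (k * r) => [|h hr]; first exact: mulr_gt0.
have -> : k *: e + h = k *: (e + k^-1 *: h).
  by rewrite scalerDr scalerA divff ?gt_eqF // scale1r.
rewrite hG ?ltW // Ge; last first.
  by rewrite normrZ ger0_norm ?invr_ge0 ?ltW // mulrC ltr_pdivrMr // mulrC.
by rewrite /edge det2Zl pmulr_rge0 // det2Zr pmulr_rge0 // !pairingZr; case: ifP.
Qed.

Lemma nrmZ (k : R) e : 0 < k -> nrm (k *: e) = k^-1 *: nrm e.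
Proof.
move=> k0; have [->|e0] := eqVneq e 0.
  by apply: row2P; rewrite /nrm !mxE /=; ring.
have := sqnorm_neq0 e0 => N0; have k0' := lt0r_neq0 k0.
have Nk0 : (k * e 0 0) ^+ 2 + (k * e 0 1) ^+ 2 != 0.
  by rewrite !exprMn -mulrDr mulf_neq0 // expf_neq0.
by apply: row2P; rewrite /nrm !mxE /=; field; rewrite ?k0' ?N0 ?Nk0.
Qed.

Lemma jump_scale E G e (k : R) : fan E G -> e != 0 -> 0 < k ->
  jump G (k *: e) = k^-1 * jump G e.
Proof.
move=> [hG fG] e0 k0; have [a [b [Gab _]]] := fG e e0.
have ke0 : k *: e != 0 by rewrite scaler_eq0 negb_or e0 gt_eqF.
rewrite (jumpE ke0 (edge_at_scale hG k0 Gab)) (jumpE e0 Gab).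
by rewrite nrmZ // pairingZr.
Qed.

(* The self-intersection multiplicity at a vertex x is the sum of the ray_mult F x e over
   the rays e of the germ of F at x. *)
Definition ray_mult F x e : R := jump (germ F x) e * germ F x e.

Lemma edge_at_edge a b e : pairing a e = pairing b e -> edge_at (edge a b e) e a b.
Proof. by move=> abe; split=> //; exists 1. Qed.

Lemma edge_at_edgeN a b e : e != 0 -> pairing a e = pairing b e ->
  edge_at (edge a b e) (- e) b a.
Proof.
move=> e0 abe; split; first by rewrite !pairingNr abe.
by exists 1 => // h _; rewrite edgeN.
Qed.

Lemma det2_bound e : exists2 C, 0 < C & forall h, `|det2 e h| <= C * `|h|.
Proof.
have [C C0 hC] := pairing_bound (vec2 (- e 0 1) (e 0 0)); exists C => // h.
by have := hC h; rewrite pairing2 vec20 vec21 /det2 addrC mulNr.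
Qed.

Lemma edge_at_edge_off a b e h : det2 e h != 0 ->
  let c := if 0 <= det2 e h then b else a in edge_at (edge a b e) h c c.
Proof.
move=> eh c; split=> //; have [C C0 hC] := det2_bound e.
exists (`|det2 e h| / C) => [|k]; first by rewrite divr_gt0 // normr_gt0.
rewrite ltr_pdivlMr // mulrC => kC.
rewrite edge_same /edge det2Dr /c.
have := le_lt_trans (hC k) kC.
have [eh0|eh0] := leP 0 (det2 e h); last first.
  rewrite (ltr0_norm eh0) ltr_norml => /andP[_ lt_k].
  by rewrite leNgt; have -> : det2 e h + det2 e k < 0 by lra.
rewrite (ger0_norm eh0) ltr_norml => /andP[lt_k _].
by have -> : 0 <= det2 e h + det2 e k by lra.
Qed.

Lemma edge_fan (a b : 'rV[int]_2) e : e != 0 ->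
  pairing (toR a) e = pairing (toR b) e -> fan [:: e] (edge (toR a) (toR b) e).
Proof.
move=> e0 abe; split=> [|h h0]; first exact: edge_homogeneous.
have [eh|eh] := eqVneq (det2 e h) 0; last first.
  exists (if 0 <= det2 e h then b else a), (if 0 <= det2 e h then b else a).
  rewrite eqxx; split=> //.
  by have := edge_at_edge_off (toR a) (toR b) eh; case: ifP.
have [k hk] := parallel_det2 e0 eh.
have k0 : k != 0 by apply: contra h0 => /eqP k0; rewrite hk k0 scale0r.
have eE : exists2 u : V, u \in [:: e] & u != 0 /\ det2 u h = 0.
  by exists e; rewrite ?inE.
have [kneg|kpos|] := ltgtP k 0; last by move/eqP; rewrite (negPf k0).
  exists b, a; split=> //; rewrite hk -[k]opprK scaleNr -scalerN.
  apply: edge_at_scale; [exact: edge_homogeneous|by rewrite oppr_gt0|].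
  exact: edge_at_edgeN.
exists a, b; split=> //; rewrite hk; apply: edge_at_scale => //.
  exact: edge_homogeneous.
exact: edge_at_edge.
Qed.

(** A small punctured neighbourhood of x contains only edge points, possibly with equal slopes on
    both sides, and the edge through x + h has the direction h. Hence vertices are isolated. *)
Lemma germ_near E F x : germ_at F x (germ F x) -> fan E (germ F x) ->
  exists2 r, 0 < r & forall h, `|h| < r -> h != 0 ->
    exists a b : 'rV[int]_2, [/\ edge_at (germ F x) h (toR a) (toR b),
      germ_at F (x + h) (edge (toR a) (toR b) h),
      F (x + h) = F x + germ F x h
      & a != b -> exists2 u, u \in E & u != 0 /\ det2 u h = 0].
Proof.
move=> [hG [r r0 FG]] [_ fG]; exists r => // h hr h0.
have [a [b [Gab ab]]] := fG h h0; exists a, b; split=> //; last exact: FG.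
have [_ [d d0 Gd]] := edge_at_germ Gab.
split; first exact: edge_homogeneous.
exists (Num.min d (r - `|h|)); first by rewrite lt_min d0 subr_gt0.
move=> k; rewrite lt_min => /andP[kd kr].
have hkr : `|h + k| < r.
  by apply: le_lt_trans (ler_normD _ _) _; rewrite addrC -ltrBrDr.
by rewrite -addrA (FG (h + k)) // Gd // (FG h) // addrA.
Qed.

Definition pl_at F x := exists E, fan E (germ F x) /\ germ_at F x (germ F x).

Lemma germ_at_pl E F x G : germ_at F x G -> fan E G -> pl_at F x.
Proof. by move=> FG fG; exists E; rewrite (germE FG). Qed.

(* Along a ray the two opposite contributions at an inner point cancel. *)
Lemma ray_mult_near F x e : pl_at F x -> e != 0 ->
  exists2 r, 0 < r & forall d, 0 < d -> d < r ->
    ray_mult F (x + d *: e) e = ray_mult F x e /\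
    ray_mult F (x + d *: e) (- e) = - ray_mult F x e.
Proof.
move=> [E [fG gG]] e0; have [r r0 near_x] := germ_near gG fG.
have [k k0 small_k] := scale_small_le e r0; exists k => // d d0 dk.
have de0 : d *: e != 0 by rewrite scaler_eq0 negb_or e0 gt_eqF.
have [a [b [_ gd _ _]]] := near_x _ (small_k d (ltW d0) (ltW dk)) de0.
have [a' [b' [Gab' _]]] := fG.2 e e0.
have hG := gG.1.
have := near_x _ (small_k d (ltW d0) (ltW dk)) de0.
move=> {gd} [{}a [{}b [Gab gd _ _]]].
have [ea eb] := edge_at_unique de0 Gab (edge_at_scale hG d0 Gab').
have abe : pairing (toR a) e = pairing (toR b) e.
  by rewrite ea eb; case: Gab'.
have eE : edge (toR a) (toR b) (d *: e) = edge (toR a) (toR b) e.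
  by apply: funext => h; rewrite /edge det2Zl pmulr_rge0.
rewrite eE in gd.
have Ge : germ F x e = pairing (toR a) e by rewrite ea (edge_at_val Gab').
have Je : jump (germ F x) e = pairing (toR b - toR a) (nrm e).
  by rewrite (jumpE e0 Gab') ea eb.
rewrite /ray_mult (germE gd) Je Ge.
have Ne0 : - e != 0 by rewrite oppr_eq0.
rewrite (jumpE e0 (edge_at_edge abe)) (jumpE Ne0 (edge_at_edgeN e0 abe)).
rewrite (edge_at_val (edge_at_edge abe)) (edge_at_val (edge_at_edgeN e0 abe)).
rewrite nrmN pairingNr -pairingNl opprB; split=> //.
by rewrite pairingNr mulrN -abe.
Qed.

End Germs.

(** * Rational functions are piecewise linear with integral slopes *)

Section RationalGerms.
Context {R : realType}.
Local Notation V := 'rV[R]_2.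
Local Notation Z2 := 'rV[int]_2.
Implicit Types (e h x y : V) (F G f g : V -> R) (a b : Z2) (s : seq Z2).

Definition max_covectors a s h : R :=
  \big[Num.max/pairing (toR a) h]_(b <- s) pairing (toR b) h.

Lemma max_covectors_cons a b s h :
  max_covectors a (b :: s) h = Num.max (pairing (toR b) h) (max_covectors a s h).
Proof. by rewrite /max_covectors big_cons. Qed.

Lemma max_covectors_homogeneous a s : homogeneous (max_covectors a s).
Proof.
elim: s => [|b s IH] k h k0; first by rewrite /max_covectors !big_nil pairingZr.
by rewrite !max_covectors_cons IH // pairingZr maxr_pMr.
Qed.

Lemma max_covectors_ge a s h b : b \in a :: s ->
  pairing (toR b) h <= max_covectors a s h.
Proof.
elim: s => [|c s IH]; first by rewrite inE /max_covectors big_nil => /eqP->.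
rewrite max_covectors_cons le_max !in_cons orbCA => /orP[/eqP->|].
  by rewrite lexx.
by rewrite -in_cons => bs; rewrite IH ?orbT.
Qed.

Lemma max_covectors_mem a s h : exists2 b, b \in a :: s &
  max_covectors a s h = pairing (toR b) h.
Proof.
elim: s => [|c s [b bs IH]].
  by exists a; rewrite ?inE // /max_covectors big_nil.
rewrite max_covectors_cons IH.
have [_|_] := leP (pairing (toR c) h) (pairing (toR b) h).
  by exists b => //; move: bs; rewrite !inE orbCA => ->; rewrite orbT.
by exists c => //; rewrite !inE eqxx orbT.
Qed.

Lemma max_covectors_bound a s :
  exists2 C, 0 < C & forall h, `|max_covectors a s h| <= C * `|h|.
Proof.
elim: s => [|b s [C C0 IH]].
  have [C C0 hC] := pairing_bound (toR a : V); exists C => // h.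
  by rewrite /max_covectors big_nil.
have [D D0 hD] := pairing_bound (toR b : V); exists (C + D) => [|h].
  exact: addr_gt0.
rewrite max_covectors_cons mulrDl.
have [_|_] := leP (pairing (toR b) h) (max_covectors a s h).
  by rewrite (le_trans (IH h)) // lerDl mulr_ge0 // ltW.
by rewrite (le_trans (hD h)) // lerDr mulr_ge0 // ltW.
Qed.

(** A strict inequality survives perturbations of linear growth; this discards the terms of a
    maximum that are not active at the point. *)
Lemma lt_near0 (u v : V -> R) (p q C D : R) : p < q -> 0 < C -> 0 < D ->
  (forall h, `|u h| <= C * `|h|) -> (forall h, `|v h| <= D * `|h|) ->
  exists2 r, 0 < r & forall h, `|h| < r -> p + u h < q + v h.
Proof.
move=> pq C0 D0 uC vD; have CD0 : 0 < C + D by exact: addr_gt0.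
exists ((q - p) / (C + D)) => [|h]; first by rewrite divr_gt0 // subr_gt0.
rewrite ltr_pdivlMr // mulrDr => hh.
have := uC h; have := vD h; rewrite !ler_norml => /andP[v1 _] /andP[_ u2].
by move: v1 u2 hh; rewrite ![_ * `|h|]mulrC; lra.
Qed.

Lemma edge_at_max G1 G2 e a1 b1 a2 b2 : e != 0 ->
  edge_at G1 e (toR a1) (toR b1) -> edge_at G2 e (toR a2) (toR b2) ->
  exists a b, [/\ a \in [:: a1; b1; a2; b2], b \in [:: a1; b1; a2; b2],
    (a, b) = (a1, b1) \/ ((a, b) = (a2, b2) \/ pairing (toR a1) e = pairing (toR a2) e)
    & edge_at (fun h => Num.max (G1 h) (G2 h)) e (toR a) (toR b)].
Proof.
move=> e0; suff main G3 G4 a3 b3 a4 b4 : edge_at G3 e (toR a3) (toR b3) ->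
    edge_at G4 e (toR a4) (toR b4) -> G4 e < G3 e ->
    edge_at (fun h => Num.max (G3 h) (G4 h)) e (toR a3) (toR b3).
  move=> E1 E2; have [lt12|lt21|eq12] := ltgtP (G1 e) (G2 e).
  - exists a2, b2; split; rewrite ?inE ?eqxx ?orbT //; first by right; left.
    have := main _ _ _ _ _ _ E2 E1 lt12.
    by rewrite (_ : (fun h => _) = (fun h => Num.max (G1 h) (G2 h))) //;
       apply: funext => h; rewrite maxC.
  - exists a1, b1; split; rewrite ?inE ?eqxx ?orbT //; first by left.
    exact: main E1 E2 lt21.
  (* Tie on e: the covectors agree on e, so their order on the left half-plane is that of their
     values at n, and on the right half-plane it is the opposite one. *)
  set n := nrm e.
  pose b := if pairing (toR b1) n < pairing (toR b2) n :> R then b2 else b1.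
  pose a := if pairing (toR a2) n < pairing (toR a1) n :> R then a2 else a1.
  exists a, b; move: (E1) (E2) => [ab1 [r1 r10 H1]] [ab2 [r2 r20 H2]].
  move: eq12; rewrite (edge_at_val E1) (edge_at_val E2) => eq12.
  split; rewrite ?inE; last 1 [idtac].
  - by rewrite /a; case: ifP; rewrite eqxx ?orbT.
  - by rewrite /b; case: ifP; rewrite eqxx ?orbT.
  - by right; right.
  split.
    by rewrite /a /b; case: ifP; case: ifP; rewrite -?ab1 -?ab2 ?eq12.
  exists (Num.min r1 r2) => [|h]; first by rewrite lt_min r10.
  rewrite lt_min => /andP[hr1 hr2]; rewrite H1 // H2 // /edge.
  have eqb : pairing (toR b1) e = pairing (toR b2) e by rewrite -ab1 -ab2.
  have jb := ortho_jump (e + h) e0 eqb; have ja := ortho_jump (e + h) e0 eq12.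
  case: ifP => [d0|/negbT].
    rewrite /b -/n; move: jb; rewrite pairingBl -/n => jb; case: ifP => [lt12|/negbT].
      apply/max_idPr; rewrite -subr_ge0 jb mulr_ge0 // subr_ge0 ltW //.
    rewrite -leNgt => le21; apply/max_idPl.
    rewrite -subr_le0 jb mulr_le0_ge0 // subr_le0 //.
  rewrite -ltNge => d0.
  rewrite /a -/n; move: ja; rewrite pairingBl -/n => ja; case: ifP => [lt12|/negbT].
    apply/max_idPr; rewrite -subr_ge0 ja nmulr_lge0 // subr_le0 ltW //.
  rewrite -leNgt => le21; apply/max_idPl.
  rewrite -subr_le0 ja nmulr_lle0 // subr_ge0 //.
move=> E3 E4 lt43; have [hG3 [r3 r30 H3]] := edge_at_germ E3.
have [hG4 [r4 r40 H4]] := edge_at_germ E4.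
have [C C0 hC] := edge_bound (toR a3 : V) (toR b3) e.
have [D D0 hD] := edge_bound (toR a4 : V) (toR b4) e.
have [r r0 hr] := lt_near0 lt43 D0 C0 hD hC.
have [abe [r5 r50 H5]] := E3.
split=> //; exists (Num.min r5 (Num.min r (Num.min r3 r4))) => [|h].
  by rewrite !lt_min r0 r30 r40 r50.
rewrite !lt_min => /and4P[hr5 hhr hr3 hr4].
by rewrite -H5 //; apply/max_idPl/ltW; rewrite H3 // H4 //; exact: hr.
Qed.

Lemma max_covectors_edge a s e : e != 0 -> exists b c,
  [/\ b \in a :: s, c \in a :: s & edge_at (max_covectors a s) e (toR b) (toR c)].
Proof.
move=> e0; elim: s => [|d s [b [c [bs cs IH]]]].
  exists a, a; rewrite !inE; split=> //; split=> //; exists 1 => // h _.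
  by rewrite edge_same /max_covectors big_nil.
have Ed : edge_at (pairing (toR d)) e (toR d) (toR d : V).
  by split=> //; exists 1 => // h _; rewrite edge_same.
have [b' [c' [b'P c'P _ E]]] := edge_at_max e0 Ed IH.
have sub u : u \in [:: d; d; b; c] -> u \in a :: d :: s.
  move: bs cs; rewrite !inE => bs cs /or4P[] /eqP->; rewrite ?eqxx ?orbT //.
    by move: bs => /orP[->|->]; rewrite ?orbT.
  by move: cs => /orP[->|->]; rewrite ?orbT.
exists b', c'; split; [exact: sub|exact: sub|].
rewrite (_ : max_covectors a (d :: s) =
  fun h => Num.max (pairing (toR d) h) (max_covectors a s h)) //.
by apply: funext => h; rewrite max_covectors_cons.
Qed.

Lemma toR_inj : injective (@toR R 1 2).
Proof. by move=> u v /rowP uv; apply/rowP => j; have := uv j; rewrite !mxE => /intr_inj. Qed.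

Lemma toRB a b : toR (a - b) = toR a - toR b :> V.
Proof. by rewrite /toR map_mxB. Qed.

Lemma toRD a b : toR (a + b) = toR a + toR b :> V.
Proof. by rewrite /toR map_mxD. Qed.

Lemma toRN a : toR (- a) = - toR a :> V.
Proof. by rewrite /toR map_mxN. Qed.

Lemma toR0 : toR 0 = 0 :> V.
Proof. by rewrite /toR map_mx0. Qed.

Lemma max_covectors_fan a s : exists E, fan E (max_covectors a s : V -> R).
Proof.
pose J (u : V) := vec2 (- u 0 1) (u 0 0).
(* A break between two of the covectors lies in the kernel of their difference, which is spanned by
   the rotation [J] of this difference. *)
exists [seq J (toR u.2 - toR u.1) | u <- allpairs pair (a :: s) (a :: s)].
split=> [|e e0]; first exact: max_covectors_homogeneous.
have [b [c [bs cs E]]] := max_covectors_edge a s e0.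
exists b, c; split=> // bc.
exists (J (toR c - toR b)).
  by apply: (map_f (fun u => J (toR u.2 - toR u.1)) (x := (b, c))); apply: allpairs_f.
split.
  apply: contra bc => /eqP J0; rewrite eq_sym -subr_eq0 -(inj_eq toR_inj) toRB toR0.
  have := congr1 (fun u : V => u 0 1) J0; have := congr1 (fun u : V => u 0 0) J0.
  rewrite vec20 vec21 !mxE => /eqP; rewrite oppr_eq0 => /eqP c1 c0.
  by apply/eqP/row2P; rewrite !mxE.
rewrite /J /det2 vec20 vec21.
case: E => /eqP; rewrite eq_sym -subr_eq0 -pairingBl pairing2 => /eqP bce _.
by rewrite mulNr -opprD addrC bce oppr0.
Qed.

Lemma fanB E1 E2 G1 G2 : fan E1 G1 -> fan E2 G2 ->
  fan (E1 ++ E2) (fun h => G1 h - G2 h).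
Proof.
move=> [hG1 f1] [hG2 f2]; split=> [k h k0|e e0].
  by rewrite hG1 // hG2 // mulrBr.
have [a1 [b1 [[ab1 [r1 r10 H1]] J1]]] := f1 e e0.
have [a2 [b2 [[ab2 [r2 r20 H2]] J2]]] := f2 e e0.
exists (a1 - a2), (b1 - b2); split; last first.
  move=> ab; have [eq1|/J1[u uE hu]] := eqVneq a1 b1; last first.
    by exists u => //; rewrite mem_cat uE.
  have [eq2|/J2[u uE hu]] := eqVneq a2 b2; last first.
    by exists u => //; rewrite mem_cat uE orbT.
  by rewrite eq1 eq2 eqxx in ab.
split; first by rewrite !toRB !pairingBl ab1 ab2.
exists (Num.min r1 r2) => [|h]; first by rewrite lt_min r10.
rewrite lt_min => /andP[hr1 hr2]; rewrite H1 // H2 // /edge !toRB !pairingBl.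
by case: ifP.
Qed.

Lemma germ_atB F1 F2 G1 G2 x : germ_at F1 x G1 -> germ_at F2 x G2 ->
  germ_at (fun y => F1 y - F2 y) x (fun h => G1 h - G2 h).
Proof.
move=> [hG1 [r1 r10 H1]] [hG2 [r2 r20 H2]]; split=> [k h k0|].
  by rewrite hG1 // hG2 // mulrBr.
exists (Num.min r1 r2) => [|h]; first by rewrite lt_min r10.
by rewrite lt_min => /andP[hr1 hr2]; rewrite H1 // H2 //; ring.
Qed.

Lemma germ_at_near F F' x G : (\forall y \near x, F y = F' y) ->
  germ_at F' x G -> germ_at F x G.
Proof.
move=> /nearE[e e0 FF'] [hG [r r0 H]]; split=> //.
exists (Num.min e r) => [|h]; first by rewrite lt_min e0.
rewrite lt_min => /andP[he hr]; rewrite FF' // H //.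
by rewrite -[in RHS](addr0 x) FF' ?normr0 // addr0.
Qed.

Lemma affine_fun_shift (m : Z2 * R) x h :
  affine_fun m (x + h) = affine_fun m x + pairing (toR m.1) h.
Proof. by rewrite /affine_fun pairingDr addrAC. Qed.

(** Terms strictly below the maximum at x disappear near x; the active ones contribute their linear
    parts. *)
Lemma bigmax_affine_germ (m : Z2 * R) (s : seq (Z2 * R)) x : exists a t,
  germ_at (fun y => \big[Num.max/affine_fun m y]_(i <- s) affine_fun i y) x
    (max_covectors a t).
Proof.
suff [a [t [r r0 H]]] : exists a t, exists2 r, 0 < r & forall h, `|h| < r ->
  \big[Num.max/affine_fun m (x + h)]_(i <- s) affine_fun i (x + h) =
  \big[Num.max/affine_fun m x]_(i <- s) affine_fun i x + max_covectors a t h.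
  exists a, t; split; first exact: max_covectors_homogeneous.
  by exists r.
elim: s => [|i s [a [t [r r0 IH]]]].
  exists m.1, [::], 1 => // h _.
  by rewrite !big_nil affine_fun_shift /max_covectors big_nil.
set B := \big[_/_]_(_ <- _) _ in IH *.
have [C C0 hC] := max_covectors_bound a t.
have [D D0 hD] := pairing_bound (toR i.1 : V).
have [lt12|lt21|eq12] := ltgtP (affine_fun i x) B.
- have [d d0 hd] := lt_near0 lt12 D0 C0 hD hC.
  exists a, t, (Num.min r d) => [|h]; first by rewrite lt_min r0.
  rewrite lt_min => /andP[hr hhd].
  rewrite !big_cons -/B IH // affine_fun_shift.
  by rewrite (max_idPr (ltW lt12)); apply/max_idPr/ltW/hd.
- have [d d0 hd] := lt_near0 lt21 C0 D0 hC hD.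
  exists i.1, [::], (Num.min r d) => [|h]; first by rewrite lt_min r0.
  rewrite lt_min => /andP[hr hhd].
  rewrite !big_cons -/B IH // affine_fun_shift /max_covectors big_nil.
  by rewrite (max_idPl (ltW lt21)); apply/max_idPl/ltW/hd.
exists a, (i.1 :: t), r => // h hr.
rewrite !big_cons -/B IH // affine_fun_shift max_covectors_cons eq12 maxxx.
by rewrite addr_maxr.
Qed.

Lemma regular_germ f x : regular_at f x -> exists a s, germ_at f x (max_covectors a s).
Proof.
move=> [_ [m [s fs]]]; have [a [t H]] := bigmax_affine_germ m s x.
by exists a, t; exact: germ_at_near fs H.
Qed.

Lemma rational_pl f x : rational_at f x -> pl_at f x.
Proof.
move=> [_ [g [k fgk]]].
have [/regular_germ[a [s ga]] /regular_germ[b [t kb]] _] := nbhs_singleton fgk.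
have [E1 f1] := max_covectors_fan a s; have [E2 f2] := max_covectors_fan b t.
apply: germ_at_pl (fanB f1 f2).
apply: germ_at_near (germ_atB ga kb).
by apply: filterS fgk => y [].
Qed.

Lemma Zaffine_germ f x : Zaffine_at f x -> exists a, germ_at f x (pairing (toR a)).
Proof.
move=> [m fm]; exists m.1; apply: (germ_at_near fm); split=> [k h _|].
  by rewrite pairingZr.
by exists 1 => // h _; exact: affine_fun_shift.
Qed.

Lemma germ_Zaffine f x a : germ_at f x (pairing (toR a)) -> Zaffine_at f x.
Proof.
move=> [_ [r r0 H]]; exists (a, f x - pairing (toR a) x).
apply/nearE; exists r => // h /H->.
by rewrite /affine_fun /= pairingDr; ring.
Qed.

End RationalGerms.

(** * The balancing condition *)

Section Balancing.
Context {R : realType}.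
Local Notation V := 'rV[R]_2.
Implicit Types (a b d e h k p x y : V) (F G : V -> R) (E : seq V) (S : seq R).

Lemma exists_notin (s : seq R) (a b : R) : a < b -> exists2 t, a < t < b & t \notin s.
Proof.
elim: s a b => [|c s IH] a b ab; first by exists ((a + b) / 2) => //; lra.
have [cm|mc] := leP c ((a + b) / 2).
  have [|t /andP[at_ tb] ts] := IH ((a + b) / 2) b; first lra.
  exists t; first lra.
  by rewrite inE negb_or ts andbT gt_eqF // (le_lt_trans cm).
have [|t /andP[at_ tb] ts] := IH a ((a + b) / 2); first lra.
exists t; first lra.
by rewrite inE negb_or ts andbT lt_eqF // (lt_trans tb).
Qed.

Lemma exists_transverse E : exists2 d, d != 0 &
  forall u, u \in E -> u != 0 -> det2 d u != 0.
Proof.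
have [t _ tE] := exists_notin [seq u 0 1 / u 0 0 | u : V <- E] ltr01.
exists (vec2 1 t).
  by apply/eqP => /(congr1 (fun u : V => u 0 0)); rewrite vec20 mxE => /eqP; rewrite oner_eq0.
move=> u uE u0; rewrite /det2 vec20 vec21 mul1r subr_eq0.
apply: contra tE => /eqP u1; apply/mapP; exists u => //.
have [u00|u00] := eqVneq (u 0 0) 0; last by rewrite u1 mulfK.
by case/eqP: u0; apply: row2P; rewrite mxE // u1 u00 mulr0.
Qed.

Lemma edge_at_agree G G' e a b :
  (exists2 r, 0 < r & forall h, `|h| < r -> G (e + h) = G' (e + h)) ->
  edge_at G' e a b -> edge_at G e a b.
Proof.
move=> [r r0 GG'] [abe [r' r'0 G'e]]; split=> //.
exists (Num.min r r'); first by rewrite lt_min r0.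
by move=> h; rewrite lt_min => /andP[hr hr']; rewrite GG' // G'e.
Qed.

Lemma edge_at_near G e a b : edge_at G e a b ->
  exists2 r, 0 < r & forall h, `|h| < r -> det2 e h != 0 ->
    let c := if 0 <= det2 e h then b else a in edge_at G (e + h) c c.
Proof.
move=> [abe [r r0 Ge]]; exists r => // h hr eh c.
apply: (@edge_at_agree _ (edge a b e)).
  exists (r - `|h|) => [|k kr]; first by rewrite subr_gt0.
  rewrite -addrA Ge //; apply: le_lt_trans (ler_normD _ _) _.
  by rewrite addrC -ltrBrDr.
have -> : c = if 0 <= det2 e (e + h) then b else a by rewrite det2Dr det2vv add0r.
by apply: edge_at_edge_off; rewrite det2Dr det2vv add0r.
Qed.

Lemma edge_at_linear_near G e a : edge_at G e a a ->
  exists2 r, 0 < r & forall h, `|h| < r -> edge_at G (e + h) a a.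
Proof.
move=> [_ [r r0 Ge]]; exists r => // h hr; split=> //.
exists (r - `|h|) => [|k kr]; first by rewrite subr_gt0.
rewrite -addrA Ge ?edge_same //; apply: le_lt_trans (ler_normD _ _) _.
by rewrite addrC -ltrBrDr.
Qed.

(** Seen from far away p is negligible: p + s d is s times a point close to d, near which G is
    linear. *)
Lemma edge_at_far G d p a : homogeneous G -> edge_at G d a a ->
  exists2 B : R, 0 < B & forall s, B <= s -> edge_at G (p + s *: d) a a.
Proof.
move=> hG /edge_at_linear_near[r r0 near_d].
exists (`|p| / r + 1) => [|s Bs]; first by rewrite ltr_wpDl // divr_ge0 // ltW.
have s0 : 0 < s by apply: lt_le_trans Bs; rewrite ltr_wpDl // divr_ge0 // ltW.
have -> : p + s *: d = s *: (d + s^-1 *: p).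
  by rewrite scalerDr scalerA divff ?gt_eqF // scale1r addrC.
apply: edge_at_scale => //; apply: near_d.
rewrite normrZ ger0_norm ?invr_ge0 1?ltW // mulrC ltr_pdivrMr // mulrC -ltr_pdivrMr //.
by apply: lt_le_trans Bs; rewrite ltrDl.
Qed.

Section Fan.
Variables (E : seq V) (G : V -> R) (d : V).
Hypothesis fG : fan E G.
Hypothesis d0 : d != 0.
Hypothesis dE : forall u, u \in E -> u != 0 -> det2 d u != 0.

Lemma fan_edge_at e : e != 0 -> exists a b, edge_at G e a b.
Proof. by move=> /fG.2[a [b [Gab _]]]; exists (toR a), (toR b). Qed.

Lemma fan_transverse (k : R) : k != 0 -> exists a, edge_at G (k *: d) a a.
Proof.
move=> k0; have kd0 : k *: d != 0 by rewrite scaler_eq0 negb_or k0.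
have [a [b [Gab ab]]] := fG.2 _ kd0.
have [eab|/ab[u uE [u0]]] := eqVneq a b; first by exists (toR a); rewrite {2}eab.
move/eqP; rewrite det2Zr mulf_eq0 (negPf k0) /= det2C oppr_eq0 => du.
by have := dE uE u0; rewrite du.
Qed.

(** Travelling along p + R d, which crosses the rays on one side of R d, the gradient of G passes
    from a' to a. Each jump is traversed from left to right or from right to left according to the
    side of p, hence the sign. *)
Lemma line_jumps a a' p S h : edge_at G d a a -> edge_at G (- d) a' a' ->
  det2 d p != 0 -> uniq S -> (forall s, jump G (p + s *: d) != 0 -> s \in S) ->
  \sum_(s <- S) jump G (p + s *: d) * det2 (p + s *: d) h =
    Num.sg (det2 d p) * pairing (a' - a) h.
Proof.
move=> Ga Ga' dp uS covS.
have z0 s : p + s *: d != 0.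
  by apply: contra dp => /eqP; rewrite addrC => /(congr1 (det2 d));
     rewrite det2Dr det2Zr det2vv mulr0 add0r => ->; rewrite /det2 !mxE; apply/eqP; ring.
have zd s : det2 (p + s *: d) d = - det2 d p.
  by rewrite det2Dl det2Zl det2vv mulr0 addr0 det2C.
(* [sel true] is the gradient just after the point when moving in the direction d, [sel false] the
   one just before. *)
pose sel (fwd : bool) s := let ab := gradients G (p + s *: d) in
  if (0 < det2 d p) == fwd then ab.1 else ab.2.
have loc t : exists2 e, 0 < e & forall l, 0 < l -> l < e ->
    [/\ sel true (t + l) = sel true t, sel false (t + l) = sel true t,
        sel true (t - l) = sel false t & sel false (t - l) = sel false t].
  have [u [v Guv]] := fan_edge_at (z0 t).
  have [r r0 near_t] := edge_at_near Guv.
  have [l l0 hl] := scale_small_le d r0; exists l => // m m0 ml.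
  have md := hl m (ltW m0) (ltW ml).
  have mdN : `|- (m *: d)| < r by rewrite normrN.
  have zm : det2 (p + t *: d) (m *: d) = - (m * det2 d p) by rewrite det2Zr zd mulrN.
  have := near_t _ md; have := near_t _ mdN.
  have mdp : m * det2 d p != 0 by rewrite mulf_neq0 ?(gt_eqF m0).
  rewrite !det2Nr zm opprK oppr_eq0 mdp => /(_ isT) EN /(_ isT) EP.
  have zP : p + (t + m) *: d = p + t *: d + m *: d by rewrite scalerDl addrA.
  have zN : p + (t - m) *: d = p + t *: d - m *: d by rewrite scalerBl addrA.
  have zP0 := z0 (t + m); have zN0 := z0 (t - m).
  rewrite /sel zP zN; rewrite zP in zP0; rewrite zN in zN0.
  rewrite (gradientsE zP0 EP) (gradientsE zN0 EN) (gradientsE (z0 t) Guv) /=.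
  rewrite !if_same oppr_ge0 !pmulr_rge0 // pmulr_rle0 //.
  have [dp0|dp0|dp0] := ltgtP (det2 d p) 0; last by rewrite dp0 eqxx in dp.
    split=> //. 
  by [].
have [B1 B10 far1] := edge_at_far p fG.1 Ga.
have [B2 B20 far2] := edge_at_far p fG.1 Ga'.
(* Outside [-B, B] the gradient is already a or a', so all the jumps lie inside. *)
pose B := Num.max B1 B2.
have B0 : 0 < B by rewrite lt_max B10.
have far s : B <= s -> gradients G (p + s *: d) = (a, a).
  by rewrite ge_max => /andP[B1s _]; apply: gradientsE => //; exact: far1.
have farN s : s <= - B -> gradients G (p + s *: d) = (a', a').
  rewrite lerNr ge_max => /andP[_ B2s]; apply: gradientsE => //.
  by have := far2 _ B2s; rewrite scalerN scaleNr opprK.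
have [|S' [uS' _ covS' sumS']] := telescope_jumps loc (a := - B) (b := B).
  by rewrite gtrN.
rewrite (sum_over_support uS uS') => [|s]; last first.
  rewrite mulf_eq0 negb_or => /andP[js _]; rewrite covS //.
  apply/esym/negPn/negP => sS'.
  have [sB|Bs] := ltP (- B) s; last first.
    by move: js; rewrite /jump farN // subrr pairing0l eqxx.
  have [sB'|Bs] := ltP s B; last first.
    by move: js; rewrite /jump far // subrr pairing0l eqxx.
  have := covS' s; rewrite sB sB' => /(_ isT sS').
  have [u [v Guv]] := fan_edge_at (z0 s).
  rewrite /sel (gradientsE (z0 s) Guv) /=.
  move: js; rewrite (jump_eq0 (z0 s) Guv) => /eqP uv.
  by case: (0 < det2 d p) => [/uv|/esym/uv].
have := congr1 (fun w => pairing w h) sumS'.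
rewrite /sel far // farN // !if_same.
have -> : forall (s : seq R) (f : R -> V),
    pairing (\sum_(t <- s) f t) h = \sum_(t <- s) pairing (f t) h.
  move=> s f; elim: s => [|t s IH]; first by rewrite !big_nil pairing0l.
  by rewrite !big_cons pairingDl IH.
move=> eq_sum; have [dp0|dp0|dp0] := ltgtP (det2 d p) 0; last by rewrite dp0 eqxx in dp.
  rewrite ltr0_sg // mulN1r -pairingNl opprB -eq_sum; apply: eq_bigr => s _.
  have [u [v Guv]] := fan_edge_at (z0 s).
  rewrite -(jump_det2 h (z0 s) Guv) (gradientsE (z0 s) Guv) /= pairingBl.
  by rewrite (lt_gtF dp0).
rewrite gtr0_sg // mul1r -opprB pairingNl -eq_sum -sumrN; apply: eq_bigr => s _.
have [u [v Guv]] := fan_edge_at (z0 s).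
rewrite -(jump_det2 h (z0 s) Guv) (gradientsE (z0 s) Guv) /= pairingBl.
by rewrite dp0 opprB.
Qed.

(** Affine chart on the lines transverse to d: each contains exactly one vector of this form. *)
Definition ray (s : R) : V := nrm d + s *: d.

Lemma det2_ray s : det2 d (ray s) = 1.
Proof. by rewrite det2Dr det2Zr det2vv mulr0 addr0 det2_nrm. Qed.

Lemma ray_neq0 s : ray s != 0.
Proof.
apply/eqP => r0; have := det2_ray s.
by rewrite r0 /det2 !mxE !mulr0 subrr => /eqP; rewrite eq_sym oner_eq0.
Qed.

Lemma det2_rays s t : det2 (ray t) (ray s) = t - s.
Proof.
have : det2 (ray t) (ray s) = (t - s) * det2 d (nrm d).
  by rewrite /ray; move: (nrm d) => n; rewrite /det2 !mxE; ring.
by rewrite det2_nrm // mulr1.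
Qed.

(** The two lines parallel to d through [nrm d] and [- nrm d] meet every ray that carries a jump
    exactly once between them. On both the gradient passes from a' to a, and the two totals enter
    with opposite signs. *)
Lemma balancing S c : uniq S ->
  (forall e, e != 0 -> jump G e != 0 -> exists2 s, s \in S & det2 (ray s) e = 0) ->
  \sum_(s <- S) (jump G (ray s) - jump G (- ray s)) * pairing c (ray s) = 0.
Proof.
move=> uS covS.
have [a Ga] := fan_transverse (oner_neq0 R); rewrite scale1r in Ga.
have [a' Ga'] : exists a', edge_at G (- d) a' a'.
  have [|b Gb] := @fan_transverse (- 1); first by rewrite oppr_eq0 oner_eq0.
  by exists b; rewrite -scaleN1r.
(* With this rotation of c, pairing with c becomes [det2] with h, the form in which [line_jumps]
   sums the jumps. *)
pose h := vec2 (- c 0 1) (c 0 0).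
have ch z : pairing c z = det2 z h.
  by rewrite /det2 vec20 vec21 pairing2; ring.
have dn : det2 d (nrm d) = 1 by exact: det2_nrm.
have dnN : det2 d (- nrm d) = - 1 by rewrite det2Nr dn.
have := @line_jumps a a' (nrm d) S h Ga Ga'.
rewrite dn oner_neq0 sgr1 mul1r => /(_ isT uS) L1.
have := @line_jumps a a' (- nrm d) [seq - s | s <- S] h Ga Ga'.
rewrite dnN oppr_eq0 oner_neq0 map_inj_uniq; last exact: oppr_inj.
rewrite sgrN sgr1 mulN1r => /(_ isT uS) L2.
rewrite (eq_bigr (fun s => jump G (ray s) * det2 (ray s) h
   + jump G (- ray s) * det2 (- ray s) h)); last first.
  by move=> s _; rewrite ch det2Nl mulrN -mulrBl.
rewrite big_split /= {1}/ray L1; last first.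
  move=> s js; have [t tS] := covS _ (ray_neq0 s) js.
  by rewrite det2_rays => /eqP; rewrite subr_eq0 => /eqP<-.
rewrite big_map in L2.
rewrite [X in _ + X](_ : _ = - pairing (a' - a) h) ?subrr //.
rewrite -L2; last first.
  move=> s js; rewrite -[s]opprK map_f //.
  have zE : - nrm d + s *: d = - ray (- s) by rewrite /ray opprD scaleNr opprK.
  rewrite zE in js.
  have rN0 : - ray (- s) != 0 by rewrite oppr_eq0 ray_neq0.
  have [t tS] := covS _ rN0 js.
  by rewrite det2Nr det2_rays => /eqP; rewrite oppr_eq0 subr_eq0 => /eqP<-.
by apply: eq_bigr => s _; rewrite /ray opprD scaleNr.
Qed.

End Fan.
End Balancing.

Section GermDirections.
Context {R : realType}.
Local Notation V := 'rV[R]_2.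
Implicit Types (a b d e h x y z : V) (F G : V -> R).

Lemma germ_at_dir F x G h (c : R) : germ_at F x G ->
  (exists2 r, 0 < r & forall t, 0 < t -> t < r -> F (x + t *: h) = F x + t * c) ->
  G h = c.
Proof.
move=> [hG [r r0 FG]] [r' r'0 H].
have [k k0 kh] := scale_small_le h r0.
pose t := Num.min k r' / 2.
have m0 : 0 < Num.min k r' by rewrite lt_min k0.
have t0 : 0 < t by rewrite divr_gt0.
have tm : t < Num.min k r' by rewrite /t; lra.
move: tm; rewrite lt_min => /andP[tk tr].
apply: (mulfI (lt0r_neq0 t0)); rewrite -hG ?(ltW t0) //.
by apply: (@addrI _ (F x)); rewrite -FG ?H // kh // ltW.
Qed.

(** At a point close to x on the ray of e, F is affine along e on both sides. Applied to e and to -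
    e, this is the local hypothesis of [telescope_jumps] for slopes along a line. *)
Lemma slope_near F x e : pl_at F x -> e != 0 ->
  exists2 r, 0 < r & forall t, 0 < t -> t < r ->
    germ F (x + t *: e) e = germ F x e /\
    germ F (x + t *: e) (- e) = - germ F x e.
Proof.
move=> [E [fG gG]] e0; have [r r0 near_x] := germ_near gG fG.
have [k k0 small_k] := scale_small_le e r0; exists k => // t t0 tk.
have te0 : t *: e != 0 by rewrite scaler_eq0 negb_or e0 gt_eqF.
have [a [b [[abe _] gt_ _ _]]] := near_x _ (small_k t (ltW t0) (ltW tk)) te0.
rewrite (germE gt_).
have Ft s : 0 <= s -> s < k -> F (x + s *: e) = F x + s * germ F x e.
  rewrite le_eqVlt => /orP[/eqP<- _|s0 sk]; first by rewrite scale0r addr0 mul0r addr0.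
  have se0 : s *: e != 0 by rewrite scaler_eq0 negb_or e0 gt_eqF.
  have [_ [_ [_ _ -> _]]] := near_x _ (small_k s (ltW s0) (ltW sk)) se0.
  by rewrite -(gG.1 _ _ (ltW s0)).
have key (s : R) : - t < s < k - t -> F (x + t *: e + s *: e) = F (x + t *: e) + s * germ F x e.
  move=> /andP[s1 s2]; rewrite -addrA -scalerDl.
  have [st0|st0] := leP 0 (t + s); last lra.
  by rewrite !Ft ?(ltW t0) //; [ring|lra].
split.
  apply: germ_at_dir gt_ _; exists (k - t) => [|s s0 sk]; first by rewrite subr_gt0.
  by apply: key; lra.
apply: germ_at_dir gt_ _; exists t => // s s0 st.
by rewrite scalerN -scaleNr key ?mulrN ?mulNr //; lra.
Qed.

End GermDirections.
Local Open Scope quotient_scope.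
Local Open Scope ring_scope.

(* The projection to the torus as a constant, so that its occurrences coming from
   different definitions are syntactically equal. *)
Definition tproj {R : realType} (B : 'M[R]_2) (x : 'rV[R]_2) : torus B :=
  \pi_(torus B) x.

Section Unfolding.
Context {R : realType} (B : 'M[R]_2) (D : local_data B).
Local Notation proj := (tproj B).

Lemma regular_onE U (f : torus B -> R) :
  regular_on U f = forall x, U (proj x) -> regular_at (f \o proj) x.
Proof. by []. Qed.

Lemma rational_onE U (f : torus B -> R) :
  rational_on U f = forall x, U (proj x) -> rational_at (f \o proj) x.
Proof. by []. Qed.

Lemma induced_byE F : induced_by D F = forall U f, D (U, f) ->
  forall x, U (proj x) -> Zaffine_at (fun y => F y - f (proj y)) x.
Proof. by []. Qed.

Lemma support_liftE : support_lift D = [set x | exists U f,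
  [/\ D (U, f), U (proj x) & ~ Zaffine_at (f \o proj) x]].
Proof. by []. Qed.

Lemma facetE x w u : facet D x w u = exists U f (a b : 'rV[int]_2),
  [/\ D (U, f) /\ U (proj x), a != b,
      b - a = (lattice_length (b - a))%:Z *: u
    & ((\forall y \near x, f (proj y) = f (proj x) +
          Num.max (pairing (toR a) (y - x)) (pairing (toR b) (y - x))) /\
       w = (lattice_length (b - a))%:Z)
   \/ ((\forall y \near x, f (proj y) = f (proj x) +
          Num.min (pairing (toR a) (y - x)) (pairing (toR b) (y - x))) /\
       w = - (lattice_length (b - a))%:Z)].
Proof. by []. Qed.

End Unfolding.

Lemma det_mx2 (A : comNzRingType) (M : 'M[A]_2) :
  \det M = M 0 0 * M 1 1 - M 0 1 * M 1 0.
Proof.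
rewrite (expand_det_row _ 0) !big_ord_recl big_ord0 addr0 /cofactor !det_mx11 !mxE.
have -> : lift ord0 ord0 = 1 :> 'I_2 by exact: val_inj.
have -> : lift (1 : 'I_2) 0 = 0 :> 'I_2 by exact: val_inj.
by rewrite /= expr0 expr1 mul1r mulN1r mulrN.
Qed.

(** * Facets *)

Section Facets.
Context {R : realType}.
Local Notation V := 'rV[R]_2.
Local Notation Z2 := 'rV[int]_2.
Implicit Types (e h x y : V) (F G : V -> R) (a b u : Z2) (w : int).

Lemma lattice_length_dvd (c : Z2) : exists u, c = (lattice_length c)%:Z *: u.
Proof.
exists (\row_j divz (c 0 j) (lattice_length c)%:Z); apply/rowP => j.
rewrite !mxE mulrC divzK // dvdzE absz_nat.
by rewrite /lattice_length (biggcdn_inf j).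
Qed.

Lemma lattice_length_gt0 (c : Z2) : c != 0 -> (0 < lattice_length c)%N.
Proof.
apply: contraNT; rewrite -eqn0Ngt => /eqP c0.
by have [u ->] := lattice_length_dvd c; rewrite c0 scale0r.
Qed.

Definition max2 a b (h : V) : R := Num.max (pairing (toR a) h) (pairing (toR b) h).
Definition min2 a b (h : V) : R := Num.min (pairing (toR a) h) (pairing (toR b) h).

Lemma max2_homogeneous a b : homogeneous (max2 a b).
Proof. by move=> k h k0; rewrite /max2 !pairingZr maxr_pMr. Qed.

Lemma min2_homogeneous a b : homogeneous (min2 a b).
Proof. by move=> k h k0; rewrite /min2 !pairingZr minr_pMr. Qed.

Lemma max2D a b m h : max2 (a + m) (b + m) h = max2 a b h + pairing (toR m) h.
Proof. by rewrite /max2 !toRD !pairingDl addr_maxl. Qed.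

Lemma min2D a b m h : min2 (a + m) (b + m) h = min2 a b h + pairing (toR m) h.
Proof. by rewrite /min2 !toRD !pairingDl addr_minl. Qed.

Lemma germ_at_nearE F x G : homogeneous G ->
  germ_at F x G <-> \forall y \near x, F y = F x + G (y - x).
Proof.
have xh h : x + h - x = h by rewrite addrAC subrr add0r.
move=> hG; split=> [[_ [r r0 H]]|/nearE[r r0 H]].
  by apply/nearE; exists r => // h /H->; rewrite xh.
by split=> //; exists r => // h /H; rewrite xh.
Qed.

Section Divisor.
Context (B : 'M[R]_2) (D : local_data B) (F : V -> R).
Local Notation proj := (tproj B).
Hypothesis coverD : forall p : torus B, exists U f, D (U, f) /\ U p.
Hypothesis indF : induced_by D F.

(** F and a local equation differ by a Z-affine function, so their germs differ by one integral
    covector, the same for every candidate G. *)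
Lemma germ_induced U f x : D (U, f) -> U (proj x) -> exists m : Z2,
  forall G, germ_at F x (fun h => G h + pairing (toR m) h) <-> germ_at (f \o proj) x G.
Proof.
move: indF; rewrite induced_byE => ind.
move=> DUf Ux; have [m /nearE[e e0 Fm]] := ind _ _ DUf _ Ux.
exists m.1 => G.
have Fx : F x - f (proj x) = affine_fun m x.
  by have := Fm 0; rewrite normr0 addr0; apply.
split=> -[hG [r r0 H]]; (split;
    [move=> k h k0|exists (Num.min e r); [by rewrite lt_min e0|move=> h]]).
- by have := hG k h k0; rewrite pairingZr mulrDr => /addIr.
- rewrite lt_min => /andP[he hr] /=; have := Fm h he.
  rewrite H // affine_fun_shift -Fx => E.
  by move: (f (proj (x + h))) (f (proj x)) (F x) (G h) (pairing _ _) E => *; lra.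
- by rewrite hG // pairingZr mulrDr.
rewrite lt_min => /andP[he hr] /=; have E1 := Fm h he; have /= E2 := H h hr.
rewrite E2 affine_fun_shift -Fx in E1.
by move: (F (x + h)) (f (proj x)) (F x) (G h) (pairing _ _) E1 => *; lra.
Qed.

Lemma support_liftP x : support_lift D x <-> ~ Zaffine_at F x.
Proof.
rewrite support_liftE; split=> [[U [f [DUf Ux nZ]]] ZF|nZ].
  apply: nZ; have [a Fa] := Zaffine_germ ZF; have [m Fm] := germ_induced DUf Ux.
  apply: (@germ_Zaffine _ _ _ (a - m)); apply/Fm.
  rewrite (_ : (fun h => _) = pairing (toR a)) //; apply: funext => h.
  by rewrite toRB pairingBl subrK.
have [U [f [DUf Ux]]] := coverD (proj x); exists U, f; split=> // /Zaffine_germ[a fa].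
apply: nZ; have [m Fm] := germ_induced DUf Ux.
apply: (@germ_Zaffine _ _ _ (a + m)).
rewrite (_ : pairing _ = fun h => pairing (toR a) h + pairing (toR m) h); first exact/Fm.
by apply: funext => h; rewrite toRD pairingDl.
Qed.

Lemma facetP x w u : facet D x w u <-> exists a b, [/\ a != b,
  b - a = (lattice_length (b - a))%:Z *: u
  & germ_at F x (max2 a b) /\ w = (lattice_length (b - a))%:Z \/
    germ_at F x (min2 a b) /\ w = - (lattice_length (b - a))%:Z].
Proof.
have shift a b m : (b + m) - (a + m) = b - a by rewrite opprD addrACA subrr addr0.
rewrite facetE; split=> [[U [f [a [b [[DUf Ux] ab bau fab]]]]]|[a [b [ab bau Fab]]]].
  have [m Fm] := germ_induced DUf Ux; exists (a + m), (b + m).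
  rewrite shift (inj_eq (addIr m)); split=> //.
  case: fab => -[fab ->]; [left|right]; split=> //.
    rewrite (_ : max2 _ _ = fun h => max2 a b h + pairing (toR m) h).
      by apply/Fm/germ_at_nearE => //; exact: max2_homogeneous.
    by apply: funext => h; rewrite max2D.
  rewrite (_ : min2 _ _ = fun h => min2 a b h + pairing (toR m) h).
    by apply/Fm/germ_at_nearE => //; exact: min2_homogeneous.
  by apply: funext => h; rewrite min2D.
have [U [f [DUf Ux]]] := coverD (proj x); have [m Fm] := germ_induced DUf Ux.
exists U, f, (a - m), (b - m); rewrite shift (inj_eq (addIr (- m))); split=> //.
case: Fab => -[Fab ->]; [left|right]; split=> //.
  suff : germ_at (f \o proj) x (max2 (a - m) (b - m)).
    by move/germ_at_nearE; apply; exact: max2_homogeneous.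
  apply/Fm; rewrite (_ : (fun h => _) = max2 a b) //.
  by apply: funext => h; rewrite -max2D !subrK.
suff : germ_at (f \o proj) x (min2 (a - m) (b - m)).
  by move/germ_at_nearE; apply; exact: min2_homogeneous.
apply/Fm; rewrite (_ : (fun h => _) = min2 a b) //.
by apply: funext => h; rewrite -min2D !subrK.
Qed.

(** Adding the values at h and - h cancels linear forms and forgets the orientation of the edge;
    what is left measures the jump. Edge germs are compared through it. *)
Lemma max2_fold a b e (j : R) : (forall h, pairing (toR b) h - pairing (toR a) h = j * det2 e h) ->
  forall h, max2 a b h + max2 a b (- h) = `|j| * `|det2 e h|.
Proof.
move=> J h; rewrite -normrM -J /max2 !pairingNr.
move: (pairing (toR a) h) (pairing (toR b) h) => p q.
have [pq|/ltW qp] := leP p q.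
  by rewrite (max_idPl _) ?lerN2 // ger0_norm ?subr_ge0.
by rewrite (max_idPr _) ?lerN2 // ler0_norm ?subr_le0 // opprB.
Qed.

Lemma min2_opp a b h : min2 a b h = - max2 (- a) (- b) h.
Proof. by rewrite /min2 /max2 !toRN !pairingNl oppr_max !opprK. Qed.

Lemma min2_fold a b e (j : R) : (forall h, pairing (toR b) h - pairing (toR a) h = j * det2 e h) ->
  forall h, min2 a b h + min2 a b (- h) = - (`|j| * `|det2 e h|).
Proof.
move=> J h; rewrite !min2_opp -opprD (@max2_fold _ _ e (- j)) ?normrN // => k.
by rewrite !toRN !pairingNl opprK addrC -[X in X = _]opprB J mulNr.
Qed.

Lemma edge_fold (a b : V) e h : e != 0 -> pairing a e = pairing b e ->
  edge a b e h + edge a b e (- h) = pairing (b - a) (nrm e) * `|det2 e h|.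
Proof.
move=> e0 abe; have J := ortho_jump h e0 abe.
rewrite /edge det2Nr oppr_ge0 !pairingNr; move: J.
have [dh|dh|dh] := ltgtP (det2 e h) 0.
- by rewrite ltr0_norm // => J; rewrite mulrN -J; ring.
- by rewrite gtr0_norm // => <-.
by rewrite dh normr0 mulr0 subrr.
Qed.

Lemma max2_edge a b (e : V) : e != 0 -> pairing (toR a) e = pairing (toR b) e ->
  0 <= pairing (toR b - toR a) (nrm e) -> edge (toR a) (toR b) e = max2 a b.
Proof.
move=> e0 abe j0; apply: funext => h; have J := ortho_jump h e0 abe.
rewrite /edge /max2; case: ifP => [dh|/negbT].
  by apply/esym/max_idPr; rewrite -subr_ge0 J mulr_ge0.
rewrite -ltNge => dh; apply/esym/max_idPl.
by rewrite -subr_le0 J mulr_ge0_le0 // ltW.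
Qed.

Lemma min2_edge a b (e : V) : e != 0 -> pairing (toR a) e = pairing (toR b) e ->
  pairing (toR b - toR a) (nrm e) <= 0 -> edge (toR a) (toR b) e = min2 a b.
Proof.
move=> e0 abe j0; apply: funext => h; have J := ortho_jump h e0 abe.
rewrite /edge /min2; case: ifP => [dh|/negbT].
  by apply/esym/min_idPr; rewrite -subr_le0 J mulr_le0_ge0.
rewrite -ltNge => dh; apply/esym/min_idPl.
by rewrite -subr_ge0 J mulr_le0 // ltW.
Qed.

Lemma edge_facet x e a b : e != 0 -> pairing (toR a) e = pairing (toR b) e -> a != b ->
  germ_at F x (edge (toR a) (toR b) e) -> exists w u, facet D x w u.
Proof.
move=> e0 abe ab Fe; have [u bau] := lattice_length_dvd (b - a).
have [j0|j0] := leP 0 (pairing (toR b - toR a) (nrm e)).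
  exists (lattice_length (b - a))%:Z, u; apply/facetP; exists a, b; split=> //.
  by left; rewrite -(max2_edge e0).
exists (- (lattice_length (b - a))%:Z), u; apply/facetP; exists a, b; split=> //.
by right; rewrite -(min2_edge e0) // ltW.
Qed.

(** The direction of the edge between a and b, scaled so that the jump from a to b across it is
    exactly 1. *)
Definition normal_ray a b : V := vec2 (toR (b - a) 0 1) (- toR (b - a) 0 0).

Lemma normal_ray_neq0 a b : a != b -> normal_ray a b != 0.
Proof.
apply: contraNneq => e0; rewrite eq_sym -subr_eq0 -(inj_eq (@toR_inj R)) toR0.
have := congr1 (fun u : V => u 0 1) e0; have := congr1 (fun u : V => u 0 0) e0.
rewrite vec20 vec21 ![(0 : V) _ _]mxE => c1 /eqP; rewrite oppr_eq0 => /eqP c0.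
by apply/eqP/row2P; rewrite ?c0 ?c1 mxE.
Qed.

Lemma normal_ray_jump a b h :
  pairing (toR b) h - pairing (toR a) h = 1 * det2 (normal_ray a b) h.
Proof. by rewrite mul1r -pairingBl -toRB /det2 vec20 vec21 pairing2; ring. Qed.

Lemma facet_edge x w u : facet D x w u -> exists a b e,
  [/\ a != b, e != 0, pairing (toR a) e = pairing (toR b) e
    & germ_at F x (edge (toR a) (toR b) e)].
Proof.
move=> /facetP[a [b [ab _ Fab]]]; have e0 := normal_ray_neq0 ab.
have J := normal_ray_jump a b.
have abe : pairing (toR a) (normal_ray a b) = pairing (toR b) (normal_ray a b).
  by apply/eqP; rewrite eq_sym -subr_eq0 J det2vv mulr0.
have j1 : pairing (toR b - toR a) (nrm (normal_ray a b)) = 1.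
  by rewrite pairingBl J det2_nrm ?mulr1.
case: Fab => -[Fab _].
  by exists a, b, (normal_ray a b); split=> //; rewrite max2_edge // j1 ler01.
exists b, a, (normal_ray a b); split=> //; first by rewrite eq_sym.
rewrite min2_edge //; last by rewrite -opprB pairingNl j1 oppr_le0 ler01.
by rewrite (_ : min2 b a = min2 a b) //; apply: funext => h; rewrite /min2 minC.
Qed.

(** Facet data are not unique: u can be replaced by - u. Whatever they are, they are tied to any
    description of the germ by a direction e and a jump j: s is the sign of w, l the lattice length,
    and l u is a multiple of e rotated. *)
Lemma facet_jump x w u G e (j : R) : e != 0 -> facet D x w u -> germ_at F x G ->
  (forall h, G h + G (- h) = j * `|det2 e h|) ->
  exists s l : R, [/\ `|s| = 1, 0 < l & w%:~R = s * l] /\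
    exists k, (forall h, l * pairing (toR u) h = k * det2 e h) /\ j = s * `|k|.
Proof.
move=> e0 /facetP[a [b [ab bau Fab]]] FG Gj.
set L := lattice_length (b - a) in bau Fab.
have L0 : 0 < L%:~R :> R by rewrite ltr0n lattice_length_gt0 // subr_eq0 eq_sym.
have uE h : L%:~R * pairing (toR u) h = pairing (toR b) h - pairing (toR a) h.
  by rewrite -pairingBl -toRB bau !pairing2 !mxE !intrM; ring.
have main (s : R) (H : V -> R) : `|s| = 1 -> germ_at F x H ->
   (forall e' (j' : R), (forall h, pairing (toR b) h - pairing (toR a) h = j' * det2 e' h) ->
     forall h, H h + H (- h) = s * (`|j'| * `|det2 e' h|)) ->
   exists k, (forall h, L%:~R * pairing (toR u) h = k * det2 e h) /\ j = s * `|k|.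
  move=> s1 FH HJ; have GH := germ_at_unique FG FH; rewrite GH in Gj.
  have e'0 := normal_ray_neq0 ab; have J' := normal_ray_jump a b.
  have abe : pairing (toR a) e = pairing (toR b) e.
    apply/eqP; rewrite eq_sym -subr_eq0 J' mul1r -normr_eq0.
    have := HJ _ _ J' e; rewrite Gj det2vv normr0 mulr0 normr1 mul1r => /esym/eqP.
    by rewrite mulf_eq0 -normr_eq0 s1 oner_eq0.
  have Je h := ortho_jump h e0 abe.
  exists (pairing (toR b - toR a) (nrm e)); split=> [h|]; first by rewrite uE.
  have := HJ _ _ Je (nrm e); rewrite Gj det2_nrm // normr1 !mulr1 //.
case: Fab => -[Fab ->].
  exists 1, L%:~R; split; first by rewrite normr1 mul1r.
  apply: main Fab _ => [|e' j' J h]; first by rewrite normr1.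
  by rewrite mul1r (max2_fold J).
exists (- 1), L%:~R; split; first by rewrite normrN1 mulN1r rmorphN.
apply: main Fab _ => [|e' j' J h]; first by rewrite normrN1.
by rewrite mulN1r (min2_fold J).
Qed.

Lemma det_col_mx2 (u1 u2 : Z2) :
  (\det (col_mx u1 u2))%:~R = det2 (toR u1) (toR u2) :> R.
Proof.
have E0 j : col_mx u1 u2 (0 : 'I_2) j = u1 0 j.
  by rewrite -(col_mxEu u1 u2); congr (col_mx _ _ _ _); exact: val_inj.
have E1 j : col_mx u1 u2 (1 : 'I_2) j = u2 0 j.
  by rewrite -(col_mxEd u1 u2); congr (col_mx _ _ _ _); exact: val_inj.
by rewrite (det_mx2 (col_mx u1 u2)) !E0 !E1 rmorphB !rmorphM /det2 !mxE.
Qed.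

End Divisor.
End Facets.

Lemma uniform_eps {R : realType} (T : eqType) (L : seq T) (P : T -> R -> Prop) :
  (forall x r r', r' <= r -> P x r -> P x r') ->
  (forall x, x \in L -> exists2 r, 0 < r & P x r) ->
  exists2 r, 0 < r & forall x, x \in L -> P x r.
Proof.
move=> mono; elim: L => [|x L IH] ex; first by exists 1.
have [|r r0 hr] := IH; first by move=> y yL; apply: ex; rewrite inE yL orbT.
have [|r' r'0 hr'] := ex x; first by rewrite inE eqxx.
exists (Num.min r r') => [|y]; first by rewrite lt_min r0.
rewrite inE => /orP[/eqP->|/hr].
  by apply: mono hr'; rewrite ge_min lexx orbT.
by apply: mono; rewrite ge_min lexx.
Qed.

(** * Local intersection multiplicities *)

Section Rays.
Context {R : realType}.
Local Notation V := 'rV[R]_2.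
Implicit Types (a b d e h x y z v : V) (F G : V -> R) (S : seq R).

Definition rays d S : seq V := [seq ray d s | s <- S] ++ [seq - ray d s | s <- S].

Definition vertex_mult d S F x : R := \sum_(e <- rays d S) ray_mult F x e.

Lemma rays_det2 d S e : d != 0 -> e \in rays d S -> det2 d e = 1 \/ det2 d e = - 1.
Proof.
by move=> d0; rewrite mem_cat => /orP[] /mapP[s _ ->]; [left|right];
   rewrite ?det2Nr det2_ray.
Qed.

Lemma rays_neq0 d S e : d != 0 -> e \in rays d S -> e != 0.
Proof.
by move=> d0; rewrite mem_cat => /orP[] /mapP[s _ ->]; rewrite ?oppr_eq0 ray_neq0.
Qed.

(** All rays have determinant 1 or -1 with d, so two of them on the same half-line are equal. *)
Lemma rays_inj d S e e' (s s' : R) : d != 0 -> e \in rays d S -> e' \in rays d S ->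
  0 < s -> 0 < s' -> s *: e = s' *: e' -> s = s' /\ e = e'.
Proof.
move=> d0 eS e'S s0 s'0 se.
have ss' : s = s'.
  have := congr1 (det2 d) se; rewrite !det2Zr.
  by case: (rays_det2 d0 eS) => ->; case: (rays_det2 d0 e'S) => -> ?; lra.
by split=> //; apply: (scalerI (lt0r_neq0 s'0)); rewrite -se ss'.
Qed.

Lemma rays_uniq d S : d != 0 -> uniq S -> uniq (rays d S).
Proof.
move=> d0 uS; have ri : injective (ray d).
  move=> s t /(congr1 (det2 (ray d 0))); rewrite !det2_rays // !sub0r.
  exact: oppr_inj.
rewrite cat_uniq map_inj_uniq // uS map_inj_uniq ?uS; last first.
  by move=> s t /oppr_inj/ri.
rewrite andbT; apply/hasPn => e /mapP[s _ ->]; apply/negP => /mapP[t _].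
by move=> /(congr1 (det2 d)); rewrite det2Nr !det2_ray // => ?; lra.
Qed.

Lemma fan_ray d S G e : d != 0 -> fan [seq ray d s | s <- S] G -> e != 0 ->
  jump G e != 0 -> exists2 u, u \in rays d S & exists2 s : R, 0 < s & e = s *: u.
Proof.
move=> d0 fG e0; have [a [b [Gab ab]]] := fG.2 e e0.
rewrite (jump_eq0 e0 Gab) => abR.
have [|u /mapP[s sS ->] [r0 re]] := ab; first by apply: contra abR => /eqP->.
have [k ek] := parallel_det2 r0 re.
have k0 : k != 0 by apply: contra e0 => /eqP k0; rewrite ek k0 scale0r.
have [kn|kp|/eqP] := ltgtP k 0; last by rewrite (negPf k0).
  exists (- ray d s); first by rewrite mem_cat (map_f (fun s => - ray d s)) ?orbT.
  by exists (- k); rewrite ?oppr_gt0 // ek scalerN scaleNr opprK.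
by exists (ray d s); [rewrite mem_cat map_f|exists k].
Qed.

Lemma rays_balancing d S G c : d != 0 -> uniq S -> fan [seq ray d s | s <- S] G ->
  \sum_(e <- rays d S) jump G e * pairing c e = 0.
Proof.
move=> d0 uS fG; rewrite big_cat !big_map /= -big_split /=.
rewrite -[RHS](@balancing _ _ G d fG d0 _ S c uS) //.
- by apply: eq_bigr => s _; rewrite pairingNr mulrN mulrBl.
- by move=> u /mapP[s sS ->] _; rewrite det2_ray // oner_neq0.
move=> e e0 je; have [a [b [Gab ab]]] := fG.2 e e0.
have [|u /mapP[s sS ->] [_ re]] := ab; last by exists s.
by apply: contra je => /eqP eab; rewrite (jump_eq0 e0 Gab) eab.
Qed.

Lemma fan_pl E G z : fan E G -> pl_at G z.
Proof.
move=> fG; have [->|z0] := eqVneq z 0.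
  apply: (@germ_at_pl _ E _ _ G) => //; split; first exact: fG.1.
  by exists 1 => // h _; rewrite add0r (homogeneous0 fG.1) add0r.
have [a [b [Gab _]]] := fG.2 z z0.
by apply: germ_at_pl (edge_at_germ Gab) _; apply: edge_fan => //; case: Gab.
Qed.

Definition fold G e : R := G e + G (- e).

Lemma edge_fan_germ (a b : 'rV[int]_2) e z : e != 0 ->
  pairing (toR a) e = pairing (toR b) e ->
  germ (edge (toR a) (toR b) e) z (- e) = - pairing (toR a) e.
Proof.
move=> e0 abe; have [E' [_ gE]] := fan_pl z (edge_fan e0 abe).
apply: (germ_at_dir gE); exists 1 => // t t0 _.
by rewrite scalerN -scaleNr addrC edge_shift // mulNr mulrN addrC.
Qed.

Lemma germ_agree F F' x : (exists2 r, 0 < r & forall h, `|h| < r -> F (x + h) = F' (x + h)) ->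
  pl_at F' x -> germ F x = germ F' x.
Proof.
move=> FF' [E [_ gF]]; apply: germE; apply: germ_at_near gF.
exact/nearE.
Qed.

(* Restricting G to the half-line v + s e, s >= 0, and summing the changes of slope. *)
Lemma half_line_sum E G e v (a b : 'rV[int]_2) (r k : R) : fan E G -> e != 0 ->
  pairing (toR a) e = pairing (toR b) e ->
  (forall h, `|h| < r -> G (e + h) = edge (toR a) (toR b) e (e + h)) ->
  0 < k -> `|v| < k * r ->
  exists S : seq R, [/\ uniq S, forall s, s \in S -> 0 < s < k,
    forall s, 0 < s < k -> s \notin S -> fold (germ G (v + s *: e)) e = 0,
    \sum_(s <- S) fold (germ G (v + s *: e)) e = pairing (toR a) e - germ G v e
    & forall s, k <= s -> germ G (v + s *: e) = germ (edge (toR a) (toR b) e) (v + s *: e)].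
Proof.
move=> fG e0 abe Ge k0 vk.
(* From s = k on, v + s e is s times a point at distance less than r from e, where G is the edge
   germ. *)
have far s : k <= s -> germ G (v + s *: e) = germ (edge (toR a) (toR b) e) (v + s *: e).
  move=> ks; have s0 : 0 < s by exact: lt_le_trans ks.
  apply: germ_agree; last exact: fan_pl (edge_fan e0 abe).
  have vs : `|v| < s * r.
    by apply: (lt_le_trans vk); rewrite ler_wpM2r // ltW // -(pmulr_rgt0 _ k0) (le_lt_trans _ vk).
  exists (s * r - `|v|) => [|h hr]; first by rewrite subr_gt0.
  have -> : v + s *: e + h = s *: (e + s^-1 *: (v + h)).
    by rewrite scalerDr scalerA divff ?gt_eqF // scale1r addrAC addrC.
  rewrite (fG.1 _ _ (ltW s0)) Ge ?(edge_homogeneous _ _ _ _ (ltW s0)) //.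
  rewrite normrZ ger0_norm ?invr_ge0 ?ltW // mulrC ltr_pdivrMr // mulrC.
  by rewrite (le_lt_trans (ler_normD _ _)) // addrC -ltrBrDr.
(* The slopes along e after and before the point; their difference is [fold], the bend of G along
   the half-line. *)
pose Pp s := germ G (v + s *: e) e; pose Pm s := - germ G (v + s *: e) (- e).
have loc t : exists2 r', 0 < r' & forall l, 0 < l -> l < r' ->
    [/\ Pp (t + l) = Pp t, Pm (t + l) = Pp t, Pp (t - l) = Pm t & Pm (t - l) = Pm t].
  have [r1 r10 h1] := slope_near (fan_pl (v + t *: e) fG) e0.
  have Ne0 : - e != 0 by rewrite oppr_eq0.
  have [r2 r20 h2] := slope_near (fan_pl (v + t *: e) fG) Ne0.
  exists (Num.min r1 r2) => [|l l0]; first by rewrite lt_min r10.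
  rewrite lt_min => /andP[lr1 lr2]; rewrite /Pp /Pm scalerDl scalerBl !addrA.
  have [-> Ep] := h1 l l0 lr1; have [Em Em'] := h2 l l0 lr2.
  rewrite !scalerN opprK in Em Em'.
  by rewrite Ep opprK Em Em'.
have [S [uS S0 cov sumS]] := telescope_jumps loc k0.
exists S; split=> //.
  move=> s sk sS; rewrite /fold; have := cov s sk sS; rewrite /Pp /Pm => ->.
  by rewrite addNr.
have PP s : Pp s - Pm s = fold (germ G (v + s *: e)) e by rewrite /Pm opprK.
rewrite -(eq_bigr _ (fun s _ => PP s)) sumS /Pp /Pm scale0r addr0.
by rewrite far ?lexx // edge_fan_germ // opprK.
Qed.

End Rays.

(** * The multiplicity of a vertex *)

Section LocalIntersection.
Context {R : realType}.
Local Notation V := 'rV[R]_2.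
Context (B : 'M[R]_2) (D : local_data B) (F : V -> R).
Hypothesis coverD : forall p : torus B, exists U f, D (U, f) /\ U p.
Hypothesis indF : induced_by D F.

Lemma edge_Zaffine x (a b : 'rV[int]_2) e : e != 0 ->
  pairing (toR a) e = pairing (toR b) e -> germ_at F x (edge (toR a) (toR b) e) ->
  Zaffine_at F x <-> a = b.
Proof.
move=> e0 abe Fe; split=> [/Zaffine_germ[c Fc]|eab]; last first.
  apply: (@germ_Zaffine _ _ _ a); rewrite (_ : pairing _ = edge (toR a) (toR b) e) //.
  by apply: funext => h; rewrite eab edge_same.
have := germ_at_unique Fe Fc.
rewrite (_ : pairing (toR c) = edge (toR c) (toR c) e); last first.
  by apply: funext => h; rewrite edge_same.
by case/(edge_inj e0 abe erefl) => /toR_inj-> /toR_inj->.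
Qed.

(** All choices of facet data give the same product, by [facet_jump]; this pins down the value that
    [transversal_mult] picks. *)
Lemma transversal_multE v1 v2 y e1 e2 (G1 G2 : V -> R) (j1 j2 : R) : e1 != 0 -> e2 != 0 ->
  germ_at F (y - v1) G1 -> (forall h, fold G1 h = j1 * `|det2 e1 h|) ->
  germ_at F (y - v2) G2 -> (forall h, fold G2 h = j2 * `|det2 e2 h|) ->
  (exists w u, facet D (y - v1) w u) -> (exists w u, facet D (y - v2) w u) ->
  (transversal_mult D D v1 v2 y)%:~R = j1 * j2 * `|det2 e1 e2|.
Proof.
move=> e10 e20 F1 J1 F2 J2 [w1 [u1 f1]] [w2 [u2 f2]].
rewrite /transversal_mult.
set M := (X in xget 0 X).
have : M (xget 0 M).
  apply: xgetPex; exists (w1 * w2 * `|\det (col_mx u1 u2)|).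
  by exists w1, u1, w2, u2; split.
case=> {}w1 [{}u1 [{}w2 [{}u2 [{}f1 {}f2 ->]]]].
have [s1 [l1 [[s11 l10 ws1] [k1 [u1E ->]]]]] := facet_jump coverD indF e10 f1 F1 J1.
have [s2 [l2 [[s21 l20 ws2] [k2 [u2E ->]]]]] := facet_jump coverD indF e20 f2 F2 J2.
rewrite !intrM intr_norm det_col_mx2 ws1 ws2.
have coord (u e : V) (l k : R) : (forall h, l * pairing u h = k * det2 e h) ->
    l * u 0 0 = - (k * e 0 1) /\ l * u 0 1 = k * e 0 0.
  move=> uE; have := uE (vec2 1 0); have := uE (vec2 0 1).
  by rewrite /det2 !pairing2 !vec20 !vec21; lra.
have [a1 b1] := coord _ _ _ _ u1E; have [a2 b2] := coord _ _ _ _ u2E.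
have -> : s1 * l1 * (s2 * l2) * `|det2 (toR u1) (toR u2)| =
    s1 * s2 * `|l1 * l2 * det2 (toR u1) (toR u2)|.
  by rewrite !normrM (gtr0_norm l10) (gtr0_norm l20); ring.
have -> : l1 * l2 * det2 (toR u1) (toR u2) = k1 * k2 * det2 e1 e2.
  transitivity (l1 * (toR u1 : V) 0 0 * (l2 * (toR u2 : V) 0 1)
    - l1 * (toR u1 : V) 0 1 * (l2 * (toR u2 : V) 0 0)); first by rewrite /det2; ring.
  by rewrite a1 b1 a2 b2 /det2; ring.
by rewrite !normrM; ring.
Qed.

Lemma facet_det_neq0 y1 y2 w1 u1 w2 u2 e1 e2 (G1 G2 : V -> R) (j1 j2 : R) :
  e1 != 0 -> e2 != 0 ->
  germ_at F y1 G1 -> (forall h, fold G1 h = j1 * `|det2 e1 h|) ->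
  germ_at F y2 G2 -> (forall h, fold G2 h = j2 * `|det2 e2 h|) ->
  j1 != 0 -> j2 != 0 ->
  facet D y1 w1 u1 -> facet D y2 w2 u2 ->
  (\det (col_mx u1 u2) != 0) = (det2 e1 e2 != 0).
Proof.
move=> e10 e20 F1 J1 F2 J2 j10 j20 f1 f2.
have [s1 [l1 [[s11 l10 ws1] [k1 [u1E j1E]]]]] := facet_jump coverD indF e10 f1 F1 J1.
have [s2 [l2 [[s21 l20 ws2] [k2 [u2E j2E]]]]] := facet_jump coverD indF e20 f2 F2 J2.
rewrite -(intr_eq0 R) det_col_mx2.
have coord (u e : V) (l k : R) : (forall h, l * pairing u h = k * det2 e h) ->
    l * u 0 0 = - (k * e 0 1) /\ l * u 0 1 = k * e 0 0.
  move=> uE; have := uE (vec2 1 0); have := uE (vec2 0 1).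
  by rewrite /det2 !pairing2 !vec20 !vec21; lra.
have [a1 b1] := coord _ _ _ _ u1E; have [a2 b2] := coord _ _ _ _ u2E.
have E : l1 * l2 * det2 (toR u1) (toR u2) = k1 * k2 * det2 e1 e2.
  transitivity (l1 * (toR u1 : V) 0 0 * (l2 * (toR u2 : V) 0 1)
    - l1 * (toR u1 : V) 0 1 * (l2 * (toR u2 : V) 0 0)); first by rewrite /det2; ring.
  by rewrite a1 b1 a2 b2 /det2; ring.
have k10 : k1 != 0 by apply: contra j10 => /eqP k0; rewrite j1E k0 normr0 mulr0.
have k20 : k2 != 0 by apply: contra j20 => /eqP k0; rewrite j2E k0 normr0 mulr0.
have := congr1 (fun z => z != 0) E.
by rewrite !mulf_eq0 (gt_eqF l10) (gt_eqF l20) (negPf k10) (negPf k20).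
Qed.

(** In the coordinate h centered at the translated vertex x0 + v1 only the difference v1 - v2
    matters. *)
Lemma meetingE x0 r v1 v2 h : meeting D D x0 r v1 v2 (x0 + v1 + h) <->
  [/\ support_lift D (x0 + h), `|h| < r, support_lift D (x0 + (v1 - v2 + h))
    & `|v1 - v2 + h| < r].
Proof.
have E1 : x0 + v1 + h - v1 = x0 + h by rewrite addrAC addrK.
have E2 : x0 + v1 + h - v2 = x0 + (v1 - v2 + h) by rewrite !addrA [RHS]addrAC.
have bE z : ball x0 r (x0 + z) <-> `|z| < r.
  by rewrite -ball_normE /= opprD addrA subrr add0r normrN.
rewrite /meeting /translate; split=> /=.
  by rewrite E1 E2 => -[[s1 /bE b1] [s2 /bE b2]].
by rewrite E1 E2 => -[s1 /bE b1 s2 /bE b2].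
Qed.

Section Vertex.
Variables (d : V) (S : seq R) (x0 : V).
Hypothesis d0 : d != 0.
Hypothesis uS : uniq S.
Hypothesis fG : fan [seq ray d s | s <- S] (germ F x0).
Hypothesis gG : germ_at F x0 (germ F x0).
Hypothesis nofacet : forall w u, ~ facet D x0 w u.
Local Notation G := (germ F x0).

Lemma near_vertex : exists2 r0, 0 < r0 & forall h, `|h| < r0 -> h != 0 ->
  exists a b : 'rV[int]_2, [/\ edge_at G h (toR a) (toR b),
    germ_at F (x0 + h) (edge (toR a) (toR b) h),
    support_lift D (x0 + h) <-> jump G h != 0
    & jump G h != 0 -> exists w u, facet D (x0 + h) w u].
Proof.
have [r0 r00 near_x] := germ_near gG fG; exists r0 => // h hr h0.
have [a [b [Gab Fab _ _]]] := near_x h hr h0.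
have abh : pairing (toR a) h = pairing (toR b) h by case: Gab.
have jE : (jump G h == 0) = (a == b) by rewrite (jump_eq0 h0 Gab) (inj_eq (@toR_inj R)).
exists a, b; split=> //.
  rewrite jE; apply: iff_trans (support_liftP coverD indF _) _; split.
    by move=> nZ; apply/eqP => /(edge_Zaffine h0 abh Fab).
  by move=> ab /(edge_Zaffine h0 abh Fab) eab; rewrite eab eqxx in ab.
by rewrite jE => ab; exact: edge_facet abh ab Fab.
Qed.

(** The bound on the translations depends on r, as in [is_multiplicity]: on each ray the crossings
    must occur before a parameter k up to which the points stay in the ball, and from k on the
    second copy has at most an edge parallel to the ray. *)
Lemma local_intersection : support_lift D x0 -> exists2 r0, 0 < r0 &
  forall r, 0 < r -> r < r0 -> exists2 dl, 0 < dl &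
  forall v1 v2 : V, `|v1| < dl -> `|v2| < dl -> Defs.transversal D D x0 r v1 v2 ->
  (\sum_(y \in meeting D D x0 r v1 v2) transversal_mult D D v1 v2 y)%:~R =
    vertex_mult d S F x0.
Proof.
move=> supp; have [r0 r00 near_x] := near_vertex.
exists r0 => // r rp rr0.
pose good (e : V) (dl : R) := forall v : V, `|v| < dl ->
  exists (k : R) (a b : 'rV[int]_2), [/\ 0 < k, `|v| < r,
  (forall s : R, 0 < s < k -> `|s *: e| < r /\ `|v + s *: e| < r),
  edge_at G e (toR a) (toR b) & exists T : seq R, [/\ uniq T,
    forall s, s \in T -> 0 < s < k,
    forall s, 0 < s < k -> s \notin T -> fold (germ G (v + s *: e)) e = 0,
    \sum_(s <- T) fold (germ G (v + s *: e)) e = G e - germ G v e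
  & forall s, k <= s -> germ G (v + s *: e) = germ (edge (toR a) (toR b) e) (v + s *: e)]].
have [dl dl0 hdl] : exists2 dl, 0 < dl & forall e, e \in rays d S -> good e dl.
  apply: uniform_eps => [e dl dl' dd' h v vd|e eS].
    by apply: h; exact: lt_le_trans dd'.
  have e0 := rays_neq0 d0 eS.
  have [a [b [Gab _]]] := fG.2 e e0.
  have [abe [re re0 Ge]] := Gab.
  have r20 : 0 < r / 2 by rewrite divr_gt0.
  have [k kp ke] := scale_small_le e r20.
  exists (Num.min (k * re) (r / 2)) => [|v].
    by rewrite lt_min mulr_gt0 // divr_gt0.
  rewrite lt_min => /andP[vk vr].
  exists k, a, b; split=> //; first by apply: (lt_trans vr); lra.
    move=> s /andP[s0 sk]; have se := ke s (ltW s0) (ltW sk).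
    split; first by apply: (lt_trans se); lra.
    by apply: le_lt_trans (ler_normD _ _) _; lra.
  have [T [uT T0 cov sumT far]] := half_line_sum fG e0 abe Ge kp vk.
  by exists T; split=> //; rewrite (edge_at_val Gab).
exists (dl / 2) => [|v1 v2 v1d v2d tr]; first by rewrite divr_gt0.
pose v := v1 - v2.
have vd : `|v| < dl by apply: le_lt_trans (ler_normB _ _) _; lra.
have [fin trP] := tr.
have meetP h : meeting D D x0 r v1 v2 (x0 + v1 + h) <->
    [/\ support_lift D (x0 + h), `|h| < r, support_lift D (x0 + (v + h)) & `|v + h| < r].
  exact: meetingE.
have facets h : meeting D D x0 r v1 v2 (x0 + v1 + h) -> exists w1 u1 w2 u2,
    [/\ facet D (x0 + h) w1 u1, facet D (x0 + (v + h)) w2 u2 & \det (col_mx u1 u2) != 0].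
  move=> /trP[w1 [u1 [w2 [u2]]]]; rewrite addrAC addrK => -[f1 f2 dn].
  by exists w1, u1, w2, u2; split=> //; move: f2; rewrite /v !addrA [in X in _ -> X]addrAC.
(* Transversality alone makes v generic: if v = 0, or if G has a jump along v, the vertex of the
   first copy lies on the second copy, although it is in no facet. *)
have vne0 : v != 0.
  apply/eqP => v0; have [|w1 [u1 [_ [_ [f1 _ _]]]]] := facets 0.
    by apply/meetP; rewrite v0 !addr0 normr0.
  by apply: (nofacet (w := w1) (u := u1)); rewrite -[x0]addr0.
have jv0 : jump G v = 0.
  apply/eqP/negPn/negP => jv.
  have [e eS _] := fan_ray d0 fG vne0 jv; have [_ [_ [_ [_ vr _ _ _]]]] := hdl e eS v vd.
  have [a [b [_ _ sP _]]] := near_x v (lt_trans vr rr0) vne0.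
  have [|w1 [u1 [_ [_ [f1 _ _]]]]] := facets 0.
    by apply/meetP; rewrite !addr0 normr0; split=> //; apply/sP.
  by apply: (nofacet (w := w1) (u := u1)); rewrite -[x0]addr0.
(* So G is linear near v, and the initial slopes of all the half-lines are values of one covector
   c. *)
have [c Gv] : exists c, germ G v = pairing c.
  have [a [b [Gab _]]] := fG.2 v vne0; exists (toR a).
  move: jv0 => /eqP; rewrite (jump_eq0 vne0 Gab) => /eqP eab.
  rewrite (germE (edge_at_germ Gab)); apply: funext => h.
  by rewrite -eab edge_same.
(* At a crossing both germs are edges, of directions e and v + s e, and the bend of G at v + s e in
   the direction e is the second jump times the absolute determinant of the two directions. *)
have crossing e s a b : e \in rays d S -> 0 < s -> `|s *: e| < r -> `|v + s *: e| < r ->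
    edge_at G e (toR a) (toR b) -> meeting D D x0 r v1 v2 (x0 + v1 + s *: e) ->
    [/\ (transversal_mult D D v1 v2 (x0 + v1 + s *: e))%:~R =
          jump G e * fold (germ G (v + s *: e)) e,
        jump G e != 0, det2 e v != 0 & fold (germ G (v + s *: e)) e != 0].
  move=> eS s0 ser vser Gab mt; have e0 := rays_neq0 d0 eS.
  have se0 : s *: e != 0 by rewrite scaler_eq0 negb_or e0 gt_eqF.
  have [w1 [u1 [w2 [u2 [f1 f2 detn]]]]] := facets _ mt.
  move/meetP: (mt) => [s1 _ s2 _].
  have vs0 : v + s *: e != 0.
    apply/eqP => h0; apply: (nofacet (w := w2) (u := u2)).
    by rewrite -[x0]addr0 -h0.
  have [a1 [b1 [G1 F1 sP1 _]]] := near_x _ (lt_trans ser rr0) se0.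
  have [a2 [b2 [G2 F2 sP2 _]]] := near_x _ (lt_trans vser rr0) vs0.
  have [ea eb] := edge_at_unique se0 G1 (edge_at_scale fG.1 s0 Gab).
  have ab1 : pairing (toR a1) (s *: e) = pairing (toR b1) (s *: e) by case: G1.
  have abe : pairing (toR a1) e = pairing (toR b1) e.
    by rewrite ea eb; case: Gab.
  have ab2 : pairing (toR a2) (v + s *: e) = pairing (toR b2) (v + s *: e) by case: G2.
  have J1 h : fold (edge (toR a1) (toR b1) (s *: e)) h = jump G e * `|det2 e h|.
    rewrite /fold edge_fold // ea eb (jumpE e0 Gab) nrmZ // pairingZr det2Zl normrM.
    by rewrite (gtr0_norm s0); field; rewrite gt_eqF.
  have J2 h : fold (edge (toR a2) (toR b2) (v + s *: e)) h =
      jump G (v + s *: e) * `|det2 (v + s *: e) h|.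
    by rewrite /fold edge_fold // (jumpE vs0 G2).
  have j1 : jump G e != 0.
    have := sP1.1 s1; rewrite (jump_eq0 se0 G1) (jump_eq0 e0 Gab) ea eb //.
  have j2 := sP2.1 s2.
  have dn : det2 e (v + s *: e) != 0.
    by rewrite -(facet_det_neq0 e0 vs0 F1 J1 F2 J2 j1 j2 f1 f2).
  have foldE : fold (germ G (v + s *: e)) e = jump G (v + s *: e) * `|det2 (v + s *: e) e|.
    by rewrite (germE (edge_at_germ G2)) J2.
  have dC : `|det2 (v + s *: e) e| = `|det2 e (v + s *: e)| by rewrite det2C normrN.
  split=> //.
  - have E1 : x0 + v1 + s *: e - v1 = x0 + s *: e by rewrite addrAC addrK.
    have E2 : x0 + v1 + s *: e - v2 = x0 + (v + s *: e) by rewrite /v !addrA [RHS]addrAC.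
    rewrite -E1 in F1 f1; rewrite -E2 in F2 f2.
    rewrite (transversal_multE e0 vs0 F1 J1 F2 J2); last 2 first.
    + by exists w1, u1.
    + by exists w2, u2.
    by rewrite foldE dC mulrA.
  - by move: dn; rewrite det2Dr det2Zr det2vv mulr0 addr0.
  - by rewrite foldE mulf_neq0 // normr_eq0 det2C oppr_eq0.
have := hdl; rewrite /good => {}hdl.
have /choice[T TP] : forall e, exists T : seq R, e \in rays d S -> [/\ uniq T,
    forall s, s \in T -> [/\ 0 < s, `|s *: e| < r & `|v + s *: e| < r],
    forall s, 0 < s -> meeting D D x0 r v1 v2 (x0 + v1 + s *: e) -> s \in T
  & \sum_(s <- T) fold (germ G (v + s *: e)) e = G e - germ G v e].
  move=> e; have [eS|_] := boolP (e \in rays d S); last by exists [::].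
  have [k [a [b [k0 vr sr Gab [T [uT T0 cov sumT far]]]]]] := hdl e eS v vd.
  exists T => _; split=> //.
    by move=> s sT; case/andP: (T0 s sT) => s0 sk; have [] := sr s; rewrite ?s0.
  move=> s s0 mt; have e0 := rays_neq0 d0 eS.
  have [_ ser _ vser] := (meetP _).1 mt.
  have [_ j1 dv fn] := crossing e s a b eS s0 ser vser Gab mt.
  have [sk|ks] := ltP s k.
    by apply/negPn/negP => sT; rewrite (cov s) ?eqxx ?s0 // in fn.
  (* Past k the germ is that of an edge function of direction e at a point off the line of e, hence
     linear: there is no bend. *)
  exfalso; move: fn; rewrite (far s ks).
  have dvs : det2 e (v + s *: e) != 0 by rewrite det2Dr det2Zr det2vv mulr0 addr0.
  have := edge_at_germ (edge_at_edge_off (toR a) (toR b) dvs) => gs.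
  by rewrite (germE gs) /fold !edge_same pairingNr subrr eqxx.
pose L := [seq x0 + v1 + p.2 *: p.1 |
   p <- [seq (e, s) | e <- rays d S, s <- T e]].
have uL : uniq L.
  rewrite map_inj_in_uniq.
    apply: allpairs_uniq_dep => //.
    - exact: rays_uniq.
    - by move=> e eS; have [] := TP e eS.
    - by move=> [? ?] [? ?] _ _ /= [-> ->].
  move=> [e s] [e' s'] /allpairsPdep[e1 [s1 [eS sT [-> ->]]]].
  move=> /allpairsPdep[e2 [s2 [e'S s'T [-> ->]]]] /= /addrI se.
  have [_ /(_ _ sT)[s10 _ _] _ _] := TP _ eS.
  have [_ /(_ _ s'T)[s20 _ _] _ _] := TP _ e'S.
  by have [-> ->] := rays_inj d0 eS e'S s10 s20 se.
have meetL y : meeting D D x0 r v1 v2 y -> y \in L.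
  have -> : y = x0 + v1 + (y - (x0 + v1)) by rewrite addrC subrK.
  move: (y - _) => h mt; have [w1 [u1 [w2 [u2 [f1 f2 detn]]]]] := facets _ mt.
  have [s1 hr _ _] := (meetP _).1 mt.
  have h0 : h != 0.
    by apply/eqP => h0; apply: (nofacet (w := w1) (u := u1)); rewrite -[x0]addr0 -h0.
  have [a [b [_ _ sP _]]] := near_x _ (lt_trans hr rr0) h0.
  have [e eS [s s0 he]] := fan_ray d0 fG h0 (sP.1 s1).
  rewrite he in mt *; have [_ _ cov _] := TP e eS.
  apply/mapP; exists (e, s) => //; apply/allpairsPdep; exists e, s; split=> //.
  exact: cov.
have -> : meeting D D x0 r v1 v2 = [set` [seq y <- L | `[< meeting D D x0 r v1 v2 y >]]].
  apply/seteqP; split=> y /=; rewrite mem_filter.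
    by move=> mt; apply/andP; split; [exact/asboolP|exact: meetL].
  by case/andP => /asboolP.
rewrite -fsbig_seq ?filter_uniq // big_filter big_mkcond /L big_map big_allpairs_dep /=.
(* The balancing sum for c, which is zero, supplies the initial slopes to subtract. *)
rewrite rmorph_sum /= /vertex_mult -[RHS]subr0 -[X in _ = _ - X](rays_balancing c d0 uS fG) -sumrB.
apply: eq_big_seq => e eS; rewrite /ray_mult -mulrBr -Gv rmorph_sum /=.
have [_ Tk _ <-] := TP e eS; rewrite mulr_sumr.
have e0 := rays_neq0 d0 eS.
have [a [b [Gab _]]] := fG.2 e e0.
apply: eq_big_seq => s sT; have [s0 ser vser] := Tk s sT.
case: asboolP => [mt|nmt]; first by have [] := crossing e s a b eS s0 ser vser Gab mt.
(* A term that is not a crossing must vanish: a jump and a bend that are both nonzero would put the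
   point on both copies. *)
apply/esym/eqP; rewrite mulf_eq0; apply/negPn/negP; rewrite negb_or => /andP[je fn].
have se0 : s *: e != 0 by rewrite scaler_eq0 negb_or e0 gt_eqF.
apply: nmt; apply/meetP; split=> //.
  have [_ [_ [_ _ sP _]]] := near_x _ (lt_trans ser rr0) se0; apply/sP.
  by rewrite (jump_scale fG) // mulf_neq0 // invr_eq0 gt_eqF.
have [->|vs0] := eqVneq (v + s *: e) 0; first by rewrite addr0.
have [a2 [b2 [G2 _ sP _]]] := near_x _ (lt_trans vser rr0) vs0; apply/sP.
apply: contra fn; rewrite (jump_eq0 vs0 G2) (germE (edge_at_germ G2)) => /eqP eab.
by rewrite /fold eab !edge_same pairingNr subrr.
Qed.

(** Without transversal translations every integer would satisfy [is_multiplicity]; a displacement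
    along a vector transverse to all the rays provides some. *)
Lemma transversal_exists : support_lift D x0 -> exists2 r0, 0 < r0 &
  forall r dl : R, 0 < r -> r < r0 -> 0 < dl -> exists v1 v2 : V,
    [/\ `|v1| < dl, `|v2| < dl & Defs.transversal D D x0 r v1 v2].
Proof.
move=> supp; have [r0 r00 near_x] := near_vertex; exists r0 => // r dl rp rr0 dl0.
have [w w0 wR] := exists_transverse (rays d S).
have m0 : 0 < Num.min dl r by rewrite lt_min dl0.
have [k k0] := scale_small w m0; rewrite lt_min => /andP[vd vr].
set v := k *: w in vd vr; exists v, 0; rewrite normr0; split=> //.
have v0 : v != 0 by rewrite scaler_eq0 negb_or gt_eqF.
have vR e : e \in rays d S -> det2 v e != 0.
  by move=> eS; rewrite det2Zl mulf_neq0 ?(gt_eqF k0) // wR // (rays_neq0 d0 eS).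
have jv (l : R) : l != 0 -> jump G (l *: v) = 0.
  move=> l0; apply/eqP/negPn/negP => jlv.
  have [|u uR [s s0 E]] := fan_ray d0 fG _ jlv; first by rewrite scaler_eq0 negb_or l0.
  have := vR u uR; rewrite -(inj_eq (mulfI l0)) mulr0 -det2Zl E det2Zl det2vv.
  by rewrite mulr0 eqxx.
have key y : meeting D D x0 r v 0 y -> exists h e e' (s s' : R),
    [/\ y = x0 + v + h, e \in rays d S, e' \in rays d S, 0 < s & 0 < s'] /\
    [/\ h = s *: e, v + h = s' *: e', det2 e e' != 0, `|h| < r & `|v + h| < r] /\
    jump G h != 0 /\ jump G (v + h) != 0.
  have -> : y = x0 + v + (y - (x0 + v)) by rewrite addrC subrK.
  move: (y - _) => h /meetingE; rewrite subr0 => -[s1 hr s2 vhr].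
  have h0 : h != 0.
    apply/eqP => h0; move: s2; rewrite h0 addr0.
    have [_ [_ [_ _ sP _]]] := near_x v (lt_trans vr rr0) v0.
    by move/sP; rewrite -[v]scale1r jv ?eqxx ?oner_eq0.
  have vh0 : v + h != 0.
    apply/eqP => /eqP; rewrite addrC addr_eq0 => /eqP hv; move: s1.
    have [_ [_ [_ _ sP _]]] := near_x h (lt_trans hr rr0) h0.
    by move/sP; rewrite hv -scaleN1r jv ?eqxx // oppr_eq0 oner_eq0.
  have [_ [_ [_ _ /iffLR/(_ s1) j1 _]]] := near_x h (lt_trans hr rr0) h0.
  have [_ [_ [_ _ /iffLR/(_ s2) j2 _]]] := near_x _ (lt_trans vhr rr0) vh0.
  have [e eS [s s0 hE]] := fan_ray d0 fG h0 j1.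
  have [e' e'S [s' s'0 vhE]] := fan_ray d0 fG vh0 j2.
  exists h, e, e', s, s'; split=> //; split=> //; split=> //.
  apply/eqP => ee'; have := vR e eS; have -> : v = s' *: e' - s *: e by rewrite -vhE hE addrK.
  by rewrite det2Dl det2Nl !det2Zl det2vv det2C ee' oppr0 !mulr0 subr0 eqxx.
split.
  apply: (@sub_finite_set _ _ [set` [seq x0 + (det2 p.1 v / det2 p.1 p.2) *: p.2 |
     p <- [seq (e, e') | e <- rays d S, e' <- rays d S]]]); last exact: finite_seq.
  move=> y /key[h [e [e' [s [s' [[-> eS e'S s0 s'0] [[hE vhE ee' _ _] _]]]]]]] /=.
  apply/mapP; exists (e, e'); first exact: allpairs_f.
  rewrite /= -addrA vhE; congr (_ + _ *: _).
  have -> : det2 e v = det2 e (v + h) by rewrite det2Dr hE det2Zr det2vv mulr0 addr0.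
  by rewrite vhE det2Zr mulfK.
move=> y /key[h [e [e' [s [s' [[-> eS e'S s0 s'0] [[hE vhE ee' hr vhr] [j1 j2]]]]]]]].
have h0 : h != 0 by rewrite hE scaler_eq0 negb_or gt_eqF // (rays_neq0 d0 eS).
have vh0 : v + h != 0 by rewrite vhE scaler_eq0 negb_or gt_eqF // (rays_neq0 d0 e'S).
have [a1 [b1 [G1 F1 _ /(_ j1)[w1 [u1 f1]]]]] := near_x h (lt_trans hr rr0) h0.
have [a2 [b2 [G2 F2 _ /(_ j2)[w2 [u2 f2]]]]] := near_x _ (lt_trans vhr rr0) vh0.
have E1 : x0 + v + h - v = x0 + h by rewrite addrAC addrK.
have E2 : x0 + v + h - 0 = x0 + (v + h) by rewrite subr0 addrA.
exists w1, u1, w2, u2; rewrite E1 E2; split=> //.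
have J1 z : fold (edge (toR a1) (toR b1) h) z = jump G h * `|det2 h z|.
  by rewrite /fold edge_fold ?(jumpE h0 G1) //; case: G1.
have J2 z : fold (edge (toR a2) (toR b2) (v + h)) z = jump G (v + h) * `|det2 (v + h) z|.
  by rewrite /fold edge_fold ?(jumpE vh0 G2) //; case: G2.
rewrite (facet_det_neq0 h0 vh0 F1 J1 F2 J2 j1 j2 f1 f2) hE -hE vhE hE.
by rewrite det2Zl det2Zr !mulf_neq0 ?(gt_eqF s0) ?(gt_eqF s'0).
Qed.

Lemma multiplicityE : support_lift D x0 ->
  (multiplicity D D x0)%:~R = vertex_mult d S F x0.
Proof.
move=> supp; have [r0 r00 loc] := local_intersection supp.
have [r1 r10 ex] := transversal_exists supp.
have mP m : m%:~R = vertex_mult d S F x0 -> is_multiplicity D D x0 m.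
  move=> mE; rewrite /is_multiplicity; near=> r.
  have rp : 0 < r by near: r; exact: nbhs_right_gt.
  have rr0 : r < r0 by near: r; exact: nbhs_right_lt.
  have [dl dl0 h] := loc r rp rr0.
  exists ([set v1 : V | `|v1| < dl], [set v2 : V | `|v2| < dl]).
    have small : \forall v \near (0 : V), `|v| < dl.
      by apply/nearE; exists dl => // h0; rewrite add0r.
    by split; exact: small.
  by move=> [v1 v2] [/= v1d v2d] tr; apply: (@intr_inj R); rewrite mE h.
have unique m : is_multiplicity D D x0 m -> m%:~R = vertex_mult d S F x0.
  move=> hm; near (0 : R)^'+ => r.
  have rp : 0 < r by near: r; exact: nbhs_right_gt.
  have rr0 : r < r0 by near: r; exact: nbhs_right_lt.
  have rr1 : r < r1 by near: r; exact: nbhs_right_lt.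
  have [dl dl0 h] := loc r rp rr0.
  have [[A1 A2] [/= /nearE[e1 e10 A1P] /nearE[e2 e20 A2P]] AP] :
    \forall v1 \near (0 : V) & v2 \near (0 : V), Defs.transversal D D x0 r v1 v2 ->
      m = \sum_(y \in meeting D D x0 r v1 v2) transversal_mult D D v1 v2 y.
    by near: r.
  have [|v1 [v2]] := ex r (Num.min dl (Num.min e1 e2)) rp rr1.
    by rewrite !lt_min dl0 e10.
  rewrite !lt_min => -[/and3P[v1d v1e _] /and3P[v2d _ v2e] tr].
  by rewrite (AP (v1, v2) _ tr) ?h //; split; rewrite /= -[X in _ X]add0r; [exact: A1P|exact: A2P].
(* [vertex_mult] is a priori only real; the integer that represents it is the sum for one actual
   transversal position. *)
apply: unique; apply: xgetPex.
near (0 : R)^'+ => r.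
have rp : 0 < r by near: r; exact: nbhs_right_gt.
have rr0 : r < r0 by near: r; exact: nbhs_right_lt.
have rr1 : r < r1 by near: r; exact: nbhs_right_lt.
have [dl dl0 h] := loc r rp rr0.
have [v1 [v2 [v1d v2d tr]]] := ex r dl rp rr1 dl0.
by eexists; apply: mP; exact: h v1d v2d tr.
Unshelve. all: by end_near.
Qed.

End Vertex.
End LocalIntersection.

(** * The sum of the multiplicities over the torus *)

Section QuasiPeriodic.
Context {R : realType}.
Local Notation V := 'rV[R]_2.
Local Notation Z2 := 'rV[int]_2.
Implicit Types (d e h l m x y z : V) (F G : V -> R) (E : seq V) (S : seq R) (a b q : Z2).

Lemma fan_sub E E' G : {subset E <= E'} -> fan E G -> fan E' G.
Proof.
move=> sub [hG fG]; split=> // e e0; have [a [b [Gab ab]]] := fG e e0.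
by exists a, b; split=> // /ab[u uE hu]; exists u => //; exact: sub.
Qed.

Lemma edge_at_addl G e (a b c : V) : edge_at G e a b ->
  edge_at (fun h => G h + pairing c h) e (a + c) (b + c).
Proof.
move=> [abe [r r0 Ge]]; split; first by rewrite !pairingDl abe.
by exists r => // h /Ge->; rewrite /edge !pairingDl; case: ifP.
Qed.

Lemma fan_addl E G q : fan E G -> fan E (fun h => G h + pairing (toR q) h).
Proof.
move=> [hG fG]; split=> [k h k0|e e0]; first by rewrite hG // pairingZr mulrDr.
have [a [b [Gab ab]]] := fG e e0; exists (a + q), (b + q).
rewrite (inj_eq (addIr q)) !toRD; split=> //; exact: edge_at_addl.
Qed.

Lemma fan_edge E a b e : e != 0 -> pairing (toR a) e = pairing (toR b) e ->
  (a != b -> exists2 u, u \in E & u != 0 /\ det2 u e = 0) ->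
  fan E (edge (toR a) (toR b) e).
Proof.
move=> e0 abe abE; have [hG fG] := edge_fan e0 abe; split=> // h h0.
have [a' [b' [Gab ab]]] := fG h h0; exists a', b'; split=> // ab'.
have [|u uE [u0 ue]] := abE.
  apply: contra ab' => /eqP eab.
  have G2 : edge_at (edge (toR a) (toR b) e) h (toR a) (toR a).
    by rewrite eab; split=> //; exists 1 => // k _; rewrite !edge_same.
  by have [/toR_inj-> /toR_inj->] := edge_at_unique h0 Gab G2.
exists u => //; split=> //.
have [v] := ab ab'; rewrite inE => /eqP-> [_ eh].
have [k ->] := parallel_det2 e0 eh.
by rewrite det2Zr ue mulr0.
Qed.

Lemma fan_near E F x : fan E (germ F x) -> germ_at F x (germ F x) ->
  exists2 r, 0 < r & forall h, `|h| < r -> fan E (germ F (x + h)).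
Proof.
move=> fG gG; have [r r0 near_x] := germ_near gG fG; exists r => // h hr.
have [->|h0] := eqVneq h 0; first by rewrite addr0.
have [a [b [[abh _] gab _ ab]]] := near_x h hr h0.
by rewrite (germE gab); exact: fan_edge.
Qed.

Definition quasi_period F l q := exists k : R,
  forall x, F (x + l) = F x + pairing (toR q) x + k.

Lemma quasi_periodD F l l' q q' : quasi_period F l q -> quasi_period F l' q' ->
  quasi_period F (l + l') (q + q').
Proof.
move=> [k H] [k' H']; exists (k + k' + pairing (toR q') l) => x.
by rewrite addrA H' H pairingDr toRD pairingDl; ring.
Qed.

Lemma quasi_periodN F l q : quasi_period F l q -> quasi_period F (- l) (- q).
Proof.
move=> [k H]; exists (pairing (toR q) l - k) => x.
have := H (x - l); rewrite subrK => ->.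
by rewrite pairingBr toRN pairingNl; ring.
Qed.

Lemma quasi_periodMz F l q (n : int) : quasi_period F l q ->
  quasi_period F (n%:~R *: l) (n%:~R *: q).
Proof.
move=> H; have nat_case (p : nat) : quasi_period F (p%:R *: l) (p%:R *: q).
  elim: p => [|p IH]; last by rewrite -natr1 !scalerDl !scale1r -[p.+1%:R]natr1
    scalerDl scale1r; exact: quasi_periodD.
  by exists 0 => x; rewrite !scale0r toR0 pairing0l !addr0.
case: n => p; first exact: nat_case.
rewrite NegzE !rmorphN !scaleNr; apply: quasi_periodN; exact: nat_case.
Qed.

Lemma quasi_germ F l q x : quasi_period F l q -> pl_at F x ->
  germ_at F (x + l) (fun h => germ F x h + pairing (toR q) h) /\
  germ F (x + l) = fun h => germ F x h + pairing (toR q) h.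
Proof.
move=> [k H] [E [fG [hG [r r0 FG]]]].
suff G : germ_at F (x + l) (fun h => germ F x h + pairing (toR q) h).
  by split=> //; exact: germE.
split; first by have [] := fan_addl q fG.
exists r => // h hr; have -> : x + l + h = x + h + l by rewrite addrAC.
by rewrite (H (x + h)) (FG h) // (H x) pairingDr; ring.
Qed.

Section Lattice.
Variables (F : V -> R) (l1 l2 : V) (q1 q2 : Z2).
Hypothesis plF : forall x, pl_at F x.
Hypothesis l12 : det2 l1 l2 != 0.
Hypothesis F1 : quasi_period F l1 q1.
Hypothesis F2 : quasi_period F l2 q2.

Definition lpoint (t s : R) : V := t *: l1 + s *: l2.

Definition lcoord1 x : R := det2 x l2 / det2 l1 l2.
Definition lcoord2 x : R := det2 l1 x / det2 l1 l2.

Lemma lcoordK x : x = lpoint (lcoord1 x) (lcoord2 x).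
Proof.
apply: row2P; rewrite /lpoint /lcoord1 /lcoord2 !mxE; move: l12; rewrite /det2 => D0.
  by field.
by field.
Qed.

Lemma lpoint_coord1 t s : lcoord1 (lpoint t s) = t.
Proof. by rewrite /lcoord1 /lpoint det2Dl !det2Zl det2vv mulr0 addr0 mulfK. Qed.

Lemma lpoint_coord2 t s : lcoord2 (lpoint t s) = s.
Proof. by rewrite /lcoord2 /lpoint det2Dr !det2Zr det2vv mulr0 add0r mulfK. Qed.

Lemma lpointB t s t' s' : lpoint t s - lpoint t' s' = lpoint (t - t') (s - s').
Proof. by apply: row2P; rewrite /lpoint !mxE; ring. Qed.

Lemma lpoint_near (P : V -> Prop) t s :
  (exists2 r, 0 < r & forall h, `|h| < r -> P (lpoint t s + h)) ->
  exists2 r : R, 0 < r & forall t' s', `|t' - t| < r -> `|s' - s| < r ->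
    P (lpoint t' s').
Proof.
move=> [r r0 H]; pose N := `|l1| + `|l2| + 1.
have N0 : 0 < N by rewrite ltr_wpDl // addr_ge0.
exists (r / N) => [|t' s' tt' ss']; first exact: divr_gt0.
rewrite -[lpoint t' s'](subrK (lpoint t s)) addrC; apply: H.
rewrite lpointB; apply: le_lt_trans (ler_normD _ _) _; rewrite !normrZ.
rewrite !ltr_pdivlMr // in tt' ss' *.
have A1 : `|t' - t| * `|l1| <= r / N * `|l1|.
  by rewrite ler_wpM2r // ltW // ltr_pdivlMr.
have A2 : `|s' - s| * `|l2| <= r / N * `|l2|.
  by rewrite ler_wpM2r // ltW // ltr_pdivlMr.
apply: le_lt_trans (lerD A1 A2) _; rewrite -mulrDr.
have -> : `|l1| + `|l2| = N - 1 by rewrite /N addrK.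
by rewrite mulrBr mulr1 divfK ?gt_eqF // ltrBlDr ltrDl divr_gt0.
Qed.

Lemma lattice_reduce (P : V -> Prop) (t0 s0 : R) :
  (forall x, P x -> P (x + l1)) -> (forall x, P x -> P (x - l1)) ->
  (forall x, P x -> P (x + l2)) -> (forall x, P x -> P (x - l2)) ->
  (forall t s, t0 <= t < t0 + 1 -> s0 <= s < s0 + 1 -> P (lpoint t s)) -> forall x, P x.
Proof.
move=> P1 P1N P2 P2N H x.
have step l : (forall y, P y -> P (y + l)) -> (forall y, P y -> P (y - l)) ->
    forall (n : int) y, P y -> P (y + n%:~R *: l).
  move=> Pl PlN n y Py; case: n => p.
    elim: p => [|p IH]; first by rewrite scale0r addr0.
    by rewrite intS rmorphD /= scalerDl scale1r addrA addrAC; apply: Pl.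
  rewrite NegzE rmorphN scaleNr; elim: p.+1 => [|p' IH]; first by rewrite scale0r subr0.
  by rewrite intS rmorphD /= scalerDl scale1r opprD addrA addrAC; apply: PlN.
rewrite [x]lcoordK; set t := lcoord1 x; set s := lcoord2 x.
have fl (u u0 : R) : u0 <= u - (Num.floor (u - u0))%:~R < u0 + 1.
  have := Num.Theory.floor_itv (u - u0).
  by rewrite rmorphD /=; lra.
have -> : lpoint t s = lpoint (t - (Num.floor (t - t0))%:~R) (s - (Num.floor (s - s0))%:~R)
   + (Num.floor (t - t0))%:~R *: l1 + (Num.floor (s - s0))%:~R *: l2.
  by apply: row2P; rewrite /lpoint !mxE; ring.
by apply: (step _ P2 P2N); apply: (step _ P1 P1N); apply: H; apply: (fl).
Qed.

(** On a closed parallelogram finitely many local lists suffice, and translation by a period only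
    adds a linear form to the germ, which creates no new break. *)
Lemma fan_global : exists E, forall x, fan E (germ F x).
Proof.
have [E fE] : exists E, forall t s : R, 0 <= t <= 1 -> 0 <= s <= 1 ->
    fan E (germ F (lpoint t s)).
  pose P (a b s1 s2 : R) := exists E, forall t s : R, a <= t <= b -> s1 <= s <= s2 ->
    fan E (germ F (lpoint t s)).
  suff : forall a b : R, a < b -> forall s1 s2, s1 < s2 -> P a b s1 s2.
    by apply; exact: ltr01.
  move=> a b ab s1 s2 s12; move: a b s1 s2 ab s12.
  apply: (cousin2 (P := P)) => [a b c s1 s2 _ _ _|a b s1 s2 s3 _ _ _|t s].
  - move=> [E1 f1] [E2 f2]; exists (E1 ++ E2) => t s /andP[at_ tc] ss.
    have [tb|/ltW bt] := leP t b.
      apply: fan_sub (f1 _ _ _ ss); last by rewrite at_.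
      by move=> u uE; rewrite mem_cat uE.
    apply: fan_sub (f2 _ _ _ ss); last by rewrite bt.
    by move=> u uE; rewrite mem_cat uE orbT.
  - move=> [E1 f1] [E2 f2]; exists (E1 ++ E2) => t s tt /andP[as_ sc].
    have [sb|/ltW bs] := leP s s2.
      apply: fan_sub (f1 _ _ tt _); last by rewrite as_.
      by move=> u uE; rewrite mem_cat uE.
    apply: fan_sub (f2 _ _ tt _); last by rewrite bs.
    by move=> u uE; rewrite mem_cat uE orbT.
  have [E [fG gG]] := plF (lpoint t s).
  have [r r0 H] := @lpoint_near (fun x => fan E (germ F x)) t s (fan_near fG gG).
  exists r => // a b s1 s2 _ _ /andP[t1 t2] /andP[u1 u2] ta bt sa bs; exists E.
  by move=> t' s' /andP[t'1 t'2] /andP[s'1 s'2]; apply: H; rewrite ltr_norml; lra.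
exists E; have per l q x : quasi_period F l q -> fan E (germ F x) -> fan E (germ F (x + l)).
  by move=> ql fx; rewrite (quasi_germ ql (plF x)).2; exact: fan_addl.
apply: (lattice_reduce (t0 := 0) (s0 := 0)).
- by move=> x; apply: per F1.
- by move=> x; apply: per (quasi_periodN F1).
- by move=> x; apply: per F2.
- by move=> x; apply: per (quasi_periodN F2).
by move=> t s /andP[t0 t1] /andP[s0 s1]; apply: fE; lra.
Qed.

Lemma finite_exceptions (Bad : V -> Prop) :
  (forall x, exists2 r, 0 < r & forall h, `|h| < r -> h != 0 -> ~ Bad (x + h)) ->
  forall a b s1 s2 : R, a < b -> s1 < s2 -> exists L : seq V,
    forall t s, a <= t <= b -> s1 <= s <= s2 -> Bad (lpoint t s) -> lpoint t s \in L.
Proof.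
move=> iso; pose P (a b s1 s2 : R) := exists L : seq V, forall t s,
  a <= t <= b -> s1 <= s <= s2 -> Bad (lpoint t s) -> lpoint t s \in L.
apply: (cousin2 (P := P)) => [a b c s1 s2 _ _ _|a b s1 s2 s3 _ _ _|t s].
- move=> [E1 f1] [E2 f2]; exists (E1 ++ E2) => t s /andP[at_ tc] ss bad.
  rewrite mem_cat; have [tb|/ltW bt] := leP t b.
    by rewrite f1 // at_.
  by rewrite f2 ?orbT // bt.
- move=> [E1 f1] [E2 f2]; exists (E1 ++ E2) => t s tt /andP[as_ sc] bad.
  rewrite mem_cat; have [sb|/ltW bs] := leP s s2.
    by rewrite f1 // as_.
  by rewrite f2 ?orbT // bs.
have [r r0 H] := iso (lpoint t s).
have [|e e0 H'] := @lpoint_near (fun x => Bad x -> x = lpoint t s) t s.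
  exists r => // h hr bad; have [->|h0] := eqVneq h 0; first by rewrite addr0.
  by case: (H h hr h0 bad).
exists e => // a b s1 s2 _ _ /andP[t1 t2] /andP[u1 u2] ta bt sa bs.
exists [:: lpoint t s] => t' s' /andP[t'1 t'2] /andP[s'1 s'2] bad.
by rewrite inE; apply/eqP; apply: H' bad; rewrite ltr_norml; lra.
Qed.

(** The trivial edge a = b is allowed: F is then affine near the point. *)
Definition transverse_edge l x := exists a b e,
  [/\ det2 e l != 0, pairing (toR a) e = pairing (toR b) e
    & germ F x = edge (toR a) (toR b) e].

Lemma quasi_transverse l l' q x : quasi_period F l' q ->
  transverse_edge l x -> transverse_edge l (x + l').
Proof.
move=> ql [a [b [e [el abe gx]]]]; exists (a + q), (b + q), e; split=> //.
  by rewrite !toRD !pairingDl abe.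
rewrite (quasi_germ ql (plF x)).2 gx; apply: funext => h.
by rewrite /edge !toRD !pairingDl; case: ifP.
Qed.

(** Near any x the points where transversality fails lie on x + R l1: they are x itself or points of
    an edge parallel to l1. So within a fundamental parallelogram only finitely many values of s are
    excluded. *)
Lemma good_lines (L : seq R) : exists s0 : R, [/\ 0 < s0 < 1, s0 \notin L
  & forall t, transverse_edge l1 (lpoint t s0)].
Proof.
have [M HM] : exists M : seq R, forall t s : R, 0 <= t <= 1 -> 0 <= s <= 1 ->
    ~ transverse_edge l1 (lpoint t s) -> s \in M.
  pose P (a b s1 s2 : R) := exists M : seq R, forall t s : R, a <= t <= b ->
    s1 <= s <= s2 -> ~ transverse_edge l1 (lpoint t s) -> s \in M.
  suff : forall a b : R, a < b -> forall s1 s2, s1 < s2 -> P a b s1 s2.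
    by apply; exact: ltr01.
  move=> a b ab s1 s2 s12; move: a b s1 s2 ab s12.
  apply: (cousin2 (P := P)) => [a b c s1 s2 _ _ _|a b s1 s2 s3 _ _ _|t s].
  - move=> [E1 f1] [E2 f2]; exists (E1 ++ E2) => t s /andP[at_ tc] ss bad.
    rewrite mem_cat; have [tb|/ltW bt] := leP t b.
      by rewrite (f1 t) // at_.
    by rewrite (f2 t) ?orbT // bt.
  - move=> [E1 f1] [E2 f2]; exists (E1 ++ E2) => t s tt /andP[as_ sc] bad.
    rewrite mem_cat; have [sb|/ltW bs] := leP s s2.
      by rewrite (f1 t) // as_.
    by rewrite (f2 t) ?orbT // bs.
  have [E [fG gG]] := plF (lpoint t s).
  have [r r0 near_x] := germ_near gG fG.
  have [|e e0 H] := @lpoint_near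
      (fun x => ~ transverse_edge l1 x -> lcoord2 x = s) t s.
    exists r => // h hr; have [->|h0] := eqVneq h 0.
      by rewrite addr0 lpoint_coord2.
    have [a [b [[abh _] gab _ _]]] := near_x h hr h0 => bad.
    have [hl|hl] := eqVneq (det2 h l1) 0; last first.
      by case: bad; exists a, b, h; rewrite (germE gab).
    rewrite /lcoord2 det2Dr [X in _ + X]det2C hl oppr0 addr0.
    by rewrite -/(lcoord2 _) lpoint_coord2.
  exists e => // a b s1 s2 _ _ /andP[t1 t2] /andP[u1 u2] ta bt sa bs; exists [:: s].
  move=> t' s' /andP[t'1 t'2] /andP[s'1 s'2] bad; rewrite inE -(lpoint_coord2 t' s').
  by apply/eqP; apply: H bad; rewrite ltr_norml; lra.
have [s0 s01] := exists_notin (L ++ M) ltr01.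
rewrite mem_cat negb_or => /andP[s0L s0M]; exists s0; split=> // t.
have step (n : int) x : transverse_edge l1 x -> transverse_edge l1 (x + n%:~R *: l1).
  exact: quasi_transverse (quasi_periodMz n F1).
have -> : lpoint t s0 = lpoint (t - (Num.floor t)%:~R) s0 + (Num.floor t)%:~R *: l1.
  by apply: row2P; rewrite /lpoint !mxE; ring.
apply: step; apply: contrapT => /HM; have := Num.Theory.floor_itv t.
rewrite rmorphD /= => tf; rewrite (negPf s0M) => H.
by apply: notF; apply: H; lra.
Qed.

End Lattice.
End QuasiPeriodic.

(** * Clipping to a fundamental parallelogram *)

Section UnitInterval.
Context {R : realType}.
Implicit Types (c a m s : R).

(* a and a + dl * m, for all small dl > 0, are in [c, c + 1]. *)
Definition stays_in c a m :=
  [&& c <= a <= c + 1, (a == c) ==> (0 <= m) & (a == c + 1) ==> (m <= 0)].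

Lemma stays_in_near c a m : stays_in c a m -> exists2 r, 0 < r &
  forall dl, 0 < dl -> dl < r ->
    stays_in c (a + dl * m) m /\ stays_in c (a + dl * m) (- m).
Proof.
move=> /and3P[/andP[ca ac] /implyP a0 /implyP a1].
have inner b k : c < b < c + 1 -> stays_in c b k.
  move=> /andP[cb bc]; apply/and3P; split; first by rewrite !ltW.
    by rewrite (gt_eqF cb).
  by rewrite (lt_eqF bc).
have [m0|m0|m0] := ltgtP m 0.
- have lt_a : c < a.
    by rewrite lt_neqAle ca andbT eq_sym; apply/negP => /a0; lra.
  exists ((c - a) / m) => [|dl dl0 dlr]; first by rewrite nmulr_lgt0 ?invr_lt0 //; lra.
  rewrite ltr_ndivlMr // in dlr; have dm : dl * m < 0 by rewrite pmulr_rlt0.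
  by split; apply: inner; lra.
- have lt_a : a < c + 1.
    by rewrite lt_neqAle ac andbT; apply/negP => /a1; lra.
  exists ((c + 1 - a) / m) => [|dl dl0 dlr]; first by rewrite divr_gt0 //; lra.
  rewrite ltr_pdivlMr // in dlr; have dm : 0 < dl * m by rewrite mulr_gt0.
  by split; apply: inner; lra.
exists 1 => // dl _ _; rewrite m0 mulr0 addr0 oppr0.
by split; apply/and3P; split; rewrite ?ca ?ac // lexx implybT.
Qed.

Lemma leaves_near c a m : ~~ stays_in c a m -> exists2 r, 0 < r &
  forall dl, 0 < dl -> dl < r -> ~~ (c <= a + dl * m <= c + 1).
Proof.
have far b (u v : R) : u < v -> exists2 r, 0 < r & forall dl, 0 < dl -> dl < r ->
    `|dl * b| < v - u.
  move=> uv; exists ((v - u) / (`|b| + 1)) => [|dl dl0].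
    by rewrite divr_gt0 ?subr_gt0 // ltr_wpDl.
  have b1 : 0 < `|b| + 1 by rewrite ltr_wpDl.
  rewrite ltr_pdivlMr // normrM (gtr0_norm dl0) mulrDr mulr1.
  by apply: le_lt_trans; rewrite lerDl ltW.
have [ca|/far] := leP c a; last first.
  move=> /(_ m)[r r0 H] _; exists r => // dl dl0 /(H dl dl0).
  by rewrite ltr_norml => ?; apply/negP; lra.
have [ac|/far] := leP a (c + 1); last first.
  move=> /(_ m)[r r0 H] _; exists r => // dl dl0 /(H dl dl0).
  by rewrite ltr_norml => ?; apply/negP; lra.
rewrite /stays_in ca ac /= negb_and !negb_imply => /orP[] /andP[/eqP-> hm].
  exists 1 => // dl dl0 _; rewrite -ltNge in hm.
  have : dl * m < 0 by rewrite pmulr_rlt0.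
  by move=> ?; apply/negP; lra.
exists 1 => // dl dl0 _; rewrite -ltNge in hm.
have : 0 < dl * m by rewrite mulr_gt0.
by move=> ?; apply/negP; lra.
Qed.

Lemma leaves_far c a m : m != 0 -> exists2 B, 0 < B & forall s, B <= `|s| ->
  ~~ (c <= a + s * m <= c + 1).
Proof.
rewrite -normr_gt0 => m0; exists ((`|a - c| + 2) / `|m|) => [|s].
  by rewrite divr_gt0 // ltr_wpDl.
rewrite ler_pdivrMr // -normrM => H; apply/negP => /andP[h1 h2].
have : `|s * m| <= `|a - c| + 1.
  have -> : s * m = (a + s * m - c) - (a - c) by ring.
  apply: le_trans (ler_normB _ _) _; rewrite addrC lerD2l ler_norml; lra.
by lra.
Qed.

End UnitInterval.

Section LineCancellation.
Context {R : realType}.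
Local Notation V := 'rV[R]_2.
Implicit Types (d e f h x y z : V) (S : seq R) (l : R).
Variables (F : V -> R) (l1 l2 : V) (t0 s0 : R).
Hypothesis plF : forall x, pl_at F x.
Hypothesis l12 : det2 l1 l2 != 0.
Local Notation c1 := (lcoord1 l1 l2).
Local Notation c2 := (lcoord2 l1 l2).

Lemma lcoord1D x y : c1 (x + y) = c1 x + c1 y.
Proof. by rewrite /lcoord1 det2Dl mulrDl. Qed.
Lemma lcoord2D x y : c2 (x + y) = c2 x + c2 y.
Proof. by rewrite /lcoord2 det2Dr mulrDl. Qed.
Lemma lcoord1Z (k : R) x : c1 (k *: x) = k * c1 x.
Proof. by rewrite /lcoord1 det2Zl mulrA. Qed.
Lemma lcoord2Z (k : R) x : c2 (k *: x) = k * c2 x.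
Proof. by rewrite /lcoord2 det2Zr mulrA. Qed.
Lemma lcoord1N x : c1 (- x) = - c1 x.
Proof. by rewrite /lcoord1 det2Nl mulNr. Qed.
Lemma lcoord2N x : c2 (- x) = - c2 x.
Proof. by rewrite /lcoord2 det2Nr mulNr. Qed.

Definition inward x e := stays_in t0 (c1 x) (c1 e) && stays_in s0 (c2 x) (c2 e).

Lemma inward_near x e : inward x e -> exists2 r, 0 < r & forall dl, 0 < dl -> dl < r ->
  inward (x + dl *: e) e /\ inward (x + dl *: e) (- e).
Proof.
move=> /andP[/stays_in_near[r r0 H] /stays_in_near[r' r'0 H']].
exists (Num.min r r') => [|dl dl0]; first by rewrite lt_min r0.
rewrite lt_min /inward lcoord1D lcoord2D lcoord1Z lcoord2Z lcoord1N lcoord2N.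
by move=> /andP[/(H _ dl0)[-> ->] /(H' _ dl0)[-> ->]].
Qed.

Lemma outward_near x e : ~~ inward x e -> exists2 r, 0 < r &
  forall dl, 0 < dl -> dl < r ->
    ~~ inward (x + dl *: e) e /\ ~~ inward (x + dl *: e) (- e).
Proof.
rewrite negb_and => /orP[] /leaves_near[r r0 H]; exists r => // dl dl0 /(H _ dl0) out.
  by rewrite /inward lcoord1D lcoord1Z /stays_in !(negPf out).
by rewrite /inward lcoord2D lcoord2Z /stays_in !(negPf out) !andbF.
Qed.

Lemma outward_far x e : e != 0 -> exists2 B : R, 0 < B & forall s, B <= `|s| ->
  forall f, ~~ inward (x + s *: e) f.
Proof.
move=> e0; have [a0|a0] := eqVneq (c1 e) 0; last first.
  have [B B0 H] := leaves_far t0 (c1 x) a0; exists B => // s /H out f.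
  by rewrite /inward lcoord1D lcoord1Z /stays_in !(negPf out).
have b0 : c2 e != 0.
  apply: contra e0 => /eqP b0; rewrite (lcoordK l12 e) a0 b0.
  by rewrite /lpoint !scale0r addr0.
have [B B0 H] := leaves_far s0 (c2 x) b0; exists B => // s /H out f.
by rewrite /inward lcoord2D lcoord2Z /stays_in !(negPf out) !andbF.
Qed.

(** Half-lines that leave the closed parallelogram at once are dropped, so that every line has zero
    contributions far away. *)
Definition inward_mult x e : R := if inward x e then ray_mult F x e else 0.

(** The contribution of e and minus that of - e are the right and left values of a step function
    along the line, by [ray_mult_near]. It is zero outside the parallelogram, so its jumps add up to
    zero. *)
Lemma one_line_cancel x e : e != 0 -> exists T : seq R, [/\ uniq T,
  forall s, inward_mult (x + s *: e) e + inward_mult (x + s *: e) (- e) != 0 -> s \in T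
  & \sum_(s <- T) (inward_mult (x + s *: e) e + inward_mult (x + s *: e) (- e)) = 0].
Proof.
move=> e0; pose Pp s := inward_mult (x + s *: e) e.
pose Pm s := - inward_mult (x + s *: e) (- e).
have half y f : f != 0 -> exists2 r, 0 < r & forall l, 0 < l -> l < r ->
    inward_mult (y + l *: f) f = inward_mult y f /\
    inward_mult (y + l *: f) (- f) = - inward_mult y f.
  move=> f0; have [r r0 H] := ray_mult_near (plF y) f0.
  have [r' r'0 H'] : exists2 r, 0 < r & forall l, 0 < l -> l < r ->
      inward (y + l *: f) f = inward y f /\ inward (y + l *: f) (- f) = inward y f.
    have [/inward_near[r' r'0 H']|/outward_near[r' r'0 H']] := boolP (inward y f).
      by exists r'.
    by exists r' => // l l0 lr; have [/negPf-> /negPf->] := H' l l0 lr.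
  exists (Num.min r r') => [|l l0]; first by rewrite lt_min r0.
  rewrite lt_min /inward_mult => /andP[/(H _ l0)[-> ->] /(H' _ l0)[-> ->]].
  by case: ifP; rewrite ?oppr0.
have loc t : exists2 r', 0 < r' & forall l, 0 < l -> l < r' ->
    [/\ Pp (t + l) = Pp t, Pm (t + l) = Pp t, Pp (t - l) = Pm t & Pm (t - l) = Pm t].
  have [r1 r10 h1] := half (x + t *: e) e e0.
  have Ne0 : - e != 0 by rewrite oppr_eq0.
  have [r2 r20 h2] := half (x + t *: e) (- e) Ne0.
  exists (Num.min r1 r2) => [|l l0]; first by rewrite lt_min r10.
  rewrite lt_min => /andP[lr1 lr2]; rewrite /Pp /Pm scalerDl scalerBl !addrA.
  have [-> Ep] := h1 l l0 lr1; have [Em Em'] := h2 l l0 lr2.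
  rewrite !scalerN opprK in Em Em'.
  by rewrite Ep opprK Em Em'.
have [B B0 far] := outward_far x e0.
have [|T [uT TB cov sumT]] := telescope_jumps loc (a := - B) (b := B).
  by rewrite gtrN.
have farE s f : B <= `|s| -> inward_mult (x + s *: e) f = 0.
  by move=> /far/(_ f)/negPf; rewrite /inward_mult => ->.
have PP s : Pp s - Pm s = inward_mult (x + s *: e) e + inward_mult (x + s *: e) (- e).
  by rewrite /Pm opprK.
exists T; split=> //.
  move=> s; apply: contraNT => sT; rewrite -PP subr_eq0; apply/eqP.
  have [Bs|sB] := leP B `|s|; first by rewrite /Pp /Pm !farE // oppr0.
  by apply: cov => //; rewrite ltr_norml in sB.
rewrite -(eq_bigr _ (fun s _ => PP s)) sumT /Pp /Pm !farE ?oppr0 ?addr0 //.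
  by rewrite ?normrN gtr0_norm.
by rewrite ?normrN gtr0_norm.
Qed.

Lemma line_cancel e (L : seq V) : e != 0 -> uniq L ->
  (forall x, inward_mult x e + inward_mult x (- e) != 0 -> x \in L) ->
  \sum_(x <- L) (inward_mult x e + inward_mult x (- e)) = 0.
Proof.
move=> e0; set f := fun x => inward_mult x e + inward_mult x (- e).
(* Induction on the size, removing one line parallel to e at a time; for this [L] need only contain
   the support on the lines that it meets. *)
suff main n : forall L : seq V, (size L <= n)%N -> uniq L ->
    (forall x y, x \in L -> det2 e y = det2 e x -> f y != 0 -> y \in L) ->
    \sum_(x <- L) f x = 0.
  by move=> uL cov; apply: (main (size L)) => // x y _ _; exact: cov.
move=> {L}; elim: n => [|n IH] [|x L] sL uL cov; rewrite ?big_nil //.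
rewrite (bigID (fun y => det2 e y == det2 e x)) /=.
rewrite -big_filter -[X in _ + X]big_filter.
have -> : \sum_(y <- [seq y <- x :: L | det2 e y != det2 e x]) f y = 0.
  apply: IH; last 1 first.
  - move=> y z; rewrite !mem_filter => /andP[yx yL] zy fz.
    by rewrite zy yx (cov y).
  - by rewrite /= eqxx /= size_filter (leq_trans (count_size _ _)).
  - exact: filter_uniq.
rewrite addr0; have [T [uT covT sumT]] := one_line_cancel x e0.
rewrite -[RHS]sumT; transitivity (\sum_(y <- [seq x + s *: e | s <- T]) f y); last first.
  by rewrite big_map.
apply: sum_over_support.
- exact: filter_uniq.
- rewrite map_inj_uniq // => s s' /addrI/eqP.
  by rewrite -subr_eq0 -scalerBl scaler_eq0 (negPf e0) orbF subr_eq0 => /eqP.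
move=> y fy; rewrite mem_filter; apply/idP/mapP => [/andP[/eqP yx yL]|[s sT yE]].
  have [|k yk] := parallel_det2 e0 (h := y - x).
    by rewrite det2Dr det2Nr yx subrr.
  have yE : y = x + k *: e by rewrite -yk addrC subrK.
  by exists k => //; apply: covT; rewrite -yE.
have yx : det2 e y = det2 e x by rewrite yE det2Dr det2Zr det2vv mulr0 addr0.
by rewrite yx eqxx /=; apply: (cov x) fy; rewrite ?mem_head.
Qed.

End LineCancellation.

Section EdgeGerms.
Context {R : realType}.
Local Notation V := 'rV[R]_2.
Implicit Types (a b c d e h l m x y z : V) (G : V -> R).

Lemma jump_addl E G c e : fan E G -> e != 0 ->
  jump (fun h => G h + pairing c h) e = jump G e.
Proof.
move=> fG e0; have [a [b [Gab _]]] := fG.2 e e0.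
rewrite (jumpE e0 Gab) (jumpE e0 (edge_at_addl c Gab)).
by rewrite opprD addrACA subrr addr0.
Qed.

Lemma edge_jump_off a b e h : det2 e h != 0 -> jump (edge a b e) h = 0.
Proof.
move=> eh; have h0 : h != 0 by apply: contra eh => /eqP->; rewrite /det2 !mxE; apply/eqP; ring.
by rewrite (jumpE h0 (edge_at_edge_off a b eh)) subrr pairing0l.
Qed.

Lemma edge_jumpN a b e h : e != 0 -> pairing a e = pairing b e -> h != 0 ->
  jump (edge a b e) (- h) = jump (edge a b e) h.
Proof.
move=> e0 abe h0; have [eh|eh] := eqVneq (det2 e h) 0; last first.
  by rewrite !edge_jump_off // det2Nr oppr_eq0.
have [k hk] := parallel_det2 e0 eh.
have k0 : k != 0 by apply: contra h0 => /eqP k0; rewrite hk k0 scale0r.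
have sw u a' b' : u != 0 -> edge_at (edge a b e) u a' b' -> edge_at (edge a b e) (- u) b' a' ->
    jump (edge a b e) (- u) = jump (edge a b e) u.
  move=> u0 E1 E2; have Nu0 : - u != 0 by rewrite oppr_eq0.
  by rewrite (jumpE u0 E1) (jumpE Nu0 E2) nrmN pairingNr -pairingNl opprB.
have pos (k' : R) : 0 < k' -> jump (edge a b e) (- (k' *: e)) = jump (edge a b e) (k' *: e).
  move=> k'0; apply: (sw _ a b).
  - by rewrite scaler_eq0 negb_or e0 gt_eqF.
  - by apply: edge_at_scale (edge_at_edge abe) => //; exact: edge_homogeneous.
  rewrite -scalerN; apply: edge_at_scale (edge_at_edgeN e0 abe) => //.
  exact: edge_homogeneous.
rewrite hk; have [kn|kp|/eqP] := ltgtP k 0; last by rewrite (negPf k0).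
  by rewrite -[k]opprK scaleNr opprK -pos ?oppr_gt0.
exact: pos.
Qed.

(** Along the edge opposite rays have equal jumps and opposite slopes; off it there is no jump. *)
Lemma edge_ray_cancel F x a b e h : germ F x = edge a b e -> e != 0 ->
  pairing a e = pairing b e -> h != 0 -> ray_mult F x h + ray_mult F x (- h) = 0.
Proof.
move=> gx e0 abe h0; rewrite /ray_mult gx edge_jumpN // -mulrDr.
have [eh|eh] := eqVneq (det2 e h) 0; last by rewrite edge_jump_off // mul0r.
by rewrite edge_fold // eh normr0 !mulr0.
Qed.

End EdgeGerms.

(** * The contribution of two opposite sides *)

Section Side.
Context {R : realType}.
Local Notation V := 'rV[R]_2.
Local Notation Z2 := 'rV[int]_2.
Implicit Types (e h x y z : V).
Variables (F : V -> R) (d : V) (S : seq R).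
Hypothesis d0 : d != 0.
Hypothesis uS : uniq S.
Hypothesis plF : forall x, pl_at F x.
Hypothesis fF : forall x, fan [seq ray d s | s <- S] (germ F x).
Variables (l m : V) (ql qm : Z2).
Hypothesis lm : det2 l m != 0.
Hypothesis Fl : quasi_period F l ql.
Hypothesis Fm : quasi_period F m qm.

(** e points to the same side of the line of l as m, whatever the orientation of (l, m). *)
Definition upward e := 0 < det2 l e * det2 l m.

Lemma rays_opp : perm_eq (rays d S) [seq - e | e <- rays d S].
Proof.
have -> : [seq - e | e <- rays d S] = [seq - ray d s | s <- S] ++ [seq ray d s | s <- S].
  by rewrite map_cat -!map_comp; congr (_ ++ _); apply: eq_map => s /=; rewrite opprK.
by rewrite perm_catC.
Qed.

Lemma sum_rays_opp (P : V -> bool) (f : V -> R) :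
  \sum_(e <- rays d S | P (- e)) f e = \sum_(e <- rays d S | P e) f (- e).
Proof.
rewrite (perm_big _ rays_opp) /= big_map.
by apply: eq_bigl => e; rewrite opprK.
Qed.

Definition side_flux z : R := \sum_(e <- rays d S | upward e)
  (ray_mult F z e + ray_mult F (z + m) (- e)).

(** At a point of an edge transverse to l at most one upward ray carries a jump, so this is the
    weighted direction of the edge on the side of m. *)
Definition up_vector z : V :=
  \sum_(e <- rays d S | upward e) jump (germ F z) e *: e.

Lemma pairing_sum (I : Type) (r : seq I) (P : pred I) (f : I -> V) h :
  pairing h (\sum_(i <- r | P i) f i) = \sum_(i <- r | P i) pairing h (f i).
Proof.
elim: r => [|i r IH]; first by rewrite !big_nil pairing0r.
by rewrite !big_cons; case: ifP => // _; rewrite pairingDr IH.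
Qed.

(** The germ at z + m is the one at z plus qm. Without qm the contributions of h at z and of - h at
    z + m would cancel as inside an edge; qm leaves minus its value at the jump times h. *)
Lemma side_fluxE z (a b : Z2) e : germ F z = edge (toR a) (toR b) e -> e != 0 ->
  pairing (toR a) e = pairing (toR b) e ->
  side_flux z = - pairing (toR qm) (up_vector z).
Proof.
move=> gz e0 abe; rewrite /up_vector pairing_sum -sumrN /side_flux.
rewrite !(big_seq_cond upward); apply: eq_bigr => h /andP[hS _].
have h0 := rays_neq0 d0 hS; have Nh0 : - h != 0 by rewrite oppr_eq0.
have -> : ray_mult F (z + m) (- h) = ray_mult F z (- h) - pairing (toR qm) (jump (germ F z) h *: h).
  rewrite /ray_mult (quasi_germ Fm (plF z)).2 (jump_addl _ (fF z)) //.
  by rewrite mulrDr pairingNr mulrN gz edge_jumpN // pairingZr.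
by rewrite addrA (edge_ray_cancel gz e0) // sub0r.
Qed.

Lemma up_vectorE z (a b : Z2) e h : germ F z = edge (toR a) (toR b) e -> e != 0 ->
  pairing (toR a) e = pairing (toR b) e -> det2 e l != 0 ->
  (let fwd := if 0 < det2 e l then b else a in
   let bwd := if 0 < det2 e l then a else b in
   pairing (toR fwd - toR bwd) h) = - (Num.sg (det2 l m) * det2 (up_vector z) h).
Proof.
move=> gz e0 abe el /=.
have el' : det2 l e = - det2 e l by rewrite det2C.
have [eab|ab] := eqVneq a b.
  rewrite eab !if_same subrr pairing0l /up_vector big_seq_cond big1 ?det2Zl.
    by rewrite /det2 !mxE !mul0r subrr mulr0 oppr0.
  move=> u /andP[uS' _]; have u0 := rays_neq0 d0 uS'.
  rewrite gz eab; have E : edge_at (edge (toR b : V) (toR b) e) u (toR b) (toR b).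
    by split=> //; exists 1 => // k _; rewrite !edge_same.
  by rewrite (jumpE u0 E) subrr pairing0l scale0r.
have ab' : toR a != toR b :> V by rewrite (inj_eq (@toR_inj R)).
(* The direction of the edge on the side of m. It is a positive multiple of one normalized ray,
   which gives the only nonzero term of the sum. *)
pose eu := if upward e then e else - e.
have eu0 : eu != 0 by rewrite /eu; case: ifP; rewrite ?oppr_eq0.
have up_eu : upward eu.
  rewrite /eu; case: ifP => // /negbT; rewrite /upward -leNgt det2Nr mulNr.
  rewrite oppr_gt0 lt_neqAle => ->; rewrite andbT mulf_neq0 //.
  by rewrite el' oppr_eq0.
have je : jump (germ F z) e = pairing (toR b - toR a) (nrm e).
  by rewrite gz (jumpE e0 (edge_at_edge abe)).
have jeu : jump (germ F z) eu = jump (germ F z) e.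
  by rewrite /eu; case: ifP => //; rewrite gz edge_jumpN.
have jh : det2 (jump (germ F z) eu *: eu) h =
    (if upward e then 1 else -1) * pairing (toR b - toR a) h.
  rewrite det2Zl jeu je /eu (pairingBl _ _ h) (ortho_jump _ e0 abe).
  by case: ifP => _; rewrite ?det2Nl; ring.
have jneq : jump (germ F z) eu != 0.
  rewrite jeu gz (jump_eq0 e0 (edge_at_edge abe)) //.
have [u uR [s s0 euE]] := fan_ray d0 (fF z) eu0 jneq.
have u0 := rays_neq0 d0 uR.
have wE : up_vector z = jump (germ F z) eu *: eu.
  rewrite /up_vector big_mkcond /= (bigD1_seq u) ?rays_uniq //=.
  have -> : upward u by move: up_eu; rewrite /upward euE det2Zr -mulrA pmulr_rgt0.
  rewrite euE (jump_scale (fF z)) // scalerA mulrAC mulVf ?gt_eqF // mul1r.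
  rewrite big_seq_cond big1 ?addr0 // => v /andP[vR vu].
  case: ifP => // up_v; have v0 := rays_neq0 d0 vR.
  have [->|jv] := eqVneq (jump (germ F z) v) 0; first by rewrite scale0r.
  exfalso; have ev : det2 eu v = 0.
    have [ev|ev] := eqVneq (det2 e v) 0.
      by rewrite /eu; case: ifP => _; rewrite ?det2Nl ev ?oppr0.
    by move: jv; rewrite gz edge_jump_off ?eqxx.
  have [k vk] := parallel_det2 eu0 ev.
  have k0 : 0 < k.
    by move: up_v; rewrite /upward vk det2Zr -mulrA pmulr_lgt0.
  have kE : (k * s) *: u = 1 *: v by rewrite scale1r vk euE scalerA.
  have [_ uv] := rays_inj d0 uR vR (mulr_gt0 k0 s0) ltr01 kE.
  by move: vu; rewrite uv eqxx.
rewrite wE jh.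
have := lm; rewrite neq_lt => /orP[lm0|lm0].
  rewrite (ltr0_sg lm0) /upward nmulr_lgt0 // el' oppr_lt0.
  by case: ifP => _; rewrite !pairingBl; ring.
rewrite (gtr0_sg lm0) /upward pmulr_lgt0 // el' oppr_gt0.
have -> : (det2 e l < 0) = ~~ (0 < det2 e l).
  by rewrite -leNgt lt_neqAle el.
by case: ifP => _ /=; rewrite !pairingBl; ring.
Qed.

Lemma det2_sum (I : Type) (r : seq I) (f : I -> V) h :
  det2 (\sum_(i <- r) f i) h = \sum_(i <- r) det2 (f i) h.
Proof.
elim: r => [|i r IH]; first by rewrite !big_nil /det2 !mxE !mul0r subrr.
by rewrite !big_cons det2Dl IH.
Qed.

Lemma germ_linear_near z (a b : Z2) e : germ F z = edge (toR a) (toR b) e -> e != 0 ->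
  exists2 r, 0 < r & forall h, `|h| < r -> det2 e h != 0 ->
    germ F (z + h) = pairing (toR (if 0 <= det2 e h then b else a)).
Proof.
move=> gz e0; have [E [fG gG]] := plF z; have [r r0 near_z] := germ_near gG fG.
exists r => // h hr eh.
have h0 : h != 0 by apply: contra eh => /eqP->; rewrite /det2 !mxE; apply/eqP; ring.
have [a' [b' [Gab gzh _ _]]] := near_z h hr h0.
rewrite gz in Gab.
have [ea eb] := edge_at_unique h0 Gab (edge_at_edge_off (toR a) (toR b) eh).
rewrite (germE gzh) ea eb; apply: funext => k; rewrite edge_same.
by case: ifP.
Qed.

(** Between p and p + l the gradient changes by ql in total, so ql is, up to sign, the rotation of
    the sum W of the up vectors; pairing qm with W is then a determinant of ql and qm. *)
Lemma side_sum p : (forall t, transverse_edge F l (p + t *: l)) ->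
  (exists a : Z2, germ F p = pairing (toR a)) ->
  exists T : seq R, [/\ uniq T, forall t, t \in T -> 0 < t < 1,
    forall t, 0 < t < 1 -> t \notin T -> forall e, e != 0 -> jump (germ F (p + t *: l)) e = 0
  & \sum_(t <- T) side_flux (p + t *: l) =
      - (Num.sg (det2 l m) * det2 (toR ql) (toR qm))].
Proof.
move=> tr [c gp].
have /choice[g gP] : forall t, exists abe : Z2 * Z2 * V, let: (a, b, e) := abe in
    [/\ det2 e l != 0, pairing (toR a) e = pairing (toR b) e
     & germ F (p + t *: l) = edge (toR a) (toR b) e].
  by move=> t; have [a [b [e H]]] := tr t; exists (a, b, e).
(* Gradients just after and just before t: moving along l enters the left side of e iff
   [0 < det2 e l]. *)
pose Pp t := let: (a, b, e) := g t in toR (if 0 < det2 e l then b else a) : V.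
pose Pm t := let: (a, b, e) := g t in toR (if 0 < det2 e l then a else b) : V.
have nz e : det2 e l != 0 -> e != 0.
  by apply: contra => /eqP->; rewrite /det2 !mxE; apply/eqP; ring.
have linear t (a : Z2) : germ F (p + t *: l) = pairing (toR a) ->
    Pp t = toR a /\ Pm t = toR a.
  rewrite /Pp /Pm; have := gP t; case: (g t) => -[a' b'] e [el abe ->] E.
  have [|E1 E2] := edge_inj (nz _ el) abe (erefl (pairing (toR a) e)).
    by rewrite E; apply: funext => h; rewrite edge_same.
  by split; case: ifP.
have loc t : exists2 r', 0 < r' & forall k, 0 < k -> k < r' ->
    [/\ Pp (t + k) = Pp t, Pm (t + k) = Pp t, Pp (t - k) = Pm t & Pm (t - k) = Pm t].
  have := gP t; rewrite {2 3}/Pp {2 4}/Pm.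
  case gt_ : (g t) => [[a b] e] [el abe gz].
  have [r r0 H] := germ_linear_near gz (nz _ el).
  have [k k0 hk] := scale_small_le l r0; exists k => // k' k'0 k'k.
  have kl := hk k' (ltW k'0) (ltW k'k); have klN : `|- (k' *: l)| < r by rewrite normrN.
  have d1 : det2 e (k' *: l) != 0 by rewrite det2Zr mulf_neq0 // gt_eqF.
  have d2 : det2 e (- (k' *: l)) != 0 by rewrite det2Nr oppr_eq0.
  have := H _ kl d1; have := H _ klN d2.
  rewrite -!addrA -scaleNr -!scalerDl scaleNr det2Nr det2Zr oppr_ge0 !(pmulr_rge0, pmulr_rle0) //.
  rewrite (le_eqVlt 0) eq_sym (negPf el) /= => gN gP'.
  have [P1 P2] := linear _ _ gP'; have [P3 P4] := linear _ _ gN.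
  have -> : (if 0 < det2 e l then a else b) = (if det2 e l <= 0 then b else a).
    by rewrite leNgt; case: ifP.
  by [].
have [T [uT T01 cov sumT]] := telescope_jumps loc ltr01.
exists T; split=> //.
  move=> t t01 tT e e0; have := cov t t01 tT; rewrite /Pp /Pm.
  have := gP t; case: (g t) => -[a b] e' [el abe ->] fb.
  have eab : a = b by move: fb; case: ifP => _ /toR_inj.
  have E : edge_at (edge (toR a : V) (toR b) e') e (toR a) (toR a).
    by split=> //; exists 1 => // k _; rewrite eab !edge_same.
  by rewrite (jumpE e0 E) subrr pairing0l.
have [P0 _] : Pp 0 = toR c /\ Pm 0 = toR c by apply: linear; rewrite scale0r addr0.
have [_ P1] : Pp 1 = toR (c + ql) /\ Pm 1 = toR (c + ql).
  apply: linear; rewrite scale1r (quasi_germ Fl (plF p)).2 gp; apply: funext => h.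
  by rewrite toRD pairingDl.
rewrite P0 P1 toRD addrAC subrr add0r in sumT.
pose W := \sum_(t <- T) up_vector (p + t *: l).
have qlW h : pairing (toR ql) h = - (Num.sg (det2 l m) * det2 W h).
  rewrite -sumT /W det2_sum mulr_sumr -sumrN.
  have -> : forall (s : seq R) (f : R -> V),
      pairing (\sum_(t <- s) f t) h = \sum_(t <- s) pairing (f t) h.
    move=> s f; elim: s => [|t s IH]; first by rewrite !big_nil pairing0l.
    by rewrite !big_cons pairingDl IH.
  apply: eq_bigr => t _; rewrite /Pp /Pm; have := gP t.
  by case: (g t) => -[a b] e [el abe gz]; exact: (up_vectorE h gz (nz _ el) abe el).
have -> : \sum_(t <- T) side_flux (p + t *: l) = - pairing (toR qm) W.
  rewrite /W pairing_sum -sumrN; apply: eq_bigr => t _.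
  by have := gP t; case: (g t) => -[a b] e [el abe gz]; exact: side_fluxE gz (nz _ el) abe.
have E0 : (toR ql : V) 0 0 = Num.sg (det2 l m) * W 0 1.
  have := qlW (vec2 1 0); rewrite /det2 !pairing2 !vec20 !vec21 !mulr0 !mulr1 !addr0.
  by move=> ->; ring.
have E1 : (toR ql : V) 0 1 = - (Num.sg (det2 l m) * W 0 0).
  have := qlW (vec2 0 1); rewrite /det2 !pairing2 !vec20 !vec21 !mulr0 !mulr1 !add0r.
  by move=> ->; ring.
rewrite pairing2 [det2 (toR ql) _]/det2 E0 E1.
have := lm; rewrite neq_lt => /orP[lm0|lm0].
  by rewrite (ltr0_sg lm0); ring.
by rewrite (gtr0_sg lm0); ring.
Qed.

End Side.

Section StaysIn.
Context {R : realType}.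
Implicit Types (c a m : R).

Lemma stays_in_inner c a m : c < a < c + 1 -> stays_in c a m.
Proof.
move=> /andP[ca ac]; apply/and3P; split; first by rewrite !ltW.
  by rewrite (gt_eqF ca).
by rewrite (lt_eqF ac).
Qed.

Lemma stays_in_left c m : stays_in c c m = (0 <= m).
Proof.
have c1 : c < c + 1 by rewrite ltrDl.
by rewrite /stays_in lexx (ltW c1) eqxx (lt_eqF c1) /= andbT.
Qed.

Lemma stays_in_right c m : stays_in c (c + 1) m = (m <= 0).
Proof.
have c1 : c < c + 1 by rewrite ltrDl.
by rewrite /stays_in lexx (ltW c1) eqxx (gt_eqF c1).
Qed.

End StaysIn.

Section ParallelogramSides.
Context {R : realType}.
Local Notation V := 'rV[R]_2.
Local Notation Z2 := 'rV[int]_2.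
Implicit Types (e h x y z : V).
Variables (F : V -> R) (d : V) (S : seq R).
Hypothesis d0 : d != 0.
Hypothesis uS : uniq S.
Hypothesis plF : forall x, pl_at F x.
Hypothesis fF : forall x, fan [seq ray d s | s <- S] (germ F x).

Definition no_jump x := forall e, e != 0 -> jump (germ F x) e = 0.

Lemma no_jumpD x l q : quasi_period F l q -> no_jump x -> no_jump (x + l).
Proof.
by move=> Fl nx e e0; rewrite (quasi_germ Fl (plF x)).2 (jump_addl _ (fF x)) // nx.
Qed.

Lemma linear_no_jump x (a : Z2) : germ F x = pairing (toR a) -> no_jump x.
Proof.
move=> gx e e0; have E : edge_at (pairing (toR a)) e (toR a : V) (toR a).
  by split=> //; exists 1 => // k _; rewrite edge_same.
by rewrite gx (jumpE e0 E) subrr pairing0l.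
Qed.

Definition corner_sum (l1 l2 : V) (t0 s0 : R) x : R :=
  \sum_(e <- rays d S) inward_mult F l1 l2 t0 s0 x e.

Lemma no_jump_corner_sum l1 l2 t0 s0 x : no_jump x -> corner_sum l1 l2 t0 s0 x = 0.
Proof.
move=> nx; rewrite /corner_sum big_seq big1 // => e eS.
by rewrite /inward_mult /ray_mult nx ?(rays_neq0 d0 eS) // mul0r if_same.
Qed.

Lemma lcoord_swap l1 l2 x : lcoord1 l2 l1 x = lcoord2 l1 l2 x.
Proof. by rewrite /lcoord1 /lcoord2 (det2C x) (det2C l2) invrN mulrNN. Qed.

(** Exchanging the two periods lets one lemma treat both pairs of sides. *)
Lemma corner_sum_swap l1 l2 t0 s0 x :
  corner_sum l1 l2 t0 s0 x = corner_sum l2 l1 s0 t0 x.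
Proof.
apply: eq_bigr => e _.
by rewrite /inward_mult /inward !lcoord_swap -!(lcoord_swap l2 l1) andbC.
Qed.

(** Clipping keeps the rays pointing up on the lower side and those pointing down on the opposite
    one; rays parallel to the side carry no jump, as all edges cross it. This is the flux computed
    by [side_sum]. *)
Lemma side_contribution (l1 l2 : V) (q1 q2 : Z2) (t0 s0 : R) : det2 l1 l2 != 0 ->
  quasi_period F l1 q1 -> quasi_period F l2 q2 ->
  let p := lpoint l1 l2 t0 s0 in
  (forall t, transverse_edge F l1 (p + t *: l1)) ->
  (exists a : Z2, germ F p = pairing (toR a)) ->
  exists T : seq R, [/\ uniq T, forall t, t \in T -> 0 < t < 1,
    forall t, 0 <= t <= 1 -> t \notin T -> no_jump (p + t *: l1)
  & \sum_(t <- T) (corner_sum l1 l2 t0 s0 (p + t *: l1) +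
                   corner_sum l1 l2 t0 s0 (p + t *: l1 + l2)) =
    - (Num.sg (det2 l1 l2) * det2 (toR q1) (toR q2))].
Proof.
move=> l12 F1 F2 p tr [a gp].
have [T [uT T01 cov <-]] := side_sum d0 uS plF fF l12 F1 F2 tr (ex_intro _ a gp).
exists T; split=> //.
  have n0 := linear_no_jump gp.
  move=> t /andP[t0' t1] tT; have [t00|tpos] := leP t 0.
    by have -> : t = 0 by [apply/eqP; rewrite eq_le t00]; rewrite scale0r addr0.
  have [t10|tlt1] := leP 1 t.
    have -> : t = 1 by [apply/eqP; rewrite eq_le t10 t1].
    by rewrite scale1r; exact: no_jumpD F1 n0.
  by apply: cov => //; rewrite tpos.
have upE e : upward l1 l2 e = (0 < lcoord2 l1 l2 e).
  rewrite /upward /lcoord2; have := l12; rewrite neq_lt => /orP[lm0|lm0].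
    by rewrite nmulr_lgt0 // nmulr_lgt0 // invr_lt0.
  by rewrite pmulr_lgt0 // pmulr_lgt0 // invr_gt0.
apply: eq_big_seq => t /T01 t01; set z := p + t *: l1.
have cz1 : lcoord1 l1 l2 z = t0 + t.
  rewrite /z lcoord1D lcoord1Z lpoint_coord1 //; congr (_ + _).
  by rewrite /lcoord1 divff // mulr1.
have cz2 : lcoord2 l1 l2 z = s0.
  rewrite /z lcoord2D lcoord2Z lpoint_coord2 // /lcoord2 det2vv mul0r mulr0.
  by rewrite addr0.
have c1l2 : lcoord1 l1 l2 l2 = 0 by rewrite /lcoord1 det2vv mul0r.
have c2l2 : lcoord2 l1 l2 l2 = 1 by rewrite /lcoord2 divff.
have in1 m : stays_in t0 (t0 + t) m.
  by apply: stays_in_inner; move: t01 => /andP[? ?]; lra.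
have par e : e != 0 -> lcoord2 l1 l2 e = 0 -> jump (germ F z) e = 0.
  move=> e0 /eqP; rewrite /lcoord2 mulf_eq0 invr_eq0 (negPf l12) orbF => /eqP l1e.
  have [b [c [e' [el' _ ->]]]] := tr t; apply: edge_jump_off.
  have l10 : l1 != 0 by apply: contra l12 => /eqP->; rewrite /det2 !mxE; apply/eqP; ring.
  have [k ek] := parallel_det2 l10 l1e.
  rewrite ek det2Zr mulf_neq0 //; apply: contra e0 => /eqP k0.
  by rewrite ek k0 scale0r.
rewrite /side_flux big_split /=; congr (_ + _).
  rewrite [RHS]big_mkcond; apply: eq_big_seq => e eS; have e0 := rays_neq0 d0 eS.
  rewrite /inward_mult /inward cz1 cz2 in1 stays_in_left /= upE le_eqVlt.
  have [ce|//] := eqVneq 0 (lcoord2 l1 l2 e).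
  by rewrite -ce ltxx /ray_mult par // mul0r.
rewrite -(sum_rays_opp d S (upward l1 l2)) [RHS]big_mkcond.
apply: eq_big_seq => e eS; have e0 := rays_neq0 d0 eS.
rewrite /inward_mult /inward lcoord1D lcoord2D c1l2 c2l2 addr0 cz1 cz2 in1 stays_in_right.
rewrite /= upE lcoord2N oppr_gt0 le_eqVlt.
have [ce|//] := eqVneq (lcoord2 l1 l2 e) 0.
rewrite ce ltxx /ray_mult (quasi_germ F2 (plF z)).2 (jump_addl _ (fF z)) //.
by rewrite par // mul0r.
Qed.

Lemma finite_nonlinear l (x : V) : (forall t, transverse_edge F l (x + t *: l)) ->
  exists M : seq R, forall t, 0 <= t <= 1 ->
    ~ (exists a : Z2, germ F (x + t *: l) = pairing (toR a)) -> t \in M.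
Proof.
move=> tr; pose P (a b : R) := exists M : seq R, forall t, a <= t <= b ->
    ~ (exists a : Z2, germ F (x + t *: l) = pairing (toR a)) -> t \in M.
suff : forall a b : R, a < b -> P a b by apply; exact: ltr01.
apply: cousin => [a b c _ _ [M1 h1] [M2 h2]|t].
  exists (M1 ++ M2) => t /andP[at_ tc] nl; rewrite mem_cat.
  have [tb|/ltW bt] := leP t b; first by rewrite h1 ?at_.
  by rewrite h2 ?bt ?orbT.
have [a [b [e [el _ gz]]]] := tr t.
have e0 : e != 0 by apply: contra el => /eqP->; rewrite /det2 !mxE; apply/eqP; ring.
have [r r0 H] := germ_linear_near plF gz e0.
have l1 : 0 < `|l| + 1 by rewrite ltr_wpDl.
exists (r / (`|l| + 1)) => [|a' b' _ /andP[at_ tb] ta bt]; first exact: divr_gt0.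
exists [:: t] => u /andP[au ub] nl; rewrite inE; apply/negPn/negP => ut; apply: nl.
have -> : x + u *: l = x + t *: l + (u - t) *: l by rewrite -addrA -scalerDl [t + _]addrC subrK.
eexists; apply: H.
  have : `|u - t| < r / (`|l| + 1) by rewrite ltr_norml; lra.
  rewrite ltr_pdivlMr // normrZ mulrDr mulr1; apply: le_lt_trans.
  by rewrite lerDl.
by rewrite det2Zr mulf_neq0 // subr_eq0.
Qed.

End ParallelogramSides.

(** * The sum over a fundamental parallelogram *)

Section TotalMultiplicity.
Context {R : realType}.
Local Notation V := 'rV[R]_2.
Local Notation Z2 := 'rV[int]_2.
Implicit Types (e h x y z : V).
Variables (F : V -> R) (d : V) (S : seq R).
Hypothesis d0 : d != 0.
Hypothesis uS : uniq S.
Hypothesis plF : forall x, pl_at F x.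
Hypothesis fF : forall x, fan [seq ray d s | s <- S] (germ F x).
Variables (l1 l2 : V) (q1 q2 : Z2).
Hypothesis l12 : det2 l1 l2 != 0.
Hypothesis F1 : quasi_period F l1 q1.
Hypothesis F2 : quasi_period F l2 q2.
Local Notation c1 := (lcoord1 l1 l2).
Local Notation c2 := (lcoord2 l1 l2).

(** Points where F is affine are included, with a = b; the complement is the set of vertices. *)
Definition edge_point x := exists (a b : Z2) e, [/\ e != 0,
  pairing (toR a) e = pairing (toR b) e & germ F x = edge (toR a) (toR b) e].

Lemma quasi_edge_point l q x : quasi_period F l q -> edge_point x -> edge_point (x + l).
Proof.
move=> ql [a [b [e [e0 abe gx]]]]; exists (a + q), (b + q), e; split=> //.
  by rewrite !toRD !pairingDl abe.
rewrite (quasi_germ ql (plF x)).2 gx; apply: funext => h.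
by rewrite /edge !toRD !pairingDl; case: ifP.
Qed.

Lemma edge_point_near x : exists2 r, 0 < r & forall h, `|h| < r -> h != 0 ->
  ~ ~ edge_point (x + h).
Proof.
have [E [fG gG]] := plF x; have [r r0 H] := germ_near gG fG.
exists r => // h hr h0; apply; have [a [b [[abh _] gab _ _]]] := H h hr h0.
by exists a, b, h; split=> //; exact: germE.
Qed.

(** The clipped contributions add up to zero, line by line. Interior vertices contribute their full
    multiplicity and each pair of opposite sides minus the same signed determinant, hence the factor
    2. The parallelogram is placed so that its sides avoid all vertices and F is affine at its
    corners. *)
Lemma total_multiplicity : exists (L : seq V) (t0 s0 : R), [/\ uniq L,
  forall x, x \in L -> [/\ ~ edge_point x, t0 < c1 x < t0 + 1 & s0 < c2 x < s0 + 1],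
  forall x, ~ edge_point x -> exists n1 n2 : int, x + n1%:~R *: l1 + n2%:~R *: l2 \in L
  & \sum_(x <- L) vertex_mult d S F x =
      Num.sg (det2 l1 l2) * det2 (toR q1) (toR q2) * 2].
Proof.
have [s0 [s01 _ good1]] := good_lines plF l12 F1 [::].
have tr1 t : transverse_edge F l1 (lpoint l1 l2 0 s0 + t *: l1).
  have -> : lpoint l1 l2 0 s0 + t *: l1 = lpoint l1 l2 t s0.
    by rewrite /lpoint scale0r add0r addrC.
  exact: good1.
have [M HM] := finite_nonlinear plF tr1.
have l21 : det2 l2 l1 != 0 by rewrite det2C oppr_eq0.
(* [M] lists the points of the first side where F is not affine; avoiding it makes F affine at the
   corner p. *)
have [t0 [t01 t0M good2]] := good_lines plF l21 F2 M.
pose p := lpoint l1 l2 t0 s0.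
have pE : p = lpoint l2 l1 s0 t0 by rewrite /p /lpoint addrC.
have lin_p : exists a : Z2, germ F p = pairing (toR a).
  apply: contrapT => nl; move: t0M; rewrite HM //.
    by case/andP: t01 => *; rewrite !ltW.
  have -> // : lpoint l1 l2 0 s0 + t0 *: l1 = p.
  by rewrite /p /lpoint scale0r add0r addrC.
have trp1 t : transverse_edge F l1 (p + t *: l1).
  have -> : p + t *: l1 = lpoint l1 l2 (t0 + t) s0.
    by rewrite /p /lpoint scalerDl addrAC.
  exact: good1.
have trp2 t : transverse_edge F l2 (lpoint l2 l1 s0 t0 + t *: l2).
  have -> : lpoint l2 l1 s0 t0 + t *: l2 = lpoint l2 l1 (s0 + t) t0.
    by rewrite /lpoint scalerDl addrAC.
  exact: good2.
have [T1 [uT1 T101 cov1 sum1]] := side_contribution d0 uS plF fF l12 F1 F2 trp1 lin_p.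
rewrite pE in lin_p.
have [T2 [uT2 T201 cov2 sum2]] := side_contribution d0 uS plF fF l21 F2 F1 trp2 lin_p.
rewrite -pE -/p in sum1 sum2 cov1 cov2.
pose f := corner_sum F d S l1 l2 t0 s0.
have f2E x : corner_sum F d S l2 l1 s0 t0 x = f x by rewrite -corner_sum_swap.
have c1l1 : c1 l1 = 1 by rewrite /lcoord1 divff.
have c2l1 : c2 l1 = 0 by rewrite /lcoord2 det2vv mul0r.
have c1l2 : c1 l2 = 0 by rewrite /lcoord1 det2vv mul0r.
have c2l2 : c2 l2 = 1 by rewrite /lcoord2 divff.
have c1p : c1 p = t0 by exact: lpoint_coord1.
have c2p : c2 p = s0 by exact: lpoint_coord2.
have xE x : x = p + (c1 x - t0) *: l1 + (c2 x - s0) *: l2.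
  by rewrite {1}(lcoordK l12 x) /p /lpoint !scalerBl; apply: row2P; rewrite !mxE; ring.
clearbody p.
have bottomP x : c2 x = s0 -> t0 <= c1 x <= t0 + 1 ->
    x \in [seq p + t *: l1 | t <- T1] \/ no_jump F x.
  move=> c2x /andP[h1 h2]; have xx := xE x.
  rewrite c2x subrr scale0r addr0 in xx.
  have [tT|tT] := boolP (c1 x - t0 \in T1); [left|right].
    by apply/mapP; exists (c1 x - t0).
  by rewrite xx; apply: cov1 => //; lra.
have leftP x : c1 x = t0 -> s0 <= c2 x <= s0 + 1 ->
    x \in [seq p + t *: l2 | t <- T2] \/ no_jump F x.
  move=> c1x /andP[h1 h2]; have xx := xE x.
  rewrite c1x subrr scale0r addr0 in xx.
  have [tT|tT] := boolP (c2 x - s0 \in T2); [left|right].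
    by apply/mapP; exists (c2 x - s0).
  by rewrite xx; apply: cov2 => //; lra.
have topP x : c2 x = s0 + 1 -> t0 <= c1 x <= t0 + 1 ->
    x \in [seq p + t *: l1 + l2 | t <- T1] \/ no_jump F x.
  move=> c2x c1x; have [||xL|nx] := bottomP (x - l2).
  - by rewrite lcoord2D lcoord2N c2x c2l2 addrK.
  - by rewrite lcoord1D lcoord1N c1l2 subr0.
  - left; case/mapP: xL => t tT xt; apply/mapP; exists t => //.
    by rewrite -xt subrK.
  by right; rewrite -(subrK l2 x); exact: no_jumpD F2 nx.
have rightP x : c1 x = t0 + 1 -> s0 <= c2 x <= s0 + 1 ->
    x \in [seq p + t *: l2 + l1 | t <- T2] \/ no_jump F x.
  move=> c1x c2x; have [||xL|nx] := leftP (x - l1).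
  - by rewrite lcoord1D lcoord1N c1x c1l1 addrK.
  - by rewrite lcoord2D lcoord2N c2l1 subr0.
  - left; case/mapP: xL => t tT xt; apply/mapP; exists t => //.
    by rewrite -xt subrK.
  by right; rewrite -(subrK l1 x); exact: no_jumpD F1 nx.
pose interior x := (t0 < c1 x < t0 + 1) && (s0 < c2 x < s0 + 1).
have [L0 HL0] : exists L0 : seq V, forall x, interior x -> ~ edge_point x -> x \in L0.
  have t01' : t0 < t0 + 1 by rewrite ltrDl.
  have s01' : s0 < s0 + 1 by rewrite ltrDl.
  have [L0 HL0] := @finite_exceptions _ l1 l2 (fun x => ~ edge_point x) edge_point_near
    _ _ _ _ t01' s01'.
  exists L0 => x /andP[/andP[h1 h2] /andP[h3 h4]] nx.
  by rewrite (lcoordK l12 x); apply: HL0; rewrite ?ltW // -lcoordK.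
pose Lint := [seq x <- undup L0 | interior x && ~~ `[< edge_point x >]].
have uLint : uniq Lint by rewrite filter_uniq // undup_uniq.
have LintP x : x \in Lint <-> interior x /\ ~ edge_point x.
  rewrite mem_filter mem_undup; split.
    by case/andP => /andP[ix /asboolP nx] _.
  by move=> [ix nx]; rewrite ix HL0 // andbT; apply/asboolP.
pose Lb := [seq p + t *: l1 | t <- T1]; pose Lt := [seq p + t *: l1 + l2 | t <- T1].
pose Ll := [seq p + t *: l2 | t <- T2]; pose Lr := [seq p + t *: l2 + l1 | t <- T2].
pose L := undup (Lint ++ Lb ++ Lt ++ Ll ++ Lr).
have uL : uniq L by exact: undup_uniq.
have inL x : (x \in Lint) || (x \in Lb) || (x \in Lt) || (x \in Ll) || (x \in Lr) -> x \in L.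
  by rewrite mem_undup !mem_cat -!orbA.
have l1_inj : injective (fun t : R => p + t *: l1).
  by move=> s t /(congr1 c1); rewrite !lcoord1D !lcoord1Z c1l1 !mulr1 => /addrI.
have l2_inj : injective (fun t : R => p + t *: l2).
  by move=> s t /(congr1 c2); rewrite !lcoord2D !lcoord2Z c2l2 !mulr1 => /addrI.
have closedP x e : inward l1 l2 t0 s0 x e -> t0 <= c1 x <= t0 + 1 /\ s0 <= c2 x <= s0 + 1.
  by move=> /andP[/and3P[? _ _] /and3P[? _ _]].
have boundary x : t0 <= c1 x <= t0 + 1 -> s0 <= c2 x <= s0 + 1 -> ~~ interior x ->
    [\/ c2 x = s0, c2 x = s0 + 1, c1 x = t0 | c1 x = t0 + 1].
  move=> /andP[h1 h2] /andP[h3 h4]; rewrite /interior !lt_neqAle h1 h2 h3 h4 !andbT.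
  rewrite !negb_and !negbK => /orP[] /orP[] /eqP E.
  - by constructor 3.
  - by constructor 4.
  - by constructor 1.
  by constructor 2.
have inner_inward x e : interior x -> inward l1 l2 t0 s0 x e.
  by move=> /andP[h1 h2]; apply/andP; split; exact: stays_in_inner.
have no_mult x e : e != 0 -> no_jump F x -> inward_mult F l1 l2 t0 s0 x e = 0.
  by move=> e0 nx; rewrite /inward_mult /ray_mult nx // mul0r if_same.
(* Interior edge points cancel between e and - e, so only interior vertices and crossings of the
   sides remain, all of them in [L]. *)
have cover x e : e != 0 ->
    inward_mult F l1 l2 t0 s0 x e + inward_mult F l1 l2 t0 s0 x (- e) != 0 -> x \in L.
  move=> e0 fx; apply: inL; have Ne0 : - e != 0 by rewrite oppr_eq0.
  have [h1 h2] : t0 <= c1 x <= t0 + 1 /\ s0 <= c2 x <= s0 + 1.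
    have [/closedP//|ne] := boolP (inward l1 l2 t0 s0 x e).
    have [/closedP//|nNe] := boolP (inward l1 l2 t0 s0 x (- e)).
    by move: fx; rewrite /inward_mult (negPf ne) (negPf nNe) addr0 eqxx.
  have nonj : no_jump F x -> False.
    by move=> nx; move: fx; rewrite !no_mult // addr0 eqxx.
  have [ix|nix] := boolP (interior x).
    have -> // : x \in Lint; apply/LintP; split=> // -[a [b [e' [e'0 abe' gx]]]].
    move: fx; rewrite /inward_mult !inner_inward // (edge_ray_cancel gx) //.
    by rewrite eqxx.
  have [bx|bx|bx|bx] := boundary x h1 h2 nix.
  - by have [xL|/nonj//] := bottomP x bx h1; rewrite [x \in Lb]xL !orbT.
  - by have [xL|/nonj//] := topP x bx h1; rewrite [x \in Lt]xL !orbT.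
  - by have [xL|/nonj//] := leftP x bx h2; rewrite [x \in Ll]xL !orbT.
  by have [xL|/nonj//] := rightP x bx h2; rewrite [x \in Lr]xL !orbT.
have fout x : (t0 <= c1 x <= t0 + 1) && (s0 <= c2 x <= s0 + 1) \/ f x = 0.
  have [|out] := boolP ((t0 <= c1 x <= t0 + 1) && (s0 <= c2 x <= s0 + 1)); first by left.
  right; rewrite /f /corner_sum big1 // => e _; rewrite /inward_mult.
  by case: ifP => // /closedP[h1 h2]; rewrite h1 h2 in out.
have f0 x : no_jump F x -> f x = 0 by exact: no_jump_corner_sum.
(* Summing over pairs of opposite rays first reduces this to [line_cancel] for each of finitely many
   directions. *)
have total0 : \sum_(x <- L) f x = 0.
  rewrite /f /corner_sum (eq_bigr (fun x => \sum_(s <- S)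
    (inward_mult F l1 l2 t0 s0 x (ray d s) + inward_mult F l1 l2 t0 s0 x (- ray d s)))).
    rewrite exchange_big big1 // => s _; apply: line_cancel => //; first exact: ray_neq0.
    by move=> x; apply: cover; exact: ray_neq0.
  by move=> x _; rewrite /rays big_cat !big_map /= big_split.
(* No crossing is a corner, so a point with a nonzero sum lies in the interior or on exactly one
   side. *)
have split_f x : f x = (if interior x then f x else 0) +
    ((if c2 x == s0 then f x else 0) + (if c2 x == s0 + 1 then f x else 0)) +
    ((if c1 x == t0 then f x else 0) + (if c1 x == t0 + 1 then f x else 0)).
  have [fx0|fx0] := eqVneq (f x) 0; first by rewrite fx0 !if_same !addr0.
  have nonj : no_jump F x -> False by move=> /f0 /eqP; rewrite (negPf fx0).
  have [/andP[h1 h2]|/eqP] := fout x; last by rewrite (negPf fx0).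
  have ne (u v : R) : u + 1 = v -> u == v = false.
    by move=> <-; apply/negbTE; rewrite lt_eqF // ltrDl.
  have corner : (c2 x == s0) || (c2 x == s0 + 1) -> (c1 x == t0) || (c1 x == t0 + 1) -> False.
    move=> /orP[] /eqP b /orP[] /eqP a.
    - have [|//] := bottomP x b h1; case/mapP => t /T101/andP[t0' _] xt.
      by move: a; rewrite xt lcoord1D lcoord1Z c1l1 c1p; lra.
    - have [|//] := bottomP x b h1; case/mapP => t /T101/andP[_ t1'] xt.
      by move: a; rewrite xt lcoord1D lcoord1Z c1l1 c1p; lra.
    - have [|//] := topP x b h1; case/mapP => t /T101/andP[t0' _] xt.
      by move: a; rewrite xt !lcoord1D lcoord1Z c1l1 c1p c1l2; lra.
    have [|//] := topP x b h1; case/mapP => t /T101/andP[_ t1'] xt.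
    by move: a; rewrite xt !lcoord1D lcoord1Z c1l1 c1p c1l2; lra.
  have [ix|nix] := boolP (interior x).
    have /andP[/andP[i1 i2] /andP[i3 i4]] := ix.
    by rewrite (gt_eqF i1) (lt_eqF i2) (gt_eqF i3) (lt_eqF i4) !addr0.
  have corner1 : (c2 x == s0) || (c2 x == s0 + 1) ->
      (c1 x == t0) = false /\ (c1 x == t0 + 1) = false.
    by move=> /corner nc; split; apply/negbTE/negP => c; apply: nc; rewrite c ?orbT.
  have corner2 : (c1 x == t0) || (c1 x == t0 + 1) ->
      (c2 x == s0) = false /\ (c2 x == s0 + 1) = false.
    by move=> c1x; split; apply/negbTE/negP => c; apply: corner => //; rewrite c ?orbT.
  have [b|b|b|b] := boundary x h1 h2 nix.
  - have [|-> ->] := corner1; first by rewrite b eqxx.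
    by rewrite b eqxx ne // !(add0r, addr0).
  - have [|-> ->] := corner1; first by rewrite b eqxx orbT.
    by rewrite b eqxx [_ == s0]eq_sym ne // !(add0r, addr0).
  - have [|-> ->] := corner2; first by rewrite b eqxx.
    by rewrite b eqxx ne // !(add0r, addr0).
  have [|-> ->] := corner2; first by rewrite b eqxx orbT.
  by rewrite b eqxx [_ == t0]eq_sym ne // !(add0r, addr0).
have restrict (P : pred V) (L' : seq V) : uniq L' -> (forall x, x \in L' -> P x) ->
    (forall x, f x != 0 -> P x -> x \in L') -> {subset L' <= L} ->
    \sum_(x <- L) (if P x then f x else 0) = \sum_(x <- L') f x.
  move=> uL' L'P PL' sub.
  rewrite [RHS](eq_big_seq (fun x => if P x then f x else 0)); last first.
    by move=> x /L'P->.
  apply: sum_over_support => // x; case: ifP => [Px fx|]; last by rewrite eqxx.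
  by rewrite PL' //; apply: sub; exact: PL'.
exists Lint, t0, s0; split=> //.
- by move=> x /LintP[/andP[h1 h2] nx].
- apply: (lattice_reduce l12 (t0 := t0) (s0 := s0)).
  + move=> x IH nx; have [|n1 [n2 H]] := IH.
      by apply: contra_not nx; exact: quasi_edge_point F1.
    exists (n1 - 1), n2; rewrite rmorphB scalerBl scale1r; move: H.
    by congr (_ \in Lint); apply: row2P; rewrite !mxE; ring.
  + move=> x IH nx; have [|n1 [n2 H]] := IH.
      by apply: contra_not nx; exact: quasi_edge_point (quasi_periodN F1).
    exists (n1 + 1), n2; rewrite rmorphD scalerDl scale1r; move: H.
    by congr (_ \in Lint); apply: row2P; rewrite !mxE; ring.
  + move=> x IH nx; have [|n1 [n2 H]] := IH.
      by apply: contra_not nx; exact: quasi_edge_point F2.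
    exists n1, (n2 - 1); rewrite rmorphB scalerBl scale1r; move: H.
    by congr (_ \in Lint); apply: row2P; rewrite !mxE; ring.
  + move=> x IH nx; have [|n1 [n2 H]] := IH.
      by apply: contra_not nx; exact: quasi_edge_point (quasi_periodN F2).
    exists n1, (n2 + 1); rewrite rmorphD scalerDl scale1r; move: H.
    by congr (_ \in Lint); apply: row2P; rewrite !mxE; ring.
  (* In the half-open parallelogram a vertex has neither t = t0 nor s = s0, as these sides carry
     only edge points. *)
  move=> t s /andP[tt0 tt1] /andP[ss0 ss1] nx; exists 0, 0; rewrite !scale0r !addr0.
  have edge_of l x : transverse_edge F l x -> edge_point x.
    move=> [a [b [e [el abe gx]]]]; exists a, b, e; split=> //.
    by apply: contra el => /eqP->; rewrite /det2 !mxE; apply/eqP; ring.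
  apply/LintP; split=> //; rewrite /interior !lpoint_coord1 // !lpoint_coord2 // tt1 ss1 !andbT.
  rewrite !lt_neqAle tt0 ss0 !andbT; apply/andP; split; apply/eqP => E; apply: nx; rewrite -E.
    by apply: (edge_of l2); have := good2 s; rewrite /lpoint addrC.
  exact: edge_of (good1 t).
have fint : \sum_(x <- Lint) vertex_mult d S F x = \sum_(x <- Lint) f x.
  apply: eq_big_seq => x /LintP[ix _]; apply: eq_bigr => e _.
  by rewrite /inward_mult inner_inward.
rewrite fint; move: total0; rewrite (eq_bigr _ (fun x _ => split_f x)).
have bnd x : f x != 0 -> [/\ t0 <= c1 x <= t0 + 1, s0 <= c2 x <= s0 + 1 & ~ no_jump F x].
  move=> fx; have [/andP[h1 h2]|/eqP] := fout x; last by rewrite (negPf fx).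
  by split=> // /f0 /eqP; rewrite (negPf fx).
have uLb : uniq Lb by rewrite map_inj_uniq.
have uLl : uniq Ll by rewrite map_inj_uniq.
have uLt : uniq Lt by rewrite map_inj_uniq // => s t /addIr/l1_inj.
have uLr : uniq Lr by rewrite map_inj_uniq // => s t /addIr/l2_inj.
rewrite !big_split /=.
rewrite (restrict interior Lint) //; first last.
- by move=> x xL; apply: inL; rewrite xL.
- move=> x fx ix; apply/LintP; split=> // -[a [b [e [e0 abe gx]]]].
  move/eqP: fx; apply; rewrite /f /corner_sum /rays big_cat !big_map /= -big_split /=.
  rewrite big1 // => s _; rewrite /inward_mult !inner_inward //.
  by apply: edge_ray_cancel gx _ _ _ => //; exact: ray_neq0.
- by move=> x /LintP[].
rewrite (restrict (fun x => c2 x == s0) Lb) //; first last.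
- by move=> x xL; apply: inL; rewrite xL !orbT.
- by move=> x /bnd[h1 h2 nj] /eqP c2x; have [|/nj] := bottomP x c2x h1.
- by move=> x /mapP[t _ ->]; rewrite lcoord2D lcoord2Z c2l1 c2p mulr0 addr0.
rewrite (restrict (fun x => c2 x == s0 + 1) Lt) //; first last.
- by move=> x xL; apply: inL; rewrite xL !orbT.
- by move=> x /bnd[h1 h2 nj] /eqP c2x; have [|/nj] := topP x c2x h1.
- by move=> x /mapP[t _ ->]; rewrite !lcoord2D lcoord2Z c2l1 c2p c2l2 mulr0 addr0.
rewrite (restrict (fun x => c1 x == t0) Ll) //; first last.
- by move=> x xL; apply: inL; rewrite xL !orbT.
- by move=> x /bnd[h1 h2 nj] /eqP c1x; have [|/nj] := leftP x c1x h2.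
- by move=> x /mapP[t _ ->]; rewrite lcoord1D lcoord1Z c1l2 c1p mulr0 addr0.
rewrite (restrict (fun x => c1 x == t0 + 1) Lr) //; first last.
- by move=> x xL; apply: inL; rewrite xL !orbT.
- by move=> x /bnd[h1 h2 nj] /eqP c1x; have [|/nj] := rightP x c1x h2.
- by move=> x /mapP[t _ ->]; rewrite !lcoord1D lcoord1Z c1l2 c1p c1l1 mulr0 addr0.
rewrite !big_map -!big_split /=.
have -> : \sum_(t <- T2) (f (p + t *: l2) + f (p + t *: l2 + l1)) =
    \sum_(t <- T2) (corner_sum F d S l2 l1 s0 t0 (p + t *: l2) +
      corner_sum F d S l2 l1 s0 t0 (p + t *: l2 + l1)).
  by apply: eq_bigr => t _; rewrite !f2E.
rewrite sum1 sum2 [det2 l2 l1]det2C [det2 (toR q2) _]det2C sgrN mulrNN => E.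
by move: E; set A := \sum_(x <- Lint) _; lra.
Qed.

End TotalMultiplicity.

(** * The lattice and the self-intersection number *)

Section TorusLattice.
Context {R : realType} (B : 'M[R]_2).
Local Notation V := 'rV[R]_2.
Local Notation proj := (tproj B).

Lemma tproj_eq (x y : V) : proj x = proj y <-> x - y \in int_span B.
Proof.
have E := Quotient.idealrBE (int_span B) x y.
split=> [h|h]; first by apply/idP; rewrite E; apply/eqP; exact: h.
by rewrite E in h; exact: (eqP h).
Qed.

Lemma tproj_repr (p : torus B) : proj (repr p) = p.
Proof. exact: reprK. Qed.

Lemma mem_int_span (A : nzRingType) (M : 'M[A]_2) (x : 'rV[A]_2) : x \in int_span M <->
  exists n1 n2 : int, x = n1%:~R *: row 0 M + n2%:~R *: row 1 M.
Proof.
have mulE (c : 'rV[int]_2) : toR c *m M = (c 0 0)%:~R *: row 0 M + (c 0 1)%:~R *: row 1 M.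
  apply/rowP => j; rewrite !mxE !big_ord_recl big_ord0 addr0 !mxE.
  by have -> : lift ord0 ord0 = 1 :> 'I_2 by exact: val_inj.
split=> [/asboolP[c ->]|[n1 [n2 ->]]].
  by exists (c 0 0), (c 0 1); rewrite mulE.
apply/asboolP; exists (\row_(j < 2) if j == 0 then n1 else n2).
by rewrite mulE !mxE.
Qed.

Lemma row_int_span (A : nzRingType) (M : 'M[A]_2) i : row i M \in int_span M.
Proof.
apply/mem_int_span; case: i => -[|[|//]] lt_i.
  have -> : Ordinal lt_i = 0 by exact: val_inj.
  by exists 1, 0; rewrite scale0r addr0 scale1r.
have -> : Ordinal lt_i = 1 by exact: val_inj.
by exists 0, 1; rewrite scale0r add0r scale1r.
Qed.

Lemma det_rows (M : 'M[R]_2) : det2 (row 0 M) (row 1 M) = \det M.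
Proof. by rewrite det_mx2 /det2 !mxE. Qed.

Lemma real_extE Q (x y : V) : real_ext B Q x y = pairing (x *m gram B Q) y.
Proof.
by rewrite /real_ext /pairing mxE; apply: eq_bigr => j _; rewrite [y^T _ _]mxE.
Qed.

Lemma real_ext_row Q i (y : V) : B \in unitmx ->
  real_ext B Q (row i B) y = pairing (toR (row i Q)) y.
Proof.
move=> uB; rewrite real_extE; congr (pairing _ y).
by rewrite /gram mulmxA -row_mul mulmxV // rowE -mulmxA mul1mx -rowE /toR map_row.
Qed.

Lemma section_quasi_period Q alpha F i : B \in unitmx -> section_of B Q alpha F ->
  quasi_period F (row i B) (row i Q).
Proof.
move=> uB [_ HF]; exists (real_ext B Q (row i B) (row i B) / 2 + pairing alpha (row i B)).
by move=> x; rewrite HF ?row_int_span // real_ext_row // !addrA.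
Qed.

End TorusLattice.

Section IntersectionNumber.
Context {R : realType} (B : 'M[R]_2) (D : local_data B).
Local Notation V := 'rV[R]_2.
Local Notation proj := (tproj B).
Hypothesis uB : B \in unitmx.
Hypothesis hD : is_divisor D.

Lemma verticesE F : induced_by D F -> (forall x, pl_at F x) ->
  vertices D D = [set proj x | x in [set x | ~ edge_point F x]].
Proof.
move=> indF plF; have cov : forall p : torus B, exists U f, D (U, f) /\ U p by case: hD.
have suppP x : ~ edge_point F x <-> [/\ support_lift D x, support_lift D x &
    ~ exists w1 u1 w2 u2, [/\ facet D x w1 u1, facet D x w2 u2 & \det (col_mx u1 u2) = 0]].
  split=> [nx|[sx _ nf] [a [b [e [e0 abe gx]]]]].
    have sx : support_lift D x.
      apply/(support_liftP cov indF) => /Zaffine_germ[a gx]; apply: nx.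
      exists a, a, (vec2 1 0); split=> //.
        by apply/eqP => /(congr1 (fun u : V => u 0 0)); rewrite vec20 mxE => /eqP; rewrite oner_eq0.
      by rewrite (germE gx); apply: funext => h; rewrite edge_same.
    split=> // -[w1 [u1 [_ [_ [/(facet_edge cov indF) [a [b [e [ab e0 abe gx]]]] _ _]]]]].
    by apply: nx; exists a, b, e; split=> //; exact: germE.
  have [E [_ gx']] := plF x; rewrite gx in gx'.
  have [eab|ab] := eqVneq a b.
    by move/(support_liftP cov indF): sx; apply; apply/(edge_Zaffine e0 abe gx').
  have [w [u fx]] := edge_facet cov indF e0 abe ab gx'.
  (* A facet paired with itself has determinant zero, which excludes x from [vertices]. *)
  apply: nf; exists w, u, w, u; split=> //; apply/eqP.
  by rewrite -(intr_eq0 R) det_col_mx2 det2vv.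
rewrite /vertices; congr (_ @` _).
by apply/seteqP; split=> x /suppP.
Qed.

(** The germ at x + l differs by a covector, whose contribution is zero by balancing. *)
Lemma vertex_mult_period (F : V -> R) d S l q x : d != 0 -> uniq S ->
  (forall x, pl_at F x) -> (forall x, fan [seq ray d s | s <- S] (germ F x)) ->
  quasi_period F l q -> vertex_mult d S F (x + l) = vertex_mult d S F x.
Proof.
move=> d0 uS plF fF Fl; rewrite /vertex_mult.
rewrite -[RHS]addr0 -[X in _ = _ + X](rays_balancing (toR q) d0 uS (fF x)) -big_split /=.
apply: eq_big_seq => e eS; have e0 := rays_neq0 d0 eS.
by rewrite /ray_mult (quasi_germ Fl (plF x)).2 (jump_addl _ (fF x)) // mulrDr.
Qed.

Lemma fan_rays E d (G : V -> R) : d != 0 -> (forall u, u \in E -> u != 0 -> det2 d u != 0) ->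
  fan E G -> fan [seq ray d s | s <- undup [seq - (det2 (nrm d) u / det2 d u) | u <- E]] G.
Proof.
move=> d0 dE [hG fG]; split=> // e e0; have [a [b [Gab ab]]] := fG e e0.
exists a, b; split=> // /ab[u uE [u0 ue]]; have du := dE u uE u0.
(* The parameter for which [ray d s] is parallel to u. *)
pose s := - (det2 (nrm d) u / det2 d u).
exists (ray d s); first by apply: map_f; rewrite mem_undup; apply/mapP; exists u.
split; first exact: ray_neq0.
have : det2 u (ray d s) = 0.
  rewrite /ray det2Dr det2Zr (det2C u) (det2C u d) /s mulrN mulNr opprK.
  by rewrite divfK // addNr.
have [k ->] := parallel_det2 u0 ue.
by rewrite det2Zr (det2C (ray d s)) => ->; rewrite oppr0 mulr0.
Qed.

Lemma intersection_numberE Q alpha : line_bundle_iso D Q alpha ->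
  (intersection_number D D)%:~R = 2 * (form_det B Q)%:~R :> R.
Proof.
move=> [_ [F [secF indF]]]; have [ratF _] := secF.
have cov : forall p : torus B, exists U f, D (U, f) /\ U p by case: hD.
have plF x : pl_at F x by exact: rational_pl.
pose l1 := row 0 B; pose l2 := row 1 B; pose q1 := row 0 Q; pose q2 := row 1 Q.
have F1 : quasi_period F l1 q1 by exact: section_quasi_period secF.
have F2 : quasi_period F l2 q2 by exact: section_quasi_period secF.
have l12 : det2 l1 l2 != 0 by rewrite det_rows -unitfE -unitmxE.
have [E fE] := fan_global plF l12 F1 F2.
have [d d0 dE] := exists_transverse E.
pose S := undup [seq - (det2 (nrm d) u / det2 d u) | u <- E].
have uS : uniq S by exact: undup_uniq.
have fF x : fan [seq ray d s | s <- S] (germ F x) by exact: fan_rays (fE x).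
have [L [t0 [s0 [uL LP covL sumL]]]] := total_multiplicity d0 uS plF fF l12 F1 F2.
have l_period l : l \in int_span B -> exists q, quasi_period F l q.
  move=> /mem_int_span[n1 [n2 ->]]; exists (n1%:~R *: q1 + n2%:~R *: q2).
  by apply: quasi_periodD; exact: quasi_periodMz.
(* Two points of an open unit interval that differ by an integer are equal, so distinct points of
   [L] stay distinct on the torus. *)
have int_small (n : int) (u v c : R) : c < u < c + 1 -> c < v < c + 1 ->
    u - v = n%:~R -> n = 0.
  move=> uc vc uv; have n1 : (n%:~R : R) < 1 by rewrite -uv; lra.
  have n2 : (-1)%:~R < (n%:~R : R) by rewrite -uv; lra.
  by move: n1 n2; rewrite -[1 in X in X -> _]/(1%:~R) !ltr_int; lia.
have projL : {in L &, injective proj}.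
  move=> x y xL yL /tproj_eq/mem_int_span[n1 [n2 xy]].
  have [_ x1 x2] := LP x xL; have [_ y1 y2] := LP y yL.
  have n10 : n1 = 0.
    apply: (int_small _ _ _ _ x1 y1); rewrite -lcoord1N -lcoord1D xy lcoord1D !lcoord1Z.
    by rewrite /lcoord1 det2vv mul0r mulr0 addr0 divff // mulr1.
  have n20 : n2 = 0.
    apply: (int_small _ _ _ _ x2 y2); rewrite -lcoord2N -lcoord2D xy lcoord2D !lcoord2Z.
    by rewrite /lcoord2 det2vv mul0r mulr0 add0r divff // mulr1.
  by apply/eqP; rewrite -subr_eq0 xy n10 n20 !scale0r addr0.
have vE : vertices D D = [set` [seq proj x | x <- L]].
  rewrite (verticesE indF plF); apply/seteqP; split=> p /=.
    move=> [x nx <-]; have [n1 [n2 xL]] := covL x nx.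
    apply/mapP; exists (x + n1%:~R *: l1 + n2%:~R *: l2) => //.
    apply/tproj_eq/mem_int_span; exists (- n1), (- n2).
    by rewrite !rmorphN !scaleNr -addrA opprD addrA subrr add0r opprD.
  by move=> /mapP[x xL ->]; exists x => //; have [] := LP x xL.
rewrite /intersection_number vE -fsbig_seq ?map_inj_in_uniq // big_map rmorph_sum /=.
(* The representative chosen by [repr] need not be x, but the multiplicity is invariant under the
   lattice. *)
have -> : \sum_(x <- L) ((multiplicity D D (repr (proj x)))%:~R : R) =
    \sum_(x <- L) vertex_mult d S F x.
  apply: eq_big_seq => x xL; have [nx _ _] := LP x xL.
  set y := repr (proj x).
  have [l lB yE] : exists2 l, l \in int_span B & y = x + l.
    exists (y - x); last by rewrite addrC subrK.
    by apply/tproj_eq; rewrite tproj_repr.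
  have [q ql] := l_period l lB.
  have ny : ~ edge_point F y.
    move=> ey; apply: nx; rewrite -[x](addrK l) -yE.
    exact: (quasi_edge_point plF (quasi_periodN ql)).
  have [E' [_ gyF]] := plF y.
  have nofacet w u : ~ facet D y w u.
    move=> /(facet_edge cov indF)[a [b [e [ab e0 abe gx]]]]; apply: ny.
    by exists a, b, e; split=> //; exact: germE.
  rewrite (multiplicityE cov indF d0 uS (fF y) gyF nofacet); last first.
    apply/(support_liftP cov indF) => /Zaffine_germ[a gx]; apply: ny.
    exists a, a, (vec2 1 0); split=> //.
      by apply/eqP => /(congr1 (fun u : V => u 0 0)); rewrite vec20 mxE => /eqP; rewrite oner_eq0.
    by rewrite (germE gx); apply: funext => h; rewrite edge_same.
  by rewrite yE (vertex_mult_period _ d0 uS plF fF ql).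
rewrite sumL det_rows /form_det intrM -sgrEz mulrC; congr (_ * (_ * _)).
have -> : \det Q = Q 0 0 * Q 1 1 - Q 0 1 * Q 1 0 by exact: det_mx2.
by rewrite /det2 !mxE rmorphB !rmorphM.
Qed.

End IntersectionNumber.

(** * Z-affine functions: from local to global *)

Section Zaffine.
Context {R : realType}.
Local Notation V := 'rV[R]_2.
Local Notation Z2 := 'rV[int]_2.
Implicit Types (f g h F G : V -> R) (x y z k : V) (m : Z2 * R).

Lemma germ_continuous F x G (C : R) : germ_at F x G -> (forall k, `|G k| <= C * `|k|) ->
  {for x, continuous F}.
Proof.
move=> [_ [r r0 FG]] GC; apply/(@cvgrPdist_lt R R^o _ (nbhs x) (nbhs_filter x) F (F x)) => e e0; apply/nearE.
have C1 : 0 < `|C| + 1 by rewrite ltr_wpDl.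
exists (Num.min r (e / (`|C| + 1))) => [|k]; first by rewrite lt_min r0 divr_gt0.
rewrite lt_min ltr_pdivlMr // => /andP[hr he].
rewrite FG // opprD addrA subrr add0r normrN.
apply: le_lt_trans (GC k) _; apply: le_lt_trans he; rewrite mulrC ler_wpM2l //.
by rewrite (le_trans (ler_norm C)) // lerDl.
Qed.

Lemma affine_funD m m' x :
  affine_fun (m.1 + m'.1, m.2 + m'.2) x = affine_fun m x + affine_fun m' x.
Proof. by rewrite /affine_fun /= toRD pairingDl addrACA. Qed.

Lemma affine_funN m x : affine_fun (- m.1, - m.2) x = - affine_fun m x.
Proof. by rewrite /affine_fun /= toRN pairingNl opprD. Qed.

Lemma ZaffineD f g x : Zaffine_at f x -> Zaffine_at g x ->
  Zaffine_at (fun y => f y + g y) x.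
Proof.
move=> [m fm] [m' gm]; exists (m.1 + m'.1, m.2 + m'.2).
by near=> y; rewrite affine_funD (near fm y) // (near gm y).
Unshelve. all: by end_near. Qed.

Lemma ZaffineN f x : Zaffine_at f x -> Zaffine_at (fun y => - f y) x.
Proof.
move=> [m fm]; exists (- m.1, - m.2).
by near=> y; rewrite affine_funN (near fm y).
Unshelve. all: by end_near. Qed.

Lemma ZaffineB f g x : Zaffine_at f x -> Zaffine_at g x ->
  Zaffine_at (fun y => f y - g y) x.
Proof. by move=> fx gx; apply: ZaffineD => //; exact: ZaffineN. Qed.

Lemma Zaffine_eq f g x : (forall y, f y = g y) -> Zaffine_at f x -> Zaffine_at g x.
Proof. by move=> fg; have -> : g = f by apply: funext. Qed.

Lemma Zaffine_near f g x : (\forall y \near x, g y = f y) -> Zaffine_at f x -> Zaffine_at g x.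
Proof.
move=> gf [m fm]; exists m; near=> y.
by rewrite (near gf y) // (near fm y).
Unshelve. all: by end_near. Qed.

Lemma affine_Zaffine m x : Zaffine_at (affine_fun m) x.
Proof. by exists m; near=> y. Unshelve. all: by end_near. Qed.

Lemma affine_fun_unique m m' x (e : R) : 0 < e ->
  (forall k, `|k| < e -> affine_fun m (x + k) = affine_fun m' (x + k)) -> m = m'.
Proof.
move=> e0 H; have H0 : affine_fun m x = affine_fun m' x.
  by have := H 0; rewrite addr0 normr0; apply.
have H1 : m.1 = m'.1.
  apply: (@toR_inj R); apply: pairing_inj => k.
  have [c c0 ck] := scale_small k e0; have := H _ ck.
  rewrite !affine_fun_shift H0 => /addrI; rewrite !pairingZr.
  exact: (mulfI (lt0r_neq0 c0)).
case: m m' H0 H1 {H} => [a b] [a' b'] /= H0 eqa; rewrite -{}eqa in H0 *.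
by congr (_, _); move: H0 => /addrI.
Qed.

Lemma affine_near_unique h m m' x : (\forall y \near x, h y = affine_fun m y) ->
  (\forall y \near x, h y = affine_fun m' y) -> m = m'.
Proof.
move=> hm hm'; have [e e0 H] : exists2 e, 0 < e & forall k, `|k| < e ->
    affine_fun m (x + k) = affine_fun m' (x + k).
  apply/(nearE (fun y => affine_fun m y = affine_fun m' y)).
  by near=> y; rewrite -(near hm y) // (near hm' y).
exact: affine_fun_unique e0 H.
Unshelve. all: by end_near. Qed.

Lemma near_near h m x : (\forall y \near x, h y = affine_fun m y) ->
  exists2 e, 0 < e & forall k, `|k| < e -> \forall y \near (x + k), h y = affine_fun m y.
Proof.
move=> /nearE[e e0 H]; exists e => // k ke; apply/nearE.
exists (e - `|k|) => [|k' k'e]; first by rewrite subr_gt0.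
rewrite -addrA; apply: H; apply: le_lt_trans (ler_normD _ _) _.
by rewrite addrC -ltrBrDr.
Qed.

(** Two affine expressions of h near one common point coincide, which allows concatenation in
    Cousin's lemma. For this the conclusion is about neighbourhoods of the points of the segment,
    not about the segment only. *)
Lemma Zaffine_path h x y : (forall t : R, 0 <= t <= 1 -> Zaffine_at h (x + t *: (y - x))) ->
  exists m, forall t : R, 0 <= t <= 1 -> \forall z \near (x + t *: (y - x)), h z = affine_fun m z.
Proof.
move=> H; pose P (a b : R) := 0 <= a -> b <= 1 -> exists m, forall t : R, a <= t <= b ->
  \forall z \near (x + t *: (y - x)), h z = affine_fun m z.
suff : forall a b, a < b -> P a b by apply; rewrite ?ltr01.
apply: cousin => [a b c ab bc Pab Pbc a0 c1|t].
  have [|m Hm] := Pab a0; first by rewrite (le_trans (ltW bc)).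
  have [|//|m' Hm'] := Pbc; first by rewrite (le_trans a0) // ltW.
  have mm' : m = m'.
    apply: (affine_near_unique (Hm b _) (Hm' b _)); first by rewrite ltW // lexx.
    by rewrite lexx ltW.
  exists m => t /andP[at_ tc]; have [tb|bt] := leP t b; first by apply: Hm; rewrite at_.
  by rewrite mm'; apply: Hm'; rewrite (ltW bt).
have [t01|t01] := boolP (0 <= t <= 1); last first.
  exists 1 => // a b ab /andP[at_ tb] _ _ a0 b1; exfalso.
  by move/negP: t01; apply; rewrite (le_trans a0) // (le_trans tb).
have [m Hm] := H t t01; have [e e0 He] := near_near Hm.
have N1 : 0 < `|y - x| + 1 by rewrite ltr_wpDl.
exists (e / (`|y - x| + 1)) => [|a b ab /andP[at_ tb] ta bt a0 b1]; first exact: divr_gt0.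
exists m => s /andP[as_ sb].
have -> : x + s *: (y - x) = x + t *: (y - x) + (s - t) *: (y - x).
  by rewrite -addrA -scalerDl [t + _]addrC subrK.
apply: He; rewrite normrZ.
have : `|s - t| < e / (`|y - x| + 1) by rewrite ltr_norml; lra.
rewrite ltr_pdivlMr // mulrDr mulr1; apply: le_lt_trans.
by rewrite lerDl.
Qed.

Lemma Zaffine_global h : (forall x, Zaffine_at h x) -> exists m, forall x, h x = affine_fun m x.
Proof.
move=> H; have [m Hm] := H 0; exists m => x.
have [m' Hm'] := @Zaffine_path h 0 x (fun t _ => H _).
have <- : m' = m.
  apply: affine_near_unique Hm; have := Hm' 0; rewrite scale0r addr0.
  by apply; rewrite lexx ler01.
have := Hm' 1; rewrite scale1r addrC subrK => /(_ _)/nbhs_singleton; apply.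
by rewrite lexx ler01.
Qed.

Lemma bigmax_affineD i m (s : seq (Z2 * R)) y :
  \big[Num.max/affine_fun i y]_(j <- s) affine_fun j y + affine_fun m y =
  \big[Num.max/affine_fun (i.1 + m.1, i.2 + m.2) y]_(j <- [seq (j.1 + m.1, j.2 + m.2) | j <- s])
     affine_fun j y.
Proof.
elim: s => [|j s IH]; first by rewrite !big_nil affine_funD.
by rewrite !big_cons -IH addr_maxl affine_funD.
Qed.

Lemma regular_addl f m x : regular_at f x -> regular_at (fun y => f y + affine_fun m y) x.
Proof.
move=> [cf [i [s fs]]].
have near_eq : \forall y \near x, f y + affine_fun m y =
    \big[Num.max/affine_fun (i.1 + m.1, i.2 + m.2) y]_(j <- [seq (j.1 + m.1, j.2 + m.2) | j <- s])
       affine_fun j y.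
  by near=> y; rewrite (near fs y) // bigmax_affineD.
split; last by exists (i.1 + m.1, i.2 + m.2), [seq (j.1 + m.1, j.2 + m.2) | j <- s].
have [a [t H]] := bigmax_affine_germ (i.1 + m.1, i.2 + m.2)
   [seq (j.1 + m.1, j.2 + m.2) | j <- s] x.
have [C _ HC] := @max_covectors_bound R a t.
exact: (germ_continuous (germ_at_near near_eq H) HC).
Unshelve. all: by end_near. Qed.

Lemma rational_addl f F x : rational_at f x -> Zaffine_at (fun y => F y - f y) x ->
  rational_at F x.
Proof.
move=> [cf [g [h fgh]]] [m Fm].
have near_eq : \forall y \near x, F y = f y + affine_fun m y.
  by near=> y; rewrite -(near Fm y) // addrC subrK.
have near_gh : \forall y \near x, [/\ regular_at (fun y => g y + affine_fun m y) y,
    regular_at h y & F y = g y + affine_fun m y - h y].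
  near=> y; have [gy hy fy] : [/\ regular_at g y, regular_at h y & f y = g y - h y].
    by near: y.
  split=> //; first exact: regular_addl.
  by rewrite (near near_eq y) // fy addrAC.
split; last by exists (fun y => g y + affine_fun m y), h.
have [/regular_germ[a [s ga]] /regular_germ[b [t hb]] _] := nbhs_singleton near_gh.
have [C _ HC] := @max_covectors_bound R a s; have [C' _ HC'] := @max_covectors_bound R b t.
apply: (@germ_continuous _ _ (fun k => max_covectors a s k - max_covectors b t k) (C + C')).
  by apply: germ_at_near (germ_atB ga hb); near=> y; have [] := near near_gh y.
move=> k; rewrite mulrDl; apply: le_trans (ler_normB _ _) _; exact: lerD.
Unshelve. all: by end_near. Qed.

End Zaffine.

(** * Sections of line bundles *)

Section Gluing.
Context {R : realType} (B : 'M[R]_2) (D : local_data B).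
Local Notation V := 'rV[R]_2.
Local Notation Z2 := 'rV[int]_2.
Local Notation proj := (tproj B).
Hypothesis hD : is_divisor D.
Implicit Types (F : V -> R) (x y : V).

(** The pointwise form of [induced_by], which lets F be built over larger and larger sets. *)
Definition induced_at F x := forall U f, D (U, f) -> U (proj x) ->
  Zaffine_at (fun y => F y - f (proj y)) x.

Lemma same_divisorE D1 D2 : same_divisor (B := B) D1 D2 = forall U f W g, D1 (U, f) -> D2 (W, g) ->
  forall x, (U `&` W) (proj x) -> Zaffine_at (fun y => f (proj y) - g (proj y)) x.
Proof. by []. Qed.

Lemma divisor_cover (p : torus B) : exists U f, D (U, f) /\ U p.
Proof. by have [_ cov _] := hD. Qed.

Lemma tproj_open (U : set (torus B)) x : open U -> U (proj x) -> \forall y \near x, U (proj y).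
Proof.
move=> oU Ux; have : \forall p \near proj x, U p by exact: open_nbhs_nbhs.
exact: pi_continuous.
Qed.

Lemma induced_at_sub F G x : induced_at F x -> induced_at G x ->
  Zaffine_at (fun y => F y - G y) x.
Proof.
move=> Fx Gx; have [U [f [DU Ux]]] := divisor_cover (proj x).
apply: Zaffine_eq (ZaffineB (Fx U f DU Ux) (Gx U f DU Ux)) => y.
by rewrite opprB addrA subrK.
Qed.

Lemma induced_at_addl F G x : Zaffine_at (fun y => G y - F y) x -> induced_at F x -> induced_at G x.
Proof.
move=> GF Fx U f DU Ux; apply: Zaffine_eq (ZaffineD GF (Fx U f DU Ux)) => y.
by rewrite addrA subrK.
Qed.

Lemma induced_at_near F G x : (\forall y \near x, G y = F y) -> induced_at F x -> induced_at G x.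
Proof.
move=> GF Fx U f DU Ux; apply: Zaffine_near (Fx U f DU Ux).
by near=> y; rewrite (near GF y).
Unshelve. all: by end_near. Qed.

Lemma induced_at_local x : exists F, exists2 r, 0 < r & forall k, `|k| < r -> induced_at F (x + k).
Proof.
have [U [f [DU Ux]]] := divisor_cover (proj x).
have [opD _ sameD] := hD; have [oU _] := opD U f DU.
have /nearE[r r0 H] := tproj_open oU Ux.
exists (f \o proj), r => // k kr W g DW Wx.
by move: sameD; rewrite same_divisorE; apply; first exact: DU; first exact: DW; split=> //; exact: H.
Qed.

Definition segment_closed (A : V -> Prop) := forall x y (t : R), A x -> A y -> 0 <= t <= 1 ->
  A (x + t *: (y - x)).

Lemma coord_near (j : 'I_2) x (r : R) : 0 < r -> \forall y \near x, `|(y : V) 0 j - x 0 j| < r.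
Proof.
move=> r0; apply/nearE; exists r => // k kr; rewrite mxE addrAC subrr add0r.
apply: le_lt_trans kr; have [k0 k1] := norm2_le k; case: j => -[|[|//]] lt_j.
  by have -> : Ordinal lt_j = 0 by exact: val_inj.
by have -> : Ordinal lt_j = 1 by exact: val_inj.
Qed.

(** Two solutions differ by a Z-affine function near each point of the common side, hence by a
    single one along it, as the side is convex; adding it to F2 makes the solutions match. *)
Lemma glue (j : 'I_2) (b : R) (A1 A2 : V -> Prop) F1 F2 x0 :
  (forall x, A1 x -> x 0 j <= b) -> (forall x, A2 x -> b <= x 0 j) ->
  (forall x, A1 x -> x 0 j = b -> A2 x) -> (forall x, A2 x -> x 0 j = b -> A1 x) ->
  segment_closed (fun x => A1 x /\ A2 x) -> A1 x0 /\ A2 x0 ->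
  (forall x, A1 x -> induced_at F1 x) -> (forall x, A2 x -> induced_at F2 x) ->
  exists F, forall x, A1 x \/ A2 x -> induced_at F x.
Proof.
move=> A1b A2b A12 A21 sc Ax0 ind1 ind2.
have [m Hm] : exists m, forall x, A1 x /\ A2 x -> \forall y \near x, F1 y - F2 y = affine_fun m y.
  have Z x : A1 x /\ A2 x -> Zaffine_at (fun y => F1 y - F2 y) x.
    by move=> [x1 x2]; apply: induced_at_sub; [exact: ind1|exact: ind2].
  have [m Hm] := Z x0 Ax0; exists m => x Ax.
  have [m' Hm'] := Zaffine_path (fun t t01 => Z _ (sc x0 x t Ax0 Ax t01)).
  have <- : m' = m.
    apply: affine_near_unique Hm; have := Hm' 0; rewrite scale0r addr0.
    by apply; rewrite lexx ler01.
  by have := Hm' 1; rewrite scale1r addrC subrK; apply; rewrite lexx ler01.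
exists (fun x => if x 0 j <= b then F1 x else F2 x + affine_fun m x) => x Ax.
have ind2' y : A2 y -> induced_at (fun y => F2 y + affine_fun m y) y.
  move=> A2y; apply: induced_at_addl (ind2 _ A2y).
  apply: Zaffine_eq (affine_Zaffine m y) => z; by rewrite addrC addKr.
have [xb|xb|xb] := ltgtP (x 0 j) b.
- have A1x : A1 x by case: Ax => // /A2b; rewrite leNgt xb.
  apply: induced_at_near (ind1 _ A1x).
  have bx : 0 < b - x 0 j by rewrite subr_gt0.
  near=> y; have -> // : y 0 j <= b.
  have : `|y 0 j - x 0 j| < b - x 0 j by near: y; exact: coord_near.
  by rewrite ltr_norml; lra.
- have A2x : A2 x by case: Ax => // /A1b; rewrite leNgt xb.
  apply: induced_at_near (ind2' _ A2x).
  have bx : 0 < x 0 j - b by rewrite subr_gt0.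
  near=> y; have /negbTE-> // : ~~ (y 0 j <= b).
  have : `|y 0 j - x 0 j| < x 0 j - b by near: y; exact: coord_near.
  by rewrite -ltNge ltr_norml; lra.
have A1x : A1 x by case: Ax => // /A21; apply.
have A2x : A2 x by exact: A12.
apply: induced_at_near (ind1 _ A1x); have H := Hm x (conj A1x A2x).
near=> y; case: ifP => // _; have <- : F1 y - F2 y = affine_fun m y by near: y.
by rewrite addrC subrK.
Unshelve. all: by end_near. Qed.

Lemma vec2_near (P : V -> Prop) (t s : R) :
  (exists2 r, 0 < r & forall k, `|k| < r -> P (vec2 t s + k)) ->
  exists2 r : R, 0 < r & forall t' s', `|t' - t| < r -> `|s' - s| < r -> P (vec2 t' s').
Proof.
move=> [r r0 H]; exists r => // t' s' tt' ss'.
have -> : vec2 t' s' = vec2 t s + vec2 (t' - t) (s' - s).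
  by apply: row2P; rewrite !mxE /= addrC subrK.
by apply: H; rewrite norm2_lt // vec20 vec21 tt' ss'.
Qed.

Lemma induced_on_rectangle (a b s1 s2 : R) : a < b -> s1 < s2 ->
  exists F, forall t s, a <= t <= b -> s1 <= s <= s2 -> induced_at F (vec2 t s).
Proof.
move: a b s1 s2.
pose P (a b s1 s2 : R) := exists F, forall t s, a <= t <= b -> s1 <= s <= s2 ->
   induced_at F (vec2 t s).
pose A (a b s1 s2 : R) x := (a <= x 0 0 <= b) /\ (s1 <= x 0 1 <= s2).
have sc a b s1 s2 a' b' s1' s2' :
    segment_closed (fun x => A a b s1 s2 x /\ A a' b' s1' s2' x).
  have conv (c c' u v t : R) : c <= u <= c' -> c <= v <= c' -> 0 <= t <= 1 ->
      c <= u + t * (v - u) <= c'.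
    move=> /andP[u1 u2] /andP[v1 v2] /andP[t0 t1].
    have E1 : (1 - t) * c <= (1 - t) * u by rewrite ler_wpM2l // subr_ge0.
    have E2 : (1 - t) * u <= (1 - t) * c' by rewrite ler_wpM2l // subr_ge0.
    have E3 : t * c <= t * v by rewrite ler_wpM2l.
    have E4 : t * v <= t * c' by rewrite ler_wpM2l.
    by lra.
  move=> x y t [[x1 x2] [x3 x4]] [[y1 y2] [y3 y4]] t01.
  by split; split; rewrite !mxE; exact: conv.
have PA a b s1 s2 F : (forall t s, a <= t <= b -> s1 <= s <= s2 -> induced_at F (vec2 t s)) <->
    (forall x, A a b s1 s2 x -> induced_at F x).
  split=> [H x [x1 x2]|H t s tt ss]; last by apply: H; rewrite /A vec20 vec21.
  have -> : x = vec2 (x 0 0) (x 0 1) by apply: row2P; rewrite ?vec20 ?vec21.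
  exact: H.
apply: (cousin2 (P := P)) => [a b c s1 s2 ab bc s12|a b s1 s2 s3 ab s12 s23|t s].
- move=> [F1 /PA ind1] [F2 /PA ind2].
  have [F HF] : exists F, forall x, A a b s1 s2 x \/ A b c s1 s2 x -> induced_at F x.
  apply: (@glue 0 b _ _ F1 F2 (vec2 b s1)) ind1 ind2.
  + by move=> x [/andP[]].
  + by move=> x [/andP[]].
  + by move=> x [_ x2] xb; split=> //; rewrite xb lexx ltW.
  + by move=> x [_ x2] xb; split=> //; rewrite xb lexx ltW.
  + exact: sc.
  + by rewrite /A vec20 vec21 !lexx !ltW.
  exists F => t s /andP[at_ tc] ss; apply: HF; rewrite /A vec20 vec21.
  by have [tb|/ltW bt] := leP t b; [left|right]; rewrite ?at_ ?bt.
- move=> [F1 /PA ind1] [F2 /PA ind2].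
  have [F HF] : exists F, forall x, A a b s1 s2 x \/ A a b s2 s3 x -> induced_at F x.
  apply: (@glue 1 s2 _ _ F1 F2 (vec2 a s2)) ind1 ind2.
  + by move=> x [_ /andP[]].
  + by move=> x [_ /andP[]].
  + by move=> x [x2 _] xb; split=> //; rewrite xb lexx ltW.
  + by move=> x [x2 _] xb; split=> //; rewrite xb lexx ltW.
  + exact: sc.
  + by rewrite /A vec20 vec21 !lexx !ltW.
  exists F => t s tt /andP[as_ sc']; apply: HF; rewrite /A vec20 vec21.
  by have [tb|/ltW bt] := leP s s2; [left|right]; rewrite ?as_ ?bt.
have [F Fr] := induced_at_local (vec2 t s).
have [r r0 H] := vec2_near Fr.
exists r => // a b s1 s2 _ _ /andP[t1 t2] /andP[u1 u2] ta bt sa bs; exists F.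
by move=> t' s' /andP[t'1 t'2] /andP[s'1 s'2]; apply: H; rewrite ltr_norml; lra.
Qed.

Lemma induced_exists : exists F, forall x, induced_at F x.
Proof.
have [F0 [r r0 H0]] := induced_at_local 0.
have ind0 : induced_at F0 0 by have := H0 0; rewrite addr0 normr0; apply.
(* Equality with [F0] near 0 removes the freedom of a Z-affine function, so that the solutions on
   different squares agree on the smaller one. *)
pose good (n : nat) F := (forall x, `|x| <= n.+1%:R -> induced_at F x) /\
  \forall y \near (0 : V), F y = F0 y.
have /choice[G GP] : forall n : nat, exists F, good n F.
  move=> n; have n0 : - (n.+1%:R : R) < n.+1%:R.
    by have := ltr0Sn R n; lra.
  have [F HF] := induced_on_rectangle n0 n0.
  have ind x : `|x| <= n.+1%:R -> induced_at F x.
    move=> xn; have -> : x = vec2 (x 0 0) (x 0 1) by apply: row2P; rewrite ?vec20 ?vec21.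
    have [x0 x1] := norm2_le x.
    by apply: HF; rewrite -ler_norml; [exact: le_trans x0 xn|exact: le_trans x1 xn].
  have ind_0 : induced_at F 0 by apply: ind; rewrite normr0 ler0n.
  have [m Hm] := induced_at_sub ind_0 ind0.
    exists (fun y => F y - affine_fun m y); split=> [x /ind indx|].
      apply: induced_at_addl indx; apply: Zaffine_eq (ZaffineN (affine_Zaffine m x)) => y.
      by rewrite addrAC subrr add0r.
    by near=> y; rewrite -(near Hm y) // opprB addrC subrK.
have agree n n' F F' x : good n F -> good n' F' -> `|x| <= n.+1%:R -> `|x| <= n'.+1%:R -> F x = F' x.
  move=> [indF FF0] [indF' F'F0] xn xn'.
  have seg (c t : R) : 0 <= t <= 1 -> `|x| <= c -> `|0 + t *: (x - 0)| <= c.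
    move=> /andP[t0 t1] xc; rewrite add0r subr0 normrZ ger0_norm //.
    by apply: le_trans xc; rewrite ler_piMl.
  have [m Hm] : exists m, forall t : R, 0 <= t <= 1 ->
      \forall z \near (0 + t *: (x - 0)), F z - F' z = affine_fun m z.
    apply: (@Zaffine_path _ (fun y => F y - F' y)) => t t01.
    by apply: induced_at_sub; [apply: indF|apply: indF']; exact: seg.
  have m0 : m = (0, 0).
    have Hm0 := Hm 0; rewrite scale0r addr0 lexx ler01 in Hm0.
    apply: (affine_near_unique (Hm0 isT)).
    near=> y; rewrite (near FF0 y) // (near F'F0 y) // subrr /affine_fun /= toR0 pairing0l.
    by rewrite addr0.
  have Hm1 := Hm 1; rewrite scale1r add0r subr0 lexx ler01 in Hm1.
  have := nbhs_singleton (Hm1 isT); rewrite m0 /affine_fun /= toR0 pairing0l addr0 => /eqP.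
  by rewrite subr_eq0 => /eqP.
pose N (x : V) := Num.truncn `|x|.
have NP x : `|x| <= (N x).+1%:R by apply/ltW/Num.Theory.truncnS_gt.
(* Within distance 1 of x all the solutions involved agree with the one on the next larger
   square. *)
exists (fun x => G (N x) x) => x.
apply: (@induced_at_near (G (N x).+1)); last first.
  by apply: (GP (N x).+1).1; apply: le_trans (NP x) _; rewrite ler_nat.
apply/nearE; exists 1 => // k k1; apply: agree (GP _) (GP _) (NP _) _.
apply: le_trans (ler_normD _ _) _; rewrite -[(N x).+2%:R]natr1.
by apply: lerD; [exact: NP|exact: ltW].
Unshelve. all: by end_near. Qed.

(** The translate of F has the same local equations, so it differs from F by a global Z-affine
    function. *)
Lemma induced_quasi_period F l : (forall x, induced_at F x) -> l \in int_span B ->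
  exists q, quasi_period F l q.
Proof.
move=> indF lB.
have indFl x : induced_at (fun y => F (y + l)) x.
  move=> U f DU Ux; have projl y : proj (y + l) = proj y.
    by apply/tproj_eq; rewrite addrAC subrr add0r.
  have [m /nearE[e e0 Hm]] := indF (x + l) U f DU (eq_ind_r U Ux (projl x)).
  exists (m.1, m.2 + pairing (toR m.1) l); apply/nearE; exists e => // k ke.
  have := Hm k ke; rewrite addrAC projl => ->.
  by rewrite /affine_fun /= (pairingDr _ _ l); ring.
have [m Hm] := Zaffine_global (fun x => induced_at_sub (indFl x) (indF x)).
exists m.1, m.2 => x; have := Hm x; rewrite /affine_fun => H.
by rewrite -addrA -H addrC subrK.
Qed.

Lemma induced_rational F : (forall x, induced_at F x) -> forall x, rational_at F x.
Proof.
move=> indF x; have [U [f [DU Ux]]] := divisor_cover (proj x).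
have [opD _ _] := hD; have [_ ratf] := opD U f DU.
apply: rational_addl (indF x U f DU Ux).
by move: ratf; rewrite rational_onE; apply.
Qed.

(** The rows of Q are the slopes of the quasi-periods of the basis vectors; computing F at l1 + l2
    in two ways makes Q symmetric, and alpha is solved from the two constants. *)
Lemma line_bundle_exists : B \in unitmx -> exists Q alpha, line_bundle_iso D Q alpha.
Proof.
move=> uB; have [F indF] := induced_exists.
pose l1 := row 0 B; pose l2 := row 1 B.
have [q1 Fq1] := induced_quasi_period indF (row_int_span B 0).
have [q2 Fq2] := induced_quasi_period indF (row_int_span B 1).
have [k1 F1] := Fq1; have [k2 F2] := Fq2.
rewrite -/l1 -/l2 in F1 F2.
pose Q : 'M[int]_2 := \matrix_(i, j) (if i == 0 then q1 else q2) 0 j.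
have Q0 : row 0 Q = q1 by apply/rowP => j; rewrite !mxE.
have Q1 : row 1 Q = q2 by apply/rowP => j; rewrite !mxE.
have l12 : det2 l1 l2 != 0 by rewrite det_rows -unitfE -unitmxE.
have sym12 : pairing (toR q1) l2 = pairing (toR q2) l1.
  have A := F1 (0 + l2); have A' := F2 0; have C := F2 (0 + l1); have C' := F1 0.
  have E : F (0 + l2 + l1) = F (0 + l1 + l2) by rewrite addrAC.
  rewrite A A' C C' !add0r !pairing0r in E; lra.
have reE x y : real_ext B Q x y = lcoord1 l1 l2 x * pairing (toR q1) y +
    lcoord2 l1 l2 x * pairing (toR q2) y.
  rewrite {1}(lcoordK l12 x) real_extE /lpoint mulmxDl -!scalemxAl pairingDl !pairingZl.
  by rewrite -!real_extE !real_ext_row // Q0 Q1.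
have symQ : Defs.symmetric_form B Q.
  have pl q z : pairing q z = lcoord1 l1 l2 z * pairing q l1 + lcoord2 l1 l2 z * pairing q l2.
    by rewrite {1}(lcoordK l12 z) /lpoint pairingDr !pairingZr.
  move=> x y; rewrite !reE !(pl _ x) !(pl _ y) sym12.
  move: (lcoord1 _ _ x) (lcoord2 _ _ x) (lcoord1 _ _ y) (lcoord2 _ _ y) => *.
  by ring.
(* The constant of each quasi-period must be Q(l, l)/2 + alpha(l); A1 and A2 are the values of alpha
   that this prescribes, and Cramer's rule gives alpha. *)
pose A1 := k1 - pairing (toR q1) l1 / 2; pose A2 := k2 - pairing (toR q2) l2 / 2.
pose alpha := vec2 ((A1 * l2 0 1 - A2 * l1 0 1) / det2 l1 l2)
                   ((A2 * l1 0 0 - A1 * l2 0 0) / det2 l1 l2).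
have al1 : pairing alpha l1 = A1.
  by move: l12; rewrite pairing2 vec20 vec21 /det2 => D0; field.
have al2 : pairing alpha l2 = A2.
  by move: l12; rewrite pairing2 vec20 vec21 /det2 => D0; field.
pose sec l := forall x, F (x + l) = F x + real_ext B Q l x + real_ext B Q l l / 2 + pairing alpha l.
have reDl x y z : real_ext B Q (x + y) z = real_ext B Q x z + real_ext B Q y z.
  by rewrite !reE lcoord1D lcoord2D; ring.
have reDr x y z : real_ext B Q z (x + y) = real_ext B Q z x + real_ext B Q z y.
  by rewrite symQ reDl !(symQ z).
have reNl y z : real_ext B Q (- y) z = - real_ext B Q y z.
  by rewrite !reE lcoord1N lcoord2N; ring.
have secD l l' : sec l -> sec l' -> sec (l + l').
  move=> sl sl' x; rewrite addrA sl' sl !reDl !reDr pairingDr (symQ l' l); lra.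
have secN l : sec l -> sec (- l).
  move=> sl x; have := sl (x - l); rewrite subrK => ->.
  rewrite !reNl [real_ext B Q l (- l)]symQ reNl [real_ext B Q l (x - l)]symQ reDl reNl.
  by rewrite pairingNr [real_ext B Q x l]symQ; lra.
have sec1 : sec l1.
  move=> x; rewrite F1 !real_ext_row // Q0 al1 /A1; lra.
have sec2 : sec l2.
  move=> x; rewrite F2 !real_ext_row // Q1 al2 /A2; lra.
have sec0 : sec 0.
  by rewrite -(subrr l1); apply: secD => //; exact: secN.
have secZ l (n : int) : sec l -> sec (n%:~R *: l).
  move=> sl; have nat_case (p : nat) : sec (p%:R *: l).
    elim: p => [|p IH]; first by rewrite scale0r.
    by rewrite -natr1 scalerDl scale1r; exact: secD.
  case: n => p; first exact: nat_case.
  by rewrite NegzE rmorphN scaleNr; apply: secN; exact: nat_case.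
exists Q, alpha; split=> //; exists F; split; last by rewrite induced_byE => U f DU x Ux; exact: (indF x U f DU Ux).
split; first exact: induced_rational.
move=> l x /mem_int_span[n1 [n2 ->]].
by apply: (secD _ _ (secZ _ n1 sec1) (secZ _ n2 sec2)).
Qed.

End Gluing.

(** * Closure properties of regular and rational functions *)

Section RegularClosure.
Context {R : realType}.
Local Notation V := 'rV[R]_2.
Local Notation Z2 := 'rV[int]_2.
Implicit Types (f g h F G : V -> R) (x y z k : V) (m i j : Z2 * R) (s : seq (Z2 * R)).

Definition bigmax_affine i s y : R := \big[Num.max/affine_fun i y]_(j <- s) affine_fun j y.

Definition max_affine G := exists i s, forall y, G y = bigmax_affine i s y.

Lemma max_affine_max G H : max_affine G -> max_affine H ->
  max_affine (fun y => Num.max (G y) (H y)).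
Proof.
move=> [i [s Gs]] [i' [s' Hs]].
suff [i2 [s2 E]] : exists i2 s2, forall y,
    Num.max (bigmax_affine i s y) (bigmax_affine i' s' y) = bigmax_affine i2 s2 y.
  by exists i2, s2 => y; rewrite Gs Hs.
elim: s' {H Hs} => [|j s' [i2 [s2 IH]]].
  by exists i, (i' :: s) => y; rewrite /bigmax_affine big_nil big_cons maxC.
exists i2, (j :: s2) => y; have := IH y.
by rewrite /bigmax_affine !big_cons maxCA => ->.
Qed.

Lemma max_affineD G H : max_affine G -> max_affine H -> max_affine (fun y => G y + H y).
Proof.
move=> mG [i' [s' Hs]].
have shift m : max_affine (fun y => G y + affine_fun m y).
  have [i [s Gs]] := mG; exists (i.1 + m.1, i.2 + m.2), [seq (j.1 + m.1, j.2 + m.2) | j <- s].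
  by move=> y; rewrite Gs /bigmax_affine bigmax_affineD.
suff [i2 [s2 E]] : max_affine (fun y => G y + bigmax_affine i' s' y).
  by exists i2, s2 => y; rewrite Hs.
elim: s' {H Hs} => [|j s' IH].
  have [i2 [s2 E]] := shift i'; exists i2, s2 => y.
  by rewrite {1}/bigmax_affine big_nil.
have [i2 [s2 E]] := max_affine_max (shift j) IH; exists i2, s2 => y.
by rewrite -E {1}/bigmax_affine big_cons addr_maxr.
Qed.

Lemma regular_atP f x : regular_at f x <-> exists2 G, max_affine G & \forall y \near x, f y = G y.
Proof.
split=> [[_ [i [s fs]]]|[G [i [s Gs]] fG]]; first by exists (bigmax_affine i s) => //; exists i, s.
have fs : \forall y \near x, f y = bigmax_affine i s y by near=> y; rewrite -Gs; near: y.
split; last by exists i, s.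
have [a [t H]] := bigmax_affine_germ i s x.
have [C _ HC] := @max_covectors_bound R a t.
exact: (germ_continuous (germ_at_near fs H) HC).
Unshelve. all: by end_near. Qed.

Lemma regular_near f g x : (\forall y \near x, g y = f y) -> regular_at f x -> regular_at g x.
Proof.
move=> gf /regular_atP[G mG fG]; apply/regular_atP; exists G => //.
by near=> y; rewrite (near gf y) // (near fG y).
Unshelve. all: by end_near. Qed.

Lemma regular_max f g x : regular_at f x -> regular_at g x ->
  regular_at (fun y => Num.max (f y) (g y)) x.
Proof.
move=> /regular_atP[G mG fG] /regular_atP[H mH gH]; apply/regular_atP.
exists (fun y => Num.max (G y) (H y)); first exact: max_affine_max.
by near=> y; rewrite (near fG y) // (near gH y).
Unshelve. all: by end_near. Qed.

Lemma regularD f g x : regular_at f x -> regular_at g x -> regular_at (fun y => f y + g y) x.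
Proof.
move=> /regular_atP[G mG fG] /regular_atP[H mH gH]; apply/regular_atP.
exists (fun y => G y + H y); first exact: max_affineD.
by near=> y; rewrite (near fG y) // (near gH y).
Unshelve. all: by end_near. Qed.

Lemma regular_Zaffine f F x : regular_at f x -> Zaffine_at (fun y => F y - f y) x ->
  regular_at F x.
Proof.
move=> rf [m Fm]; apply: regular_near (regular_addl m rf).
by near=> y; rewrite -(near Fm y) // addrC subrK.
Unshelve. all: by end_near. Qed.

Lemma rational_continuous f x : (exists g h, \forall y \near x,
  [/\ regular_at g y, regular_at h y & f y = g y - h y]) -> rational_at f x.
Proof.
move=> [g [h fgh]]; split; last by exists g, h.
have [/regular_germ[a [s ga]] /regular_germ[b [t hb]] _] := nbhs_singleton fgh.
have [C _ HC] := @max_covectors_bound R a s; have [C' _ HC'] := @max_covectors_bound R b t.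
apply: (@germ_continuous _ _ _ (fun k => max_covectors a s k - max_covectors b t k) (C + C')).
  by apply: germ_at_near (germ_atB ga hb); near=> y; have [] := near fgh y.
move=> k; rewrite mulrDl; apply: le_trans (ler_normB _ _) _; exact: lerD.
Unshelve. all: by end_near. Qed.

Lemma regular_rational f x : (\forall y \near x, regular_at f y) -> rational_at f x.
Proof.
move=> rf; apply: rational_continuous; exists f, (affine_fun (0, 0)).
near=> y; split; first by near: y.
  apply/regular_atP; exists (affine_fun (0, 0)); last by near=> z.
  by exists (0, 0), [::] => z; rewrite /bigmax_affine big_nil.
by rewrite /affine_fun /= toR0 pairing0l addr0 subr0.
Unshelve. all: by end_near. Qed.

Lemma regularB_rational f F x : (\forall y \near x, regular_at f y) -> rational_at F x ->
  rational_at (fun y => f y - F y) x.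
Proof.
move=> rf [_ [g [h Fgh]]]; apply: rational_continuous; exists (fun y => f y + h y), g.
near=> y; have [gy hy Fy] : [/\ regular_at g y, regular_at h y & F y = g y - h y].
  by near: y.
split=> //; first by apply: regularD => //; near: y.
by rewrite Fy opprB addrA.
Unshelve. all: by end_near. Qed.

End RegularClosure.

(** * Linear systems as regular sections *)

Section LinearSystems.
Context {R : realType} (B : 'M[R]_2).
Local Notation V := 'rV[R]_2.
Local Notation proj := (tproj B).
Implicit Types (F : V -> R) (x y : V) (Q : 'M[int]_2) (alpha : V).

Definition quasi_periodic Q alpha F := forall l x, l \in int_span B ->
  F (x + l) = F x + real_ext B Q l x + real_ext B Q l l / 2 + pairing alpha l.

Definition regular_section Q alpha F := (forall x, regular_at F x) /\ quasi_periodic Q alpha F.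

Lemma Zaffine_translate F l q x : quasi_period F l q -> Zaffine_at F x -> Zaffine_at F (x + l).
Proof.
move=> [c H] [m /nearE[e e0 Fm]].
exists (m.1 + q, m.2 + c - pairing (toR m.1) l - pairing (toR q) l).
apply/nearE; exists e => // k ke.
have -> : x + l + k = x + k + l by rewrite addrAC.
by rewrite H (Fm k ke) /affine_fun /= toRD pairingDl !(pairingDr _ _ l); ring.
Qed.

Lemma quasi_periodic_period Q alpha F l : B \in unitmx -> quasi_periodic Q alpha F ->
  l \in int_span B -> exists q, quasi_period F l q.
Proof.
move=> uB qF lB; have [n1 [n2 lE]] := (mem_int_span B l).1 lB.
exists (n1%:~R *: row 0 Q + n2%:~R *: row 1 Q), (real_ext B Q l l / 2 + pairing alpha l).
move=> x; rewrite qF // !addrA; congr (_ + _ + _ + _).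
have toRZ (n : int) (u : 'rV[int]_2) : toR (n%:~R *: u) = n%:~R *: toR u :> V.
  by apply/rowP => j; rewrite !mxE !intz rmorphM.
rewrite {1}lE real_extE mulmxDl -!scalemxAl pairingDl !pairingZl -!real_extE !real_ext_row //.
by rewrite toRD !toRZ pairingDl !pairingZl.
Qed.

Section Divisor.
Variables (D : local_data B) (Q : 'M[int]_2) (alpha : V) (FD : V -> R).
Hypothesis uB : B \in unitmx.
Hypothesis hD : is_divisor D.
Hypothesis secD : section_of B Q alpha FD.
Hypothesis indD : induced_by D FD.

Lemma FD_induced x : induced_at D FD x.
Proof. by move=> U f DU Ux; move: indD; rewrite induced_byE => H; exact: (H U f DU x Ux). Qed.

(** If E - D is the divisor of h, then FD plus the lift of h has divisor E and the same
    quasi-periods; it is regular because E has regular local equations up to Z-affine functions. *)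
Lemma linear_system_section E : linear_system D E -> exists F, regular_section Q alpha F /\
  forall x, Defs.support E (proj x) -> ~ Zaffine_at F x.
Proof.
move=> [hE [E' [hE' sameEE' regE']] [h [_ sameh]]].
pose F := fun x => FD x + h (proj x).
have indF x : induced_at E F x.
  move=> U f EU Ux; have [W [g [DW Wx]]] := divisor_cover hD (proj x).
  have Z1 := FD_induced DW Wx.
  have Z2 : Zaffine_at (fun y => f (proj y) - g (proj y) - h (proj y)) x.
    move: sameh; rewrite same_divisorE => sameh.
    apply: (sameh (U `&` W) (fun p => f p - g p) setT h) => //.
    by exists U, f, W, g.
  by apply: Zaffine_eq (ZaffineB Z1 Z2) => y; rewrite /F; ring.
exists F; split; first split.
- move=> x; have [U [f [EU Ux]]] := divisor_cover hE (proj x).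
  have [W [g [E'W Wx]]] := divisor_cover hE' (proj x).
  have := regE' W g E'W; rewrite regular_onE => /(_ x Wx) rg.
  apply: (regular_Zaffine rg).
  have Z1 : Zaffine_at (fun y => f (proj y) - g (proj y)) x.
    by move: sameEE'; rewrite same_divisorE; apply; first exact: EU; first exact: E'W.
  by apply: Zaffine_eq (ZaffineD (indF x U f EU Ux) Z1) => y; rewrite /=; ring.
- move=> l x lB; rewrite /F secD.2 //; have -> : proj (x + l) = proj x.
    by apply/tproj_eq; rewrite addrAC subrr add0r.
  by ring.
move=> x [x' sx' xx'] ZF.
have qF : quasi_periodic Q alpha F.
  move=> l z lB; rewrite /F secD.2 //; have -> : proj (z + l) = proj z.
    by apply/tproj_eq; rewrite addrAC subrr add0r.
  by ring.
have indE : induced_by E F by rewrite induced_byE => U f EU y Uy; exact: (indF y U f EU Uy).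
move/(support_liftP (divisor_cover hE) indE): sx'; apply.
have lB : x' - x \in int_span B by apply/tproj_eq.
have [q ql] := quasi_periodic_period uB qF lB.
by rewrite -[x'](subrK x) addrC; exact: Zaffine_translate ql ZF.
Qed.

(** F - FD is periodic and descends to a function h on the torus; adding h to the local equations of
    D gives E. *)
Lemma section_linear_system F : regular_section Q alpha F -> exists2 E, linear_system D E &
  forall x, ~ Zaffine_at F x -> Defs.support E (proj x).
Proof.
move=> [regF qF]; pose h (p : torus B) := F (repr p) - FD (repr p).
have hE x : h (proj x) = F x - FD x.
  have lB : repr (proj x) - x \in int_span B by apply/tproj_eq; rewrite tproj_repr.
  by rewrite /h -[repr _](subrK x) [_ + x]addrC qF // secD.2 //; ring.
pose E : local_data B := [set c | exists U f, D (U, f) /\ c = (U, fun p => f p + h p)].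
have [opD covD sameD] := hD.
have indE x : induced_at E F x.
  move=> U _ [U' [f [DU [-> ->]]]] Ux.
  by apply: Zaffine_eq (FD_induced DU Ux) => y; rewrite /= hE; ring.
have indEF : induced_by E F by rewrite induced_byE => U f EU y Uy; exact: (indE y U f EU Uy).
have regE U f : E (U, f) -> regular_on U f.
  move=> EU; rewrite regular_onE => x Ux; apply: (regular_Zaffine (regF x)).
  by apply: Zaffine_eq (ZaffineN (indE x U f EU Ux)) => y; rewrite /=; ring.
have sameE : same_divisor E E.
  rewrite same_divisorE => _ _ _ _ [U [f [DU [-> ->]]]] [W [g [DW [-> ->]]]] x UWx.
  move: sameD; rewrite same_divisorE => /(_ _ _ _ _ DU DW x UWx).
  by apply: Zaffine_eq => y; ring.
have hdE : is_divisor E.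
  split=> // [_ _ [U [f [DU [-> ->]]]]|p]; last first.
    by have [U [f [DU Up]]] := covD p; exists U, (fun p => f p + h p); split=> //; exists U, f.
  have [oU _] := opD U f DU; split=> //; rewrite rational_onE => x Ux.
  have EU : E (U, fun p => f p + h p) by exists U, f.
  apply: regular_rational; have := tproj_open oU Ux; apply: filterS => y Uy.
  by have := regE _ _ EU; rewrite regular_onE; apply.
exists E; last first.
  by move=> x nZ; exists x => //; apply/(support_liftP (divisor_cover hdE) indEF).
split=> //; first by exists E.
exists h; split.
  rewrite rational_onE => x _; have -> : h \o proj = fun y => F y - FD y by apply: funext => y /=.
  apply: regularB_rational; last exact: secD.1.
  by apply/nearE; exists 1 => // k _; exact: regF.
rewrite same_divisorE => _ _ _ _ [_ [_ [W [g [[U [f [DU [-> ->]]]] DW [-> ->]]]]]] [-> ->] x [[Ux Wx] _].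
move: sameD; rewrite same_divisorE => /(_ _ _ _ _ DU DW x (conj Ux Wx)).
by apply: Zaffine_eq => y; ring.
Unshelve. all: by end_near. Qed.

Lemma avoidableP k : avoidable D k <->
  exists p : 'I_k -> V, forall F, regular_section Q alpha F -> exists i, Zaffine_at F (p i).
Proof.
split=> [[p avoid]|[p zaff]].
  exists (fun i => repr (p i)) => F rF; apply: contrapT => /forallNP nZ.
  have [E sysE supE] := section_linear_system rF.
  by apply: (avoid E sysE) => i; have := supE _ (nZ i); rewrite tproj_repr.
exists (fun i => proj (p i)) => E sysE supE.
have [F [rF nZ]] := linear_system_section sysE; have [i Zi] := zaff F rF.
exact: nZ (supE i) Zi.
Qed.

End Divisor.

Lemma h0_nat (D : local_data B) N : avoidable D N -> (forall k, (k < N)%N -> ~ avoidable D k) ->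
  h0 D = N%:R%:E.
Proof.
move=> aN minN; rewrite /h0; apply/eqP; rewrite eq_le; apply/andP; split.
  by apply: ereal_inf_lbound; exists N.
apply: le_ereal_inf_tmp => _ [k ak <-]; rewrite lee_fin ler_nat leqNgt.
by apply/negP => /minN.
Qed.

Lemma div_opp_section (D : local_data B) Q alpha FD : section_of B Q alpha FD ->
  induced_by D FD -> is_divisor D ->
  [/\ is_divisor (div_opp D), section_of B (- Q) (- alpha) (fun x => - FD x)
    & induced_by (div_opp D) (fun x => - FD x)].
Proof.
move=> [ratF qF] indD hD; have [opD covD sameD] := hD.
have rationalN f x : rational_at f x -> rational_at (fun y => - f y) x.
  move=> [_ [g [k fgk]]]; apply: rational_continuous; exists k, g.
  by apply: filterS fgk => y [gy ky ->]; split=> //; rewrite opprB.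
have real_extN x y : real_ext B (- Q) x y = - real_ext B Q x y.
  by rewrite !real_extE /gram /toR map_mxN !mulmxN pairingNl.
split.
- split=> [_ _ [U [f [DU [-> ->]]]]|p|].
  + have [oU ratf] := opD U f DU; split=> //.
    by move: ratf; rewrite !rational_onE => ratf x Ux; exact: rationalN (ratf x Ux).
  + by have [U [f [DU Up]]] := covD p; exists U, (fun p => - f p); split=> //; exists U, f.
  rewrite same_divisorE => _ _ _ _ [U [f [DU [-> ->]]]] [W [g [DW [-> ->]]]] x UWx.
  move: sameD; rewrite same_divisorE => /(_ _ _ _ _ DU DW x UWx)/ZaffineN.
  by apply: Zaffine_eq => y; ring.
- split=> [x|l x lB]; first exact: rationalN.
  by rewrite qF // !real_extN pairingNl; lra.
rewrite induced_byE => _ _ [U [f [DU [-> ->]]]] x Ux.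
move: indD; rewrite induced_byE => /(_ _ _ DU x Ux)/ZaffineN.
by apply: Zaffine_eq => y; ring.
Qed.

End LinearSystems.

Lemma ord2P (j : 'I_2) : j = 0 \/ j = 1.
Proof. by case: j => -[|[|//]] ?; [left|right]; exact: val_inj. Qed.

Lemma coord_norm_le {R : realType} (z : 'rV[R]_2) j : `|z 0 j| <= `|z|.
Proof. by have [z0 z1] := norm2_le z; have [->|->] := ord2P j. Qed.

(** * Maxima of regular sections *)

Section MidpointConvexity.
Context {R : realType}.
Local Notation V := 'rV[R]_2.
Implicit Types (F f : V -> R) (x y z v h : V).

Lemma max_covectors_opp (a : 'rV[int]_2) s h :
  0 <= max_covectors a s h + max_covectors a s (- h) :> R.
Proof.
have A (k : V) : pairing (toR a) k <= max_covectors a s k by apply: max_covectors_ge; exact: mem_head.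
by have := A h; have := A (- h); rewrite pairingNr; lra.
Qed.

(** Convexity is only known germ by germ. If the inequality failed, F minus the chord plus a small
    convex parabola would have an interior maximum on the segment, where its second difference is
    nevertheless positive. *)
Lemma regular_midpoint F x h : (forall y, regular_at F y) ->
  2 * F x <= F (x + h) + F (x - h).
Proof.
move=> rF; rewrite leNgt; apply/negP => lt.
pose m := (F (x + h) + F (x - h)) / 2; pose c := (F (x + h) - F (x - h)) / 2.
pose d := (F x - m) / 2.
have d0 : 0 < d by rewrite /d /m; lra.
have dm : m = F x - 2 * d by rewrite /d; field.
(* [d] is half of the defect F x - m, so that at 0 the parabola costs less than the defect and [g 0]
   still exceeds the common value m at both ends. *)
pose g (t : R) := F (x + t *: h) - c * t + d * (t ^+ 2 - 1).
have Fx t : {for t, continuous (fun t : R => F (x + t *: h))}.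
  apply: (@continuous_comp R^o V R^o (fun t : R => x + t *: h) F); last exact: (rF _).1.
  by apply: cvgD; [exact: cvg_cst | apply: cvgZr_tmp; exact: cvg_id].
have gc : continuous (g : R^o -> R^o).
  move=> t; apply: cvgD; first apply: cvgB.
  - exact: Fx.
  - by apply: cvgM; [exact: cvg_cst | exact: cvg_id].
  apply: cvgM; first exact: cvg_cst.
  by apply: cvgB; [apply: exprn_continuous | exact: cvg_cst].
have [||t0 t0i tmax] := @EVT_max R g (-1) 1; first by lra.
  exact: continuous_subspaceT.
have g1 : g 1 = m by rewrite /g scale1r /c /m; field.
have gm1 : g (-1) = m by rewrite /g scaleN1r /c /m; field.
have g0 : g 0 = F x - d by rewrite /g scale0r addr0; ring.
have := tmax 0; rewrite in_itv /= lerN10 ler01 g0 => /(_ isT) gt0.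
move: t0i; rewrite in_itv /= => /andP[t01 t02].
have t01' : -1 < t0.
  by rewrite lt_neqAle t01 andbT; apply/eqP => E; move: gt0; rewrite -E gm1 dm; lra.
have t02' : t0 < 1.
  by rewrite lt_neqAle t02 andbT; apply/eqP => E; move: gt0; rewrite E g1 dm; lra.
have [a [s [_ [r r0 H]]]] := regular_germ (rF (x + t0 *: h)).
have [k k0 kh] := scale_small_le h r0.
pose u := Num.min k (Num.min (1 - t0) (t0 + 1)).
have u0 : 0 < u by rewrite !lt_min k0 /=; lra.
have uk : u <= k by rewrite ge_min lexx.
have uh : `|u *: h| < r by apply: kh => //; exact: ltW.
have [u1 u2] : u <= 1 - t0 /\ u <= t0 + 1 by rewrite /u !ge_min !lexx /= !orbT.
have Fp : F (x + (t0 + u) *: h) = F (x + t0 *: h) + max_covectors a s (u *: h).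
  by rewrite scalerDl addrA; exact: H.
have Fm : F (x + (t0 - u) *: h) = F (x + t0 *: h) + max_covectors a s (- (u *: h)).
  by rewrite scalerBl addrA; apply: (H (- _)); rewrite normrN.
have := tmax (t0 + u); rewrite in_itv /= => /(_ ltac:(lra)).
have := tmax (t0 - u); rewrite in_itv /= => /(_ ltac:(lra)).
rewrite /g Fp Fm.
have := max_covectors_opp a s (u *: h).
have : 0 < d * u ^+ 2 by rewrite mulr_gt0 ?exprn_gt0.
move: (max_covectors _ _ _) (max_covectors _ _ _) (F (x + _)) => *; lra.
Qed.

(** By homogeneity the quadratic term is negligible near 0, so the maximum of covectors is at most
    p; each covector is then at most p at k and at - k, hence equal to p. *)
Lemma regular_touch F x (p : V) (C : R) : regular_at F x ->
  (forall k, F (x + k) <= F x + pairing p k + C * `|k| ^+ 2) ->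
  exists2 a, p = toR a & Zaffine_at F x.
Proof.
move=> rF tch; have [a [s H]] := regular_germ rF; have [hG [r r0 HG]] := H.
have C0 : 0 <= `|C| by [].
have le (k : V) : max_covectors a s k <= pairing p k.
  rewrite leNgt; apply/negP => lt.
  have [l l0 lk] := scale_small_le k r0.
  pose e := max_covectors a s k - pairing p k.
  have e0 : 0 < e by rewrite subr_gt0.
  pose M := `|C| * `|k| ^+ 2 + 1.
  have M0 : 0 < M by rewrite ltr_wpDl // mulr_ge0 // exprn_ge0.
  (* Small enough for the quadratic term to stay below the gap e between the linear ones. *)
  pose u := Num.min l (e / M).
  have u0 : 0 < u by rewrite lt_min l0 divr_gt0.
  have ur : `|u *: k| < r by apply: lk; [exact: ltW | rewrite ge_min lexx].
  have := tch (u *: k); rewrite HG // hG; last exact: ltW.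
  rewrite pairingZr normrZ (gtr0_norm u0) => T.
  have T1 : u * e <= u * (u * (C * `|k| ^+ 2)) by rewrite /e; lra.
  move: T1; rewrite ler_pM2l // => T1.
  have T2 : u * (C * `|k| ^+ 2) <= u * (`|C| * `|k| ^+ 2).
    by rewrite ler_pM2l // ler_wpM2r ?exprn_ge0 // ler_norm.
  have T3 : u * M <= e by rewrite -ler_pdivlMr // ge_min lexx orbT.
  by move: T3; rewrite /M; lra.
have eqp b : b \in a :: s -> toR b = p.
  move=> bs; apply: pairing_inj => k; apply/eqP; rewrite eq_le.
  have A (k' : V) : pairing (toR b) k' <= pairing p k' by apply: le_trans (le k'); exact: max_covectors_ge.
  by rewrite A /=; have := A (- k); rewrite !pairingNr lerN2.
exists a; first by rewrite eqp ?mem_head.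
apply: (@germ_Zaffine _ _ _ a); suff -> : pairing (toR a) = max_covectors a s :> (V -> R) by [].
apply: funext => k; have [b bs ->] := max_covectors_mem a s k.
by rewrite !eqp ?mem_head.
Qed.

End MidpointConvexity.

Section SectionMaxima.
Context {R : realType} (B : 'M[R]_2).
Local Notation V := 'rV[R]_2.
Implicit Types (F f : V -> R) (x y v h l : V) (Q : 'M[int]_2) (alpha : V).

Lemma periodic_max f : B \in unitmx -> continuous (f : V -> R^o) ->
  (forall l x, l \in int_span B -> f (x + l) = f x) -> exists x0, forall x, f x <= f x0.
Proof.
move=> uB fc per; pose P (c : V) : V := c 0 0 *: row 0 B + c 0 1 *: row 1 B.
have Pc : continuous P.
  move=> c; pose Z i := @cvgZr_tmp R V V (nbhs c) (nbhs_filter c) (fun c => c 0 i) (c 0 i) (row i B).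
  have Zc i : (fun c : V => c 0 i *: row i B) x @[x --> c] --> c 0 i *: row i B.
    by apply: Z; exact: coord_continuous.
  exact: (cvgD (Zc 0) (Zc 1)).
pose A := [set v : V | forall i, `[(0 : R), 1]%classic (v ord0 i)].
have cA : compact A by by apply: (rV_compact (A := fun=> `[(0:R), 1]%classic)) => i; exact: segment_compact.
have A0 : A !=set0.
  by exists 0 => i; rewrite /= in_itv /= mxE lexx ler01.
have fP : continuous (fun c => f (P c) : R^o).
  by move=> c; apply: (continuous_comp (f := P)); [exact: Pc | exact: fc].
have [|c cmem cmax] := @EVT_max_rV R _ (f \o P) A A0 cA.
  exact: continuous_subspaceT.
have D0 : det2 (row 0 B) (row 1 B) != 0 by rewrite det_rows -unitfE -unitmxE.
have row_per i x : f (x + row i B) = f x by apply: per; exact: row_int_span.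
have row_perN i x : f (x - row i B) = f x by rewrite -[in RHS](subrK (row i B) x) row_per.
exists (P c); apply: (@lattice_reduce _ _ _ D0 _ 0 0).
- by move=> x; rewrite row_per.
- by move=> x; rewrite row_perN.
- by move=> x; rewrite row_per.
- by move=> x; rewrite row_perN.
move=> t s t01 s01; have -> : lpoint (row 0 B) (row 1 B) t s = P (vec2 t s).
  by rewrite /P vec20 vec21.
apply: cmax; rewrite inE /A /= => i; rewrite in_itv /=.
have [->|->] := ord2P i; first by rewrite vec20; lra.
by rewrite vec21; lra.
Qed.

Lemma real_ext_coord Q x y : real_ext B Q x y =
  x 0 0 * gram B Q 0 0 * y 0 0 + x 0 1 * gram B Q 1 0 * y 0 0 +
  x 0 0 * gram B Q 0 1 * y 0 1 + x 0 1 * gram B Q 1 1 * y 0 1.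
Proof.
rewrite real_extE; move: (gram B Q) => G; rewrite pairing2 !mxE !big_ord_recl !big_ord0.
have [-> ->] : lift ord0 ord0 = 1 :> 'I_2 /\ ord0 = 0 :> 'I_2 by split; exact: val_inj.
by ring.
Qed.

Definition gram_norm Q : R :=
  `|gram B Q 0 0| + `|gram B Q 1 0| + `|gram B Q 0 1| + `|gram B Q 1 1|.

Lemma real_ext_bound Q k : real_ext B Q k k <= gram_norm Q * `|k| ^+ 2.
Proof.
rewrite real_ext_coord /gram_norm !mulrDl.
have B2 i j (g : R) : k 0 i * g * k 0 j <= `|g| * `|k| ^+ 2.
  apply: le_trans (ler_norm _) _; rewrite !normrM mulrAC mulrC expr2.
  have kn m : `|k 0 m| <= `|k| by exact: coord_norm_le.
  by apply: ler_wpM2l => //; apply: ler_pM.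
by rewrite !lerD.
Qed.

Lemma real_ext_Dl Q x y z : real_ext B Q (x + y) z = real_ext B Q x z + real_ext B Q y z.
Proof. by rewrite !real_extE mulmxDl pairingDl. Qed.

Lemma real_ext_Dr Q x y z : real_ext B Q z (x + y) = real_ext B Q z x + real_ext B Q z y.
Proof. by rewrite !real_extE pairingDr. Qed.

Lemma real_ext_Zl Q (t : R) x y : real_ext B Q (t *: x) y = t * real_ext B Q x y.
Proof. by rewrite !real_extE -scalemxAl pairingZl. Qed.

Lemma real_ext_Zr Q (t : R) x y : real_ext B Q x (t *: y) = t * real_ext B Q x y.
Proof. by rewrite !real_extE pairingZr. Qed.

Lemma real_ext_Nl Q x y : real_ext B Q (- x) y = - real_ext B Q x y.
Proof. by rewrite !real_extE mulNmx pairingNl. Qed.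

Lemma real_ext_Nr Q x y : real_ext B Q x (- y) = - real_ext B Q x y.
Proof. by rewrite !real_extE pairingNr. Qed.

Section ReducedSection.
Variables (Q : 'M[int]_2) (alpha : V) (F : V -> R).
Hypothesis uB : B \in unitmx.
Hypothesis symQ : Defs.symmetric_form B Q.
Hypothesis secF : regular_section B Q alpha F.

Definition reduced_section x := F x - real_ext B Q x x / 2 - pairing alpha x.
Local Notation phi := reduced_section.

Lemma reduced_section_periodic l x : l \in int_span B -> phi (x + l) = phi x.
Proof.
move=> lB; rewrite /phi secF.2 // pairingDr real_ext_Dl !real_ext_Dr (symQ x l); lra.
Qed.

Lemma reduced_section_continuous : continuous (phi : V -> R^o).
Proof.
have C i : continuous (fun y : V => y 0 i : R^o) by move=> x; exact: coord_continuous.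
have K (k : R) : continuous (fun _ : V => k : R^o) by move=> x; exact: cst_continuous.
have D (f g : V -> R^o) : continuous f -> continuous g -> continuous (fun y => f y + g y).
  by move=> cf cg x; exact: (@cvgD R R^o V (nbhs x) (nbhs_filter x) f g _ _ (cf x) (cg x)).
have M (f g : V -> R^o) : continuous f -> continuous g -> continuous (fun y => f y * g y).
  by move=> cf cg x; exact: (@cvgM R V (nbhs x) (nbhs_filter x) f g _ _ (cf x) (cg x)).
have Cq i j k : continuous (fun y : V => y 0 i * k * y 0 j : R^o) by apply: (M) => //; exact: (M).
rewrite (_ : phi = fun y => F y + - 2^-1 * (y 0 0 * gram B Q 0 0 * y 0 0 + y 0 1 * gram B Q 1 0 * y 0 0 +
    y 0 0 * gram B Q 0 1 * y 0 1 + y 0 1 * gram B Q 1 1 * y 0 1) +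
    (- alpha 0 0 * y 0 0 + - alpha 0 1 * y 0 1)); last first.
  by apply: funext => y; rewrite /phi real_ext_coord pairing2; field.
apply: (D _ _ (D _ _ _ _)).
- by move=> x; exact: (secF.1 x).1.
- by apply: (M) => //; do 3?apply: (D).
by apply: (D); apply: (M).
Qed.

Lemma reduced_section_max : exists x0, forall x, phi x <= phi x0.
Proof.
apply: periodic_max => //; first exact: reduced_section_continuous.
by move=> l x; exact: reduced_section_periodic.
Qed.

Lemma reduced_midpoint x h : 2 * phi x <= phi (x + h) + phi (x - h) + real_ext B Q h h.
Proof.
have := regular_midpoint x h secF.1; rewrite /phi !pairingDr pairingNr.
rewrite !real_ext_Dl !real_ext_Dr !real_ext_Nl !real_ext_Nr; lra.
Qed.

Lemma section_psd : positive_semidefinite B Q.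
Proof.
move=> v; rewrite leNgt; apply/negP => qv.
have [x0 xmax] := reduced_section_max.
pose q := - real_ext B Q v v; have q0 : 0 < q by rewrite oppr_gt0.
(* At this scale -Q(t v, t v) exceeds twice the difference between the maximum of phi and its value
   at 0, which midpoint convexity at 0 forbids. *)
pose t := Num.sqrt ((2 * (phi x0 - phi 0) + 1) / q).
have t2 : t ^+ 2 * q = 2 * (phi x0 - phi 0) + 1.
  rewrite sqr_sqrtr ?divfK ?gt_eqF //; apply: divr_ge0; last exact: ltW.
  by have := xmax 0; lra.
have := reduced_midpoint 0 (t *: v); rewrite real_ext_Zl real_ext_Zr mulrA -expr2.
have := xmax (0 + t *: v); have := xmax (0 - t *: v); move: t2; rewrite /q; lra.
Qed.

Lemma reduced_max_touch x0 : (forall x, phi x <= phi x0) ->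
  exists2 a, x0 *m gram B Q + alpha = toR a & Zaffine_at F x0.
Proof.
move=> xmax.
apply: (regular_touch (secF.1 x0) (C := gram_norm Q / 2)) => k; have kq := real_ext_bound Q k.
have := xmax (x0 + k); rewrite /phi pairingDr real_ext_Dl !real_ext_Dr (symQ k x0).
rewrite pairingDl -(real_extE B Q x0 k); lra.
Qed.

Lemma section_in_image : in_image_plus_int B Q alpha.
Proof.
have [x0 /reduced_max_touch[a E _]] := reduced_section_max.
by exists (- x0), a; rewrite mulNmx -E addrA addNr add0r.
Qed.

(** As Q(v, v) = 0, midpoint convexity bounds twice the maximum by the sum of the values at x0 + v
    and x0 - v, so both are maximal. *)
Lemma reduced_max_kernel x0 v : (forall x, phi x <= phi x0) -> v *m gram B Q = 0 ->
  forall x, phi x <= phi (x0 - v).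
Proof.
move=> xmax v0 x; have := reduced_midpoint x0 v; rewrite real_extE v0 pairing0l.
by have := xmax x; have := xmax (x0 + v); lra.
Qed.

Lemma section_Zaffine (I : Type) (y : I -> V) :
  (forall x a, x *m gram B Q + alpha = toR a -> exists i l, l \in int_span B /\
     (x - y i - l) *m gram B Q = 0) ->
  exists i, Zaffine_at F (y i).
Proof.
move=> cover; have [x0 xmax] := reduced_section_max.
have [a E _] := reduced_max_touch xmax; have [i [l [lB v0]]] := cover x0 a E.
exists i; have max1 := reduced_max_kernel xmax v0.
have max2 x : phi x <= phi (y i).
  apply: le_trans (max1 x) _; rewrite (_ : x0 - _ = y i + l); last first.
    by apply: row2P; rewrite !mxE; ring.
  by rewrite reduced_section_periodic.
by have [] := reduced_max_touch max2.
Qed.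

End ReducedSection.
End SectionMaxima.

Definition int_box (N : nat) : seq 'rV[int]_2 :=
  let c := [seq i%:Z - N%:Z | i <- iota 0 (2 * N).+1] in
  [seq \row_(j < 2) (if j == 0 then a else b) | a <- c, b <- c].

Lemma mem_int_box N (m : 'rV[int]_2) : (forall j, `|m 0 j| <= N%:Z) -> m \in int_box N.
Proof.
move=> mN; have mem (z : int) : `|z| <= N%:Z -> z \in [seq i%:Z - N%:Z | i <- iota 0 (2 * N).+1].
  move=> zN; apply/mapP; exists (absz (z + N%:Z)); last by lia.
  by rewrite mem_iota; lia.
apply/allpairsP; exists (m 0 0, m 0 1); split=> /=.
- exact: mem (mN 0).
- exact: mem (mN 1).
by apply/rowP => j; rewrite mxE; have [->|->] := ord2P j.
Qed.

(** * Theta functions *)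

Section Theta.
Context {R : realType} (B : 'M[R]_2) (Q : 'M[int]_2) (alpha : 'rV[R]_2).
Local Notation V := 'rV[R]_2.
Local Notation Z2 := 'rV[int]_2.
Local Notation q := (fun w => real_ext B Q w w).
Implicit Types (F : V -> R) (x y w h l : V) (n m : Z2).
Hypothesis uB : B \in unitmx.
Hypothesis symQ : Defs.symmetric_form B Q.
Hypothesis psdQ : positive_semidefinite B Q.

Lemma toRDz m n : toR (m + n) = toR m + toR n :> V.
Proof. exact: toRD. Qed.

Lemma lattice_gram n : toR n *m B *m gram B Q = toR (n *m Q).
Proof. by rewrite /gram -mulmxA mulKVmx // /toR map_mxM. Qed.

Lemma real_ext_kernel w w' : (w - w') *m gram B Q = 0 -> q w' = q w.
Proof.
move=> ker; have -> : w = (w - w') + w' by rewrite subrK.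
move: (w - w') ker => v ker; rewrite real_ext_Dl !real_ext_Dr (symQ w' v).
by rewrite !(real_extE B Q v) ker !pairing0l !add0r.
Qed.

(** A strict upper bound of the diagonal entries of a semidefinite form, positive even for Q = 0. *)
Definition gram_diag : R := gram B Q 0 0 + gram B Q 1 1 + 1.

Lemma real_ext_delta j : real_ext B Q (delta_mx 0 j) (delta_mx 0 j) = gram B Q j j.
Proof. by rewrite /real_ext -rowE trmx_delta -colE !mxE. Qed.

Lemma gram_diag_gt j : gram B Q j j < gram_diag /\ 0 < gram_diag.
Proof.
have D0 : 0 <= gram B Q 0 0 by rewrite -real_ext_delta.
have D1 : 0 <= gram B Q 1 1 by rewrite -real_ext_delta.
by have [->|->] := ord2P j; rewrite /gram_diag; lra.
Qed.

Lemma real_ext_ge w j : (w *m gram B Q) 0 j ^+ 2 <= gram_diag * q w.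
Proof.
have [Gj T0] := gram_diag_gt j; pose b := (w *m gram B Q) 0 j.
have bE : real_ext B Q w (delta_mx 0 j) = b.
  by rewrite /real_ext trmx_delta -colE mxE.
have := psdQ (gram_diag *: w - b *: delta_mx 0 j).
rewrite real_ext_Dl !real_ext_Dr !real_ext_Nl !real_ext_Nr !real_ext_Zl !real_ext_Zr.
rewrite (symQ (delta_mx 0 j)) bE real_ext_delta -/b.
set T := gram_diag; move=> H.
have Hb : b * (b * gram B Q j j) <= b * b * T.
  by rewrite mulrA; apply: ler_wpM2l; [rewrite -expr2 sqr_ge0 | exact: ltW].
by rewrite -(ler_pM2l T0) -/T expr2; lra.
Qed.

Section Base.
Variables (y : V) (m0 : Z2).
Hypothesis ym0 : y *m gram B Q + alpha = toR m0.

(* The maximum over n of these terms is 1/2 Q(x, x) + alpha(x) - 1/2 min Q(x - y - l, x - y - l),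
   the minimum being over l in Lambda; only finitely many slopes matter near x. *)
Definition theta_term n : Z2 * R := (m0 + n *m Q, - q (y + toR n *m B) / 2).

Lemma theta_termE n x : affine_fun (theta_term n) x =
  q x / 2 + pairing alpha x - q (x - y - toR n *m B) / 2.
Proof.
have -> : x - y - toR n *m B = x - (y + toR n *m B) by rewrite opprD addrA.
have E : toR (m0 + n *m Q) = (y + toR n *m B) *m gram B Q + alpha.
  by rewrite toRDz -ym0 mulmxDl lattice_gram addrAC.
rewrite /theta_term /affine_fun /= E pairingDl -real_extE.
move: (y + _) => u; rewrite real_ext_Dl !real_ext_Dr !real_ext_Nl !real_ext_Nr (symQ x u); lra.
Qed.

Lemma theta_term_slope n n' x : n *m Q = n' *m Q ->
  affine_fun (theta_term n) x = affine_fun (theta_term n') x.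
Proof.
move=> E; rewrite !theta_termE; congr (_ - _ / _); apply: real_ext_kernel.
have -> : x - y - toR n' *m B - (x - y - toR n *m B) = toR n *m B - toR n' *m B.
  by move: (toR n *m B) (toR n' *m B) => u v; apply: row2P; rewrite !mxE; ring.
by rewrite mulmxBl !lattice_gram E subrr.
Qed.

(** By [real_ext_ge], a term with slope far from that of Q(x, -) + alpha has a large Q(x - y - l, x
    - y - l), hence is below the term n = 0. For degenerate Q infinitely many n share a slope, but
    then they give the same affine function. *)
Lemma theta_finite (r : R) : exists L : seq Z2, forall x, `|x| <= r -> forall n,
  exists2 n', n' \in L & affine_fun (theta_term n) x <= affine_fun (theta_term n') x.
Proof.
pose K := gram_norm B Q * (`|r| + `|y|) ^+ 2; pose S := gram_diag * K + 1.
have [_ T0] := gram_diag_gt 0.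
have K0 : 0 <= K by rewrite mulr_ge0 ?exprn_ge0 // ?addr_ge0 // /gram_norm !addr_ge0.
(* A slope entry beyond b differs from that of Q(x, -) + alpha by at least S, whose square is at
   least [gram_diag * K], where K bounds Q(x - y, x - y). The entries of m0 keep the base slope in
   the box. *)
pose b := S + gram_norm B Q * `|r| + `|alpha| + `|m0 0 0|%:~R + `|m0 0 1|%:~R.
pose N := (Num.truncn b).+1; have bN : b < N%:R.
  by rewrite /N; exact: truncnS_gt.
(* One index for each slope that occurs. *)
pose nu m := xget 0 [set n : Z2 | m = m0 + n *m Q].
have nuE n : nu (m0 + n *m Q) *m Q = n *m Q.
  by rewrite /nu; case: xgetP => [n' _ /addrI->//|/(_ n)]; case.
exists [seq nu m | m <- int_box N] => x xr n.
have m0E : m0 = m0 + 0 *m Q by rewrite mul0mx addr0.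
have entry j (N' : R) : `|(m0 0 j)%:~R| <= N' -> N' < N%:R -> `|m0 0 j| <= N%:Z.
  by move=> h1 h2; rewrite -(ler_int R) intr_norm; exact: ltW (le_lt_trans h1 h2).
have gn0 : 0 <= gram_norm B Q by rewrite /gram_norm !addr_ge0.
have T1 : 0 <= S by rewrite /S addr_ge0 // mulr_ge0 // ltW.
have B1 : 0 <= gram_norm B Q * `|r| by rewrite mulr_ge0.
have m0box : m0 \in int_box N.
  apply: mem_int_box => j; apply: (entry j _ _ bN).
  have [->|->] := ord2P j.
    rewrite /b -intr_norm; have := normr_ge0 alpha; have := normr_ge0 (m0 0 1).
    rewrite -(ler_int R); lra.
  rewrite /b -intr_norm; have := normr_ge0 alpha; have := normr_ge0 (m0 0 0).
  rewrite -(ler_int R); lra.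
have [inbox|] := boolP [forall j, `|(m0 + n *m Q) 0 j| <= N%:Z].
  exists (nu (m0 + n *m Q)); first by apply/map_f/mem_int_box => j; move/forallP: inbox.
  by rewrite (theta_term_slope _ (nuE n)).
rewrite negb_forall => /existsP[j]; rewrite -ltNge => far.
exists (nu m0); first exact: map_f.
rewrite [in leRHS](theta_term_slope (n' := 0)); last by rewrite {1}m0E nuE.
rewrite !theta_termE lerD2l lerN2 ler_pM2r //.
have -> : toR (0 : Z2) *m B = 0 :> V by rewrite toR0 mul0mx.
rewrite subr0; have qxy : q (x - y) <= K.
  apply: le_trans (real_ext_bound B Q (x - y)) _; rewrite ler_wpM2l // lerXn2r ?nnegrE ?addr_ge0 //.
  apply: le_trans (ler_normB _ _) _; rewrite lerD2r; exact: le_trans xr (ler_norm _).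
apply: le_trans qxy _; rewrite -(ler_pM2l T0).
apply: le_trans (real_ext_ge _ j).
have -> : (x - y - toR n *m B) *m gram B Q = x *m gram B Q + alpha - toR (m0 + n *m Q).
  by rewrite !mulmxBl lattice_gram toRDz -ym0; move: (x *m _) (y *m _) (toR (n *m Q)) => u v t; apply: row2P; rewrite !mxE; ring.
set g := x *m _ + _; set m := m0 + _ in far *.
have gB : `|g 0 j| <= gram_norm B Q * `|r| + `|alpha|.
  apply: le_trans (_ : `|(x *m gram B Q) 0 j| + `|alpha 0 j| <= _).
    by rewrite /g mxE ler_normD.
  rewrite lerD ?coord_norm_le //; apply: le_trans (_ : gram_norm B Q * `|x| <= _); last first.
    by rewrite ler_wpM2l // (le_trans xr) // ler_norm.
  have mulG : (x *m gram B Q) 0 j = x 0 0 * gram B Q 0 j + x 0 1 * gram B Q 1 j.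
    rewrite mxE !big_ord_recl big_ord0 addr0.
    by have [-> ->] : lift ord0 ord0 = 1 :> 'I_2 /\ ord0 = 0 :> 'I_2 by split; exact: val_inj.
  rewrite mulG; apply: le_trans (ler_normD _ _) _; rewrite !normrM.
  have E i i' : `|x 0 i| * `|gram B Q i i'| <= `|gram B Q i i'| * `|x|.
    by rewrite mulrC ler_wpM2l // coord_norm_le.
  have P i i' : 0 <= `|gram B Q i i'| * `|x| by rewrite mulr_ge0.
  rewrite /gram_norm !mulrDl.
  have := P 0 0; have := P 0 1; have := P 1 0; have := P 1 1; have := E 0 j; have := E 1 j.
  by have [->|->] := ord2P j; lra.
have mB : N%:R < `|(m 0 j)%:~R : R|.
  by rewrite -intr_norm -[N%:R]/((N%:Z)%:~R) ltr_int.
have SB : S <= `|(g - toR m) 0 j|.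
  rewrite mxE [(- toR m) _ _]mxE [toR m _ _]mxE distrC; apply: le_trans (lerB_dist _ _).
  have : 0 <= `|m0 0 0|%:~R + `|m0 0 1|%:~R :> R by rewrite addr_ge0 // ler0z.
  move: bN mB gB; rewrite /b; move: (`|(m 0 j)%:~R|) => *; lra.
apply: le_trans (_ : S ^+ 2 <= _); last by rewrite -[leRHS]real_normK ?num_real // lerXn2r ?nnegrE.
have TK : 0 <= gram_diag * K by rewrite mulr_ge0 // ltW.
by rewrite /S; move: (gram_diag * K) TK => t t0; nra.
Qed.

Lemma theta_max x : exists n, forall n', affine_fun (theta_term n') x <= affine_fun (theta_term n) x.
Proof.
have [L HL] := theta_finite `|x|; have [n0 n0L _] := HL x (lexx _) 0.
pose f n := affine_fun (theta_term n) x.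
have [n [nL nmax]] : exists n, n \in L /\ forall n', n' \in L -> f n' <= f n.
  elim: (L) n0 n0L {HL} => // n L' IH _ _; case: L' IH => [|n1 L'] IH.
    by exists n; split=> [|n']; rewrite inE // => /eqP->.
  have [n2 [n2L H]] := IH n1 (mem_head _ _).
  have [le|lt] := leP (f n) (f n2).
    by exists n2; split=> [|n']; rewrite inE ?n2L ?orbT // => /predU1P[->|/H].
  exists n; split=> [|n']; first exact: mem_head.
  by rewrite inE => /predU1P[->//|/H h]; exact: le_trans h (ltW lt).
exists n => n'; have [n'' /nmax h h'] := HL x (lexx _) n'; exact: le_trans h' h.
Qed.

Definition theta x : R := affine_fun (theta_term (projT1 (cid (theta_max x)))) x.

Lemma theta_ge n x : affine_fun (theta_term n) x <= theta x.
Proof. by rewrite /theta; case: cid => n' /= ->. Qed.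

Lemma theta_attained x : exists n, theta x = affine_fun (theta_term n) x.
Proof. by rewrite /theta; case: cid => n /= _; exists n. Qed.

Lemma theta_regular x : regular_at theta x.
Proof.
have [L HL] := theta_finite (`|x| + 1); have [n0 n0L _] := HL x (ler_wpDr ler01 (lexx _)) 0.
apply/regular_atP; exists (bigmax_affine (theta_term n0) [seq theta_term n | n <- L]).
  by exists (theta_term n0), [seq theta_term n | n <- L].
apply/nearE; exists 1 => // k k1; apply/eqP; rewrite eq_le; apply/andP; split.
  have [n ->] := theta_attained (x + k).
  have [|n' n'L h] := HL (x + k) _ n.
    by apply: le_trans (ler_normD _ _) _; rewrite lerD2l ltW.
  apply: le_trans h _; rewrite /bigmax_affine big_map.
  exact: (le_bigmax_seq _ n' xpredT (fun n => affine_fun (theta_term n) (x + k)) n'L).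
rewrite /bigmax_affine big_map; apply: bigmax_le => [|n _]; exact: theta_ge.
Qed.

(** Translation by l = c B permutes the terms, n becoming n + c, and adds the same quantity C to all
    of them. *)
Lemma theta_section : regular_section B Q alpha theta.
Proof.
split=> [|l x lB]; first exact: theta_regular.
have [c lE] : exists c, l = toR c *m B by apply/asboolP.
pose C := real_ext B Q l x + real_ext B Q l l / 2 + pairing alpha l.
have shift n : affine_fun (theta_term (n + c)) (x + l) = affine_fun (theta_term n) x + C.
  rewrite !theta_termE toRDz mulmxDl -lE.
  have -> : x + l - y - (toR n *m B + l) = x - y - toR n *m B.
    by move: (toR n *m B) => u; apply: row2P; rewrite !mxE; ring.
  by rewrite /C pairingDr real_ext_Dl !real_ext_Dr (symQ x l); field.
have -> : theta x + real_ext B Q l x + real_ext B Q l l / 2 + pairing alpha l = theta x + C.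
  by rewrite /C !addrA.
apply/eqP; rewrite eq_le; apply/andP; split.
  have [n ->] := theta_attained (x + l); have := shift (n - c); rewrite subrK => ->.
  by rewrite lerD2r theta_ge.
by have [n ->] := theta_attained x; rewrite -shift theta_ge.
Qed.

End Base.

Lemma regular_section_addc F (a : R) : regular_section B Q alpha F ->
  regular_section B Q alpha (fun x => a + F x).
Proof.
move=> [rF qF]; split=> [x|l x lB]; last by rewrite qF // !addrA.
apply: regularD (rF x); apply/regular_atP; exists (affine_fun (0, a)).
  by exists (0, a), [::] => y; rewrite /bigmax_affine big_nil.
by near=> y; rewrite /affine_fun /= toR0 pairing0l add0r.
Unshelve. all: by end_near. Qed.

Lemma regular_section_max F F' : regular_section B Q alpha F -> regular_section B Q alpha F' ->
  regular_section B Q alpha (fun x => Num.max (F x) (F' x)).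
Proof.
move=> [rF qF] [rF' qF']; split=> [x|l x lB]; first exact: regular_max.
by rewrite qF // qF' // -!addrA -addr_maxl.
Qed.

Lemma regular_section_bigmax (I : eqType) (F : I -> V -> R) i0 (s : seq I) :
  (forall i, regular_section B Q alpha (F i)) -> exists G, regular_section B Q alpha G /\
  forall x, (exists i, G x = F i x) /\ forall i, i \in i0 :: s -> F i x <= G x.
Proof.
move=> secF; elim: s => [|i1 s [G [secG H]]].
  by exists (F i0); split=> // x; split=> [|i]; [exists i0 | rewrite inE => /eqP->].
exists (fun x => Num.max (F i1 x) (G x)); split; first exact: regular_section_max.
move=> x; have [[i Gx] le] := H x; split.
  by have [_|_] := leP (F i1 x) (G x); [exists i | exists i1].
move=> j; rewrite !in_cons orbCA -in_cons le_max => /predU1P[->|/le->]; last by rewrite orbT.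
by rewrite lexx.
Qed.

End Theta.

(* a i is the maximal weight of an injection of the rows into I minus i, i. e. a tropical
   minor.  If i maximizes a i + A j i and b is an optimal injection for i, then b j
   is another maximizer: redirect j to i. *)
Lemma tropical_cramer (R : realDomainType) (I : finType) k (A : 'I_k -> I -> R) : (k < #|I|)%N ->
  exists a : I -> R, forall j, exists i i', [/\ i != i', a i + A j i = a i' + A j i'
    & forall i'', a i'' + A j i'' <= a i + A j i].
Proof.
move=> kI; pose P i (s : {ffun 'I_k -> I}) := injectiveb s && (i \notin codom s).
have exP i : exists s, P i s.
  have le : (k <= #|predC1 i|)%N by rewrite -ltnS (leq_trans kI) // (cardC1 i) leqSpred.
  exists [ffun j => enum_val (widen_ord le j)]; apply/andP; split.
    apply/injectiveP => u v; rewrite !ffunE => /enum_val_inj/(congr1 val) /= uv; exact: val_inj.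
  apply/codomP => -[u]; rewrite ffunE => E.
  by have := enum_valP (widen_ord le u); rewrite inE -E eqxx.
pose S (s : {ffun 'I_k -> I}) := \sum_j A j (s j).
have maxS i : exists s, P i s /\ forall t, P i t -> S t <= S s.
  have [s0 Ps0] := exP i; exists [arg max_(s > s0 | P i s) S s]%O.
  by case: arg_maxP.
have [b bP] := choice maxS; exists (fun i => S (b i)) => j.
have [i0 _] : exists i0 : I, true by have /card_gt0P[i0] := leq_ltn_trans (leq0n k) kI; exists i0.
pose i := [arg max_(i > i0) (S (b i) + A j i)]%O.
have imax i'' : S (b i'') + A j i'' <= S (b i) + A j i.
  by rewrite /i; case: arg_maxP => // i1 _ H; exact: H.
have [/andP[/injectiveP bi ib] _] := bP i.
have nb w : i <> b i w by move=> E; have := codom_f (b i) w; rewrite -E (negPf ib).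
pose i' := b i j; pose t := [ffun j' => if j' == j then i else b i j'].
have ii' : i != i' by apply/eqP; exact: nb.
have Pt : P i' t.
  apply/andP; split; first apply/injectiveP => u v; rewrite ?ffunE.
    case: eqP => [->|_]; case: eqP => [->|_] //; [by move/nb | by move/esym/nb | exact: bi].
  apply/codomP => -[u]; rewrite ffunE; case: eqP => [_ E|uj /bi E]; last by rewrite E in uj.
  by move: ii'; rewrite -E eqxx.
have St : S t + A j i' = S (b i) + A j i.
  rewrite /S (bigD1 j) //= [in RHS](bigD1 j) //= ffunE eqxx.
  rewrite (eq_bigr (fun u => A u (b i u))) => [|u /negPf uj]; last by rewrite ffunE uj.
  by rewrite -/i'; ring.
exists i, i'; split=> //; apply/eqP; rewrite eq_le imax andbT -St lerD2r.
exact: (bP i').2.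
Qed.

(** * Counting sections through given points *)

Section CountingSections.
Context {R : realType} (B : 'M[R]_2).
Local Notation V := 'rV[R]_2.
Local Notation Z2 := 'rV[int]_2.
Implicit Types (F : V -> R) (Q : 'M[int]_2) (alpha x y : V).
Hypothesis uB : B \in unitmx.

Lemma toR_int (w : Z2) : toR w = w.
Proof. by apply/matrixP => u v; rewrite mxE intz. Qed.

(** Of two affine functions with the same value at x, one can stay below the other on a
    neighbourhood only if their slopes agree. *)
Lemma Zaffine_slope F x (a : Z2) m (c : R) : (\forall y \near x, F y = affine_fun m y) ->
  affine_fun (a, c) x = F x -> (forall y, affine_fun (a, c) y <= F y) -> m.1 = a.
Proof.
move=> /nearE[e e0 H] Fx le; have Fx' : F x = affine_fun m x by have := H 0; rewrite addr0 normr0; apply.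
have le' k : pairing (toR a) k <= pairing (toR m.1) k :> R.
  have [t t0 tk] := scale_small k e0; have := le (x + t *: k).
  by rewrite (H _ tk) !affine_fun_shift -Fx' Fx lerD2l !pairingZr ler_pM2l.
apply: (@toR_inj R); apply: pairing_inj => k; apply/eqP; rewrite eq_le le' andbT.
by have := le' (- k); rewrite !pairingNr lerN2.
Qed.

Lemma section_avoids Q alpha (I : finType) (y : I -> V) (m : I -> Z2) k (p : 'I_k -> V) :
  Defs.symmetric_form B Q -> positive_semidefinite B Q ->
  (forall i, y i *m gram B Q + alpha = toR (m i)) ->
  (forall i j, m i - m j \in int_span Q -> i = j) -> (k < #|I|)%N ->
  exists2 F, regular_section B Q alpha F & forall j, ~ Zaffine_at F (p j).
Proof.
move=> symQ psdQ ym distinct kI.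
pose th i := theta uB symQ psdQ (ym i).
have [a aP] := tropical_cramer (fun j i => th i (p j)) kI.
have [i0 _] : exists i0 : I, true by have /card_gt0P[i0] := leq_ltn_trans (leq0n k) kI; exists i0.
have [i|F [secF HF]] := @regular_section_bigmax _ B Q alpha I (fun i x => a i + th i x) i0 (enum I).
  by apply: regular_section_addc; exact: theta_section.
exists F => // j [s Fs]; have [i [i' [/eqP ii' E imax]]] := aP j.
have leF i1 x : a i1 + th i1 x <= F x by apply: (HF x).2; rewrite inE mem_enum orbT.
have Fpj : F (p j) = a i + th i (p j).
  apply/eqP; rewrite eq_le leF andbT; have [[i1 ->] _] := HF (p j); exact: imax.
(* Where the shifted theta function of i1 attains F, one of its terms is an affine minorant touching
   F. If F is affine there, its slope is in the coset of m i1, and a tie would put it in two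
   different cosets. *)
have slope i1 : F (p j) = a i1 + th i1 (p j) -> exists n, s.1 = m i1 + n *m Q.
  move=> E1; have [n thE] := theta_attained uB symQ psdQ (ym i1) (p j).
  exists n; apply: (Zaffine_slope (c := (theta_term B Q (y i1) (m i1) n).2 + a i1) Fs).
    by rewrite E1 /th thE /affine_fun /=; ring.
  move=> x; apply: le_trans (leF i1 x).
  apply: le_trans (_ : a i1 + affine_fun (theta_term B Q (y i1) (m i1) n) x <= _).
    by rewrite /affine_fun /=; lra.
  by rewrite lerD2l; exact: theta_ge.
have [n En] := slope i Fpj; have [n' En'] := slope i' (etrans Fpj E).
apply: ii'; apply: distinct; apply/asboolP; exists (n' - n).
by rewrite toR_int mulmxBl; apply/eqP; rewrite subr_eq addrAC -subr_eq opprK -En addrC -En'.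
Qed.

Section Divisor.
Variables (D : local_data B) (Q : 'M[int]_2) (alpha : V).
Hypothesis hD : is_divisor D.
Hypothesis symQ : Defs.symmetric_form B Q.
Variable FD : V -> R.
Hypothesis secD : section_of B Q alpha FD.
Hypothesis indD : induced_by D FD.

Lemma h0_classes (I : finType) (y : I -> V) (m : I -> Z2) : positive_semidefinite B Q ->
  (forall i, y i *m gram B Q + alpha = toR (m i)) ->
  (forall i j, m i - m j \in int_span Q -> i = j) ->
  (forall x a, x *m gram B Q + alpha = toR a -> exists i, a - m i \in int_span Q) ->
  h0 D = #|I|%:R%:E.
Proof.
move=> psdQ ym distinct cover; apply: h0_nat.
  apply/(avoidableP uB hD secD indD); exists (fun i => y (enum_val i)) => F secF.
  have [|i Zi] := section_Zaffine uB symQ secF (y := y).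
    move=> x a xa; have [i /asboolP[n E]] := cover x a xa.
    exists i, (toR n *m B); split; first by apply/asboolP; exists n.
    rewrite !mulmxBl lattice_gram // -[n]toR_int -E toRB -xa -ym.
    by move: (x *m _) (y i *m _) => u v; apply: row2P; rewrite !mxE; ring.
  by exists (enum_rank i); rewrite enum_rankK.
move=> k kI /(avoidableP uB hD secD indD)[p pP].
have [F secF nZ] := section_avoids p symQ psdQ ym distinct kI.
by have [i /nZ] := pP F secF.
Qed.

Lemma h0_empty : (forall F, ~ regular_section B Q alpha F) -> h0 D = 0%E.
Proof.
move=> empty; rewrite (h0_nat (N := 0)) //.
by apply/(avoidableP uB hD secD indD); exists (fun=> 0) => F /empty.
Qed.

End Divisor.
End CountingSections.

(** * Cosets of the image of the lattice *)

Section Index.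
Local Notation Z2 := 'rV[int]_2.
Implicit Types (Q : 'M[int]_2).

Lemma mem_int_spanZ Q (x : Z2) : x \in int_span Q <->
  exists n1 n2 : int, x 0 0 = n1 * Q 0 0 + n2 * Q 1 0 /\ x 0 1 = n1 * Q 0 1 + n2 * Q 1 1.
Proof.
split=> [/mem_int_span[n1 [n2 ->]]|[n1 [n2 [x0 x1]]]].
  by exists n1, n2; rewrite !mxE !intz.
apply/mem_int_span; exists n1, n2; apply/rowP => j.
by have [->|->] := ord2P j; rewrite !mxE !intz.
Qed.

(** Row reduction by the Bezout coefficients of the first column: the row lattice has a basis (a,
    b), (0, d) with a the gcd of that column. *)
Lemma hermite_form Q : \det Q != 0 -> exists a b d : int, [/\ 0 < a, d != 0, `|\det Q| = a * `|d|
  & forall x : Z2, x \in int_span Q <-> exists s t, x 0 0 = s * a /\ x 0 1 = s * b + t * d].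
Proof.
move=> Q0; pose g := gcdz (Q 0 0) (Q 1 0).
have [u [v uv]] := Bezoutz (Q 0 0) (Q 1 0).
have detE : \det Q = Q 0 0 * Q 1 1 - Q 0 1 * Q 1 0 by rewrite det_mx2.
have g0 : g != 0.
  apply: contra_neq Q0 => /eqP; rewrite gcdz_eq0 => /andP[/eqP q0 /eqP q1].
  by rewrite detE q0 q1 mul0r mulr0 subrr.
have gpos : 0 < g by rewrite lt_def g0 /g /gcdz.
have /dvdzP[p pE] : Q 0 0 \in dvdz g by exact: dvdz_gcdl.
have /dvdzP[r rE] : Q 1 0 \in dvdz g by exact: dvdz_gcdr.
rewrite -/g in uv pE rE; clearbody g; have uvg : u * p + v * r = 1.
  by apply: (mulIf g0); rewrite mul1r -[RHS]uv pE rE; ring.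
pose d := p * Q 1 1 - r * Q 0 1.
have dE : \det Q = g * d by rewrite detE pE rE /d; ring.
exists g, (u * Q 0 1 + v * Q 1 1), d; split=> //.
- by apply: contra_neq Q0 => d0; rewrite dE d0 mulr0.
- by rewrite dE normrM (gtr0_norm gpos).
move=> x; split=> [/mem_int_spanZ[n1 [n2 [x0 x1]]]|[s [t [x0 x1]]]].
  exists (n1 * p + n2 * r), (n2 * u - n1 * v); split; first by rewrite x0 pE rE; ring.
  have -> : x 0 1 = (u * p + v * r) * (n1 * Q 0 1 + n2 * Q 1 1) by rewrite uvg mul1r.
  by rewrite /d; ring.
(* Coordinates in the rows of Q, through the unimodular matrix with rows (u, v) and (-r, p). *)
apply/mem_int_spanZ; exists (s * u - t * r), (s * v + t * p); split.
  rewrite x0 pE rE; transitivity (s * (u * p + v * r) * g); first by rewrite uvg mulr1.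
  by ring.
by rewrite x1 /d; ring.
Qed.

Lemma int_span_index Q : \det Q != 0 -> exists (I : finType) (m : I -> Z2),
  [/\ #|I|%:Z = `|\det Q|, forall i j, m i - m j \in int_span Q -> i = j
    & forall a, exists i, a - m i \in int_span Q].
Proof.
move=> /hermite_form[a [b [d [a0 d0 detE spanE]]]].
(* Representatives are pairs of remainders, modulo a in the first entry and modulo d in the
   second. *)
exists ('I_(absz a) * 'I_(absz d))%type.
exists (fun i => \row_(j < 2) (if j == 0 then (nat_of_ord i.1)%:Z else (nat_of_ord i.2)%:Z)).
split.
- by rewrite card_prod !card_ord detE PoszM !abszE (gtr0_norm a0).
- move=> [i1 i2] [j1 j2] /spanE[s [t]]; rewrite !mxE /= => -[h1 h2].
  have li := ltn_ord i1; have lj := ltn_ord j1; have li2 := ltn_ord i2; have lj2 := ltn_ord j2.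
  have s0 : s = 0.
    by move: h1 li lj; move: (nat_of_ord i1) (nat_of_ord j1) => x y h1 hx hy; nia.
  rewrite s0 !mul0r add0r in h1 h2.
  have t0 : t = 0.
    by move: h2 li2 lj2; move: (nat_of_ord i2) (nat_of_ord j2) => x y h2 hx hy; nia.
  by congr (_, _); apply: val_inj => /=; rewrite ?t0 in h2; lia.
move=> x; move x0E : (x 0 0) => x0; pose s := (x0 %/ a)%Z; pose z := x 0 1 - s * b.
have a0' : a != 0 by rewrite gt_eqF.
have l1 : (absz (x0 %% a)%Z < `|a|)%N.
  by have := modz_ge0 x0 a0'; have := ltz_mod x0 a0'; lia.
have l2 : (absz (z %% d)%Z < `|d|)%N.
  by have := modz_ge0 z d0; have := ltz_mod z d0; lia.
exists (Ordinal l1, Ordinal l2); apply/spanE; exists s, (z %/ d)%Z; rewrite !mxE /= x0E.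
have := modz_ge0 x0 a0'; have := modz_ge0 z d0.
have := divz_eq x0 a; have := divz_eq z d; have zE : x 0 1 = z + s * b by rewrite /z subrK.
rewrite -/s zE; clearbody s z; move: (x0 %% a)%Z (z %% d)%Z (z %/ d)%Z => u v w -> -> v0 u0; rewrite !gez0_abs //; split; ring.
Qed.

Lemma torsion_partP Q (x : Z2) : @torsion_part 2 Q (\pi_(cokernel Q) x) <->
  exists2 k, (0 < k)%N & x *+ k \in int_span Q.
Proof.
have E k : \pi_(cokernel Q) x *+ k = 0 <-> x *+ k \in int_span Q.
  rewrite -raddfMn -(raddf0 \pi_(cokernel Q)) -[x *+ k]subr0.
  by rewrite Quotient.idealrBE subr0; split=> /eqP.
by split=> -[k k0 /E xk]; exists k.
Qed.

(** Solvability of w Q = x descends from the reals to the rationals, as row spaces are compatible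
    with field extension; clearing denominators then gives a multiple of x in the lattice. *)
Lemma torsion_rational Q (R : realType) (x : Z2) :
  (exists2 k, (0 < k)%N & x *+ k \in int_span Q) <-> exists w : 'rV[R]_2, w *m toR Q = toR x.
Proof.
split=> [[k k0 /asboolP[c E]]|[w wE]].
  have k0' : k%:R != 0 :> R by rewrite pnatr_eq0 -lt0n.
  exists (k%:R^-1 *: toR c); rewrite -scalemxAl /toR -map_mxM.
  have -> : c *m Q = x *+ k by rewrite E; congr (_ *m _); apply/rowP => j; rewrite mxE intz.
  by apply/rowP => j; rewrite !mxE mulmxnE rmorphMn /= -[(x 0 j)%:~R *+ k]mulr_natl mulKf.
have ratrE (m n : nat) (A : 'M[int]_(m, n)) : toR A = map_mx (ratr : rat -> R) (toR A).
  by apply/matrixP => i j; rewrite !mxE ratr_int.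
have : (toR x <= (toR Q : 'M[rat]_2))%MS.
  by rewrite -(map_submx (ratr : {rmorphism rat -> R})) -!ratrE; apply/submxP; exists w.
move=> /submxP[r rE]; pose d0 := denq (r 0 0); pose d1 := denq (r 0 1).
exists (absz (d0 * d1)); first by rewrite absz_gt0 mulf_neq0 // denq_neq0.
have entry j : x 0 j *+ absz (d0 * d1) = numq (r 0 0) * d1 * Q 0 j + numq (r 0 1) * d0 * Q 1 j.
  rewrite -mulr_natl natz abszE gtr0_norm ?mulr_gt0 ?denq_gt0 //.
  apply: (@intr_inj rat); have := congr1 (fun A : 'rV[rat]_2 => A 0 j) rE.
  rewrite /= !mxE !big_ord_recl big_ord0 addr0 !mxE.
  have [-> ->] : lift ord0 ord0 = 1 :> 'I_2 /\ ord0 = 0 :> 'I_2 by split; exact: val_inj.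
  rewrite !rmorphD !rmorphM /= => ->.
  rewrite -{1}(divq_num_den (r 0 0)) -{1}(divq_num_den (r 0 1)) -/d0 -/d1.
  have n0 : d0%:~R != 0 :> rat by rewrite intr_eq0 denq_neq0.
  have n1 : d1%:~R != 0 :> rat by rewrite intr_eq0 denq_neq0.
  by field; rewrite n0 n1.
by apply/mem_int_spanZ; exists (numq (r 0 0) * d1), (numq (r 0 1) * d0); rewrite !mulmxnE !entry.
Qed.

(** Write a torsion element as w Q and subtract the integral parts of w: its class has a
    representative in a box determined by the entries of Q. *)
Lemma torsion_part_finite Q (R : realType) : finite_set (@torsion_part 2 Q).
Proof.
pose N := absz (`|Q 0 0| + `|Q 1 0| + `|Q 0 1| + `|Q 1 1|).
apply: (@sub_finite_set _ _ (\pi_(cokernel Q) @` [set` int_box N])); last first.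
  exact/finite_image/finite_seq.
move=> z; have <- : \pi_(cokernel Q) (repr z) = z by exact: reprK.
move: (repr z) => x /torsion_partP/(torsion_rational Q R)[w wE].
pose n0 := Num.floor (w 0 0); pose n1 := Num.floor (w 0 1).
pose x' := x - (n0 *: row 0 Q + n1 *: row 1 Q).
exists x'; last first.
  apply/eqP; rewrite -Quotient.idealrBE /x' addrAC subrr add0r rpredN.
  by apply/mem_int_span; exists n0, n1; rewrite !intz.
apply: mem_int_box => j.
have x'E : (x' 0 j)%:~R = (w 0 0 - n0%:~R) * (Q 0 j)%:~R + (w 0 1 - n1%:~R) * (Q 1 j)%:~R :> R.
  have := congr1 (fun A : 'rV[R]_2 => A 0 j) wE.
  rewrite /= /x' !mxE !big_ord_recl big_ord0 addr0 !mxE.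
  have [-> ->] : lift ord0 ord0 = 1 :> 'I_2 /\ ord0 = 0 :> 'I_2 by split; exact: val_inj.
  by rewrite rmorphB rmorphD !rmorphM /= => <-; ring.
have frac (t : R) : 0 <= t - (Num.floor t)%:~R <= 1.
  by have := Num.Theory.floor_itv t; rewrite rmorphD /=; lra.
have fracM (t : R) (c : int) : `|(t - (Num.floor t)%:~R) * c%:~R| <= `|c|%:~R.
  have /andP[f0 f1] := frac t.
  by rewrite normrM (ger0_norm f0) -intr_norm ler_piMl // ler0z.
have : `|x' 0 j| <= `|Q 0 j| + `|Q 1 j|.
  rewrite -(ler_int R) intr_norm x'E rmorphD /=.
  by apply: le_trans (ler_normD _ _) _; rewrite lerD ?fracM.
have nn i k : 0 <= `|Q i k| := normr_ge0 _.
move/le_trans; apply; rewrite /N abszE [leRHS]ger0_norm ?addr_ge0 //.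
have := nn 0 0; have := nn 0 1; have := nn 1 0; have := nn 1 1.
by have [->|->] := ord2P j; lra.
Qed.

Lemma torsion_classes Q (R : realType) : exists (I : finType) (m : I -> Z2),
  [/\ #|I| = torsion_order Q, forall i j, m i - m j \in int_span Q -> i = j,
      forall i, exists w : 'rV[R]_2, w *m toR Q = toR (m i)
    & forall a (w : 'rV[R]_2), w *m toR Q = toR a -> exists i, a - m i \in int_span Q].
Proof.
pose A := fset_set (@torsion_part 2 Q).
have AE z : (z \in A) = (z \in @torsion_part 2 Q) by rewrite in_fset_set //; exact: torsion_part_finite R.
have piK (z : cokernel Q) : \pi_(cokernel Q) (repr z) = z by exact: reprK.
exists A, (fun i => repr (val i)); split.
- by rewrite -cardfE.
- by move=> i j; rewrite Quotient.idealrBE => /eqP; rewrite !piK; exact: val_inj.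
- move=> i; apply/torsion_rational/torsion_partP; rewrite piK.
  by have := valP i; rewrite AE => /set_mem.
move=> a w wa; have aA : \pi_(cokernel Q) a \in A.
  by rewrite AE; apply/mem_set/torsion_partP/(torsion_rational Q R); exists w.
by exists (FSetSub aA); rewrite Quotient.idealrBE /= piK.
Qed.

End Index.

(** * Riemann-Roch *)

Section RiemannRoch.
Context {R : realType} (B : 'M[R]_2).
Local Notation V := 'rV[R]_2.
Local Notation Z2 := 'rV[int]_2.
Implicit Types (Q : 'M[int]_2) (alpha v w x y : V) (D : local_data B).
Hypothesis uB : B \in unitmx.

Lemma gramN Q : gram B (- Q) = - gram B Q.
Proof. by rewrite /gram /toR map_mxN mulmxN. Qed.

Lemma real_extN Q x y : real_ext B (- Q) x y = - real_ext B Q x y.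
Proof. by rewrite !real_extE gramN mulmxN pairingNl. Qed.

Lemma lattice_mul_gram Q w : w *m B *m gram B Q = w *m toR Q.
Proof. by rewrite /gram -mulmxA mulKVmx. Qed.

Lemma gram_lattice Q x : x *m gram B Q = x *m invmx B *m toR Q.
Proof. by rewrite /gram mulmxA. Qed.

(** The orientation sign in [form_det] turns the factor det B between Q and its Gram matrix into its
    absolute value, so only the quadratic form determines the sign. *)
Lemma form_detE Q : (form_det B Q)%:~R = `|\det B| * \det (gram B Q).
Proof.
have E : \det (toR Q : 'M[R]_2) = \det B * \det (gram B Q).
  by rewrite -det_mulmx /gram mulKVmx.
have -> : (form_det B Q)%:~R = Num.sg (\det B) * \det (toR Q : 'M[R]_2).
  by rewrite /form_det rmorphM /= -sgrEz /toR det_map_mx.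
by rewrite E mulrA -normrEsg.
Qed.

Lemma form_det_sg Q : Num.sg (form_det B Q)%:~R = Num.sg (\det (gram B Q)).
Proof.
by rewrite form_detE sgrM gtr0_sg ?mul1r // normr_gt0 -unitfE -unitmxE.
Qed.

Lemma form_det_norm Q : `|form_det B Q| = `|\det Q|.
Proof.
rewrite /form_det normrM normr_sgz (_ : (\det B == 0) = false) ?mul1r //.
by apply/negbTE; rewrite -unitfE -unitmxE.
Qed.

Section Gram.
Variable Q : 'M[int]_2.
Hypothesis symQ : Defs.symmetric_form B Q.
Local Notation a := (gram B Q 0 0).
Local Notation b := (gram B Q 0 1).
Local Notation c := (gram B Q 1 1).

Lemma gram_sym : gram B Q 1 0 = b.
Proof.
have := symQ (vec2 0 1) (vec2 1 0); rewrite !real_ext_coord !vec20 !vec21; lra.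
Qed.

Lemma real_ext_quadratic x : real_ext B Q x x = a * x 0 0 ^+ 2 + 2 * b * x 0 0 * x 0 1 + c * x 0 1 ^+ 2.
Proof. by rewrite real_ext_coord gram_sym; ring. Qed.

Lemma det_gram : \det (gram B Q) = a * c - b ^+ 2.
Proof. by rewrite det_mx2 gram_sym expr2. Qed.

Lemma complete_square_l x : a * real_ext B Q x x =
  (a * x 0 0 + b * x 0 1) ^+ 2 + \det (gram B Q) * x 0 1 ^+ 2.
Proof. by rewrite real_ext_quadratic det_gram; ring. Qed.

Lemma complete_square_r x : c * real_ext B Q x x =
  (c * x 0 1 + b * x 0 0) ^+ 2 + \det (gram B Q) * x 0 0 ^+ 2.
Proof. by rewrite real_ext_quadratic det_gram; ring. Qed.

Lemma positive_definite_det : positive_definite B Q -> 0 < \det (gram B Q).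
Proof.
move=> pos; have a0 : 0 < a.
  have := pos (vec2 1 0); rewrite real_ext_quadratic vec20 vec21 => H.
  have : vec2 1 0 != 0 :> V by apply/eqP => /rowP/(_ 0); rewrite vec20 mxE; lra.
  by move=> /H; lra.
have nz : vec2 (- b) a != 0 :> V by apply/eqP => /rowP/(_ 1); rewrite vec21 [RHS]mxE; lra.
have := complete_square_l (vec2 (- b) a); have := pos _ nz.
rewrite vec20 vec21 => q0; rewrite (_ : a * - b + b * a = 0); last by ring.
rewrite expr0n add0r => E; have : 0 < \det (gram B Q) * a ^+ 2 by rewrite -E mulr_gt0.
by rewrite pmulr_lgt0 ?exprn_gt0.
Qed.

Lemma det_definite : 0 < \det (gram B Q) -> positive_definite B Q \/ negative_definite B Q.
Proof.
move=> d0; have a0 : a != 0.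
  by apply/eqP => a0; move: d0; rewrite det_gram a0 mul0r sub0r oppr_gt0 ltNge sqr_ge0.
have q0 x : x != 0 -> 0 < a * real_ext B Q x x.
  move=> x0; rewrite complete_square_l; have [y0|y0] := eqVneq (x 0 1) 0.
    rewrite y0 mulr0 addr0 expr0n mulr0 addr0 exprn_even_gt0 //= mulf_neq0 //.
    by apply: contra_neq x0 => x0; apply: row2P; rewrite mxE.
  by rewrite ltr_wpDl ?sqr_ge0 // mulr_gt0 // exprn_even_gt0.
have [a1|a1|a1] := ltgtP a 0; last by rewrite a1 eqxx in a0.
  by right=> x /q0; rewrite nmulr_rgt0.
by left=> x /q0; rewrite pmulr_rgt0.
Qed.

(** If the determinant were nonnegative, completing squares would make each diagonal entry times the
    form nonnegative everywhere. As the form takes both signs, the diagonal vanishes, then b = 0 and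
    the form is zero. *)
Lemma indefinite_det : indefinite B Q -> \det (gram B Q) < 0.
Proof.
move=> [[x x0] [y y0]]; rewrite ltNge; apply/negP => d0.
have nn z : 0 <= a * real_ext B Q z z /\ 0 <= c * real_ext B Q z z.
  rewrite complete_square_l complete_square_r; split; apply: addr_ge0; first exact: sqr_ge0.
  - by rewrite mulr_ge0 ?sqr_ge0.
  - exact: sqr_ge0.
  by rewrite mulr_ge0 ?sqr_ge0.
have [ax cx] := nn x; have [ay cy] := nn y.
rewrite !pmulr_lge0 // in ax cx; rewrite !nmulr_lge0 // in ay cy.
have aE : a = 0 by apply/eqP; rewrite eq_le ax ay.
have cE : c = 0 by apply/eqP; rewrite eq_le cx cy.
have bE : b = 0.
  apply/eqP; rewrite -sqrf_eq0 eq_le sqr_ge0 andbT.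
  by move: d0; rewrite det_gram aE mul0r sub0r oppr_ge0.
by move: x0; rewrite real_ext_quadratic aE bE cE; lra.
Qed.

Lemma isotropic_form : (forall x, real_ext B Q x x = 0) -> Q = 0.
Proof.
move=> q0; have E x y : real_ext B Q x y = 0.
  have := q0 (x + y); rewrite real_ext_Dl !real_ext_Dr !q0 (symQ y x); lra.
have gram0 : gram B Q = 0.
  apply/row_matrixP => i; rewrite row0 rowE; apply: pairing_inj => k.
  by rewrite -real_extE E pairing0l.
apply/matrixP => i j; apply: (@intr_inj R); rewrite mxE rmorph0.
have : toR Q = 0 :> 'M[R]_2 by rewrite -(mulKVmx uB (toR Q)) -[invmx B *m _]/(gram B Q) gram0 mulmx0.
by move/matrixP => /(_ i j); rewrite !mxE.
Qed.

End Gram.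

Lemma line_bundle_opp D Q alpha : is_divisor D -> line_bundle_iso D Q alpha ->
  is_divisor (div_opp D) /\ line_bundle_iso (div_opp D) (- Q) (- alpha).
Proof.
move=> hD [symQ [F [secF indF]]]; have [hD' secF' indF'] := div_opp_section secF indF hD.
split=> //; split; last by exists (fun x => - F x).
by move=> x y; rewrite !real_extN symQ.
Qed.

Lemma h0_not_psd D Q alpha v : is_divisor D -> line_bundle_iso D Q alpha ->
  real_ext B Q v v < 0 -> h0 D = 0%E.
Proof.
move=> hD [symQ [F [secF indF]]] v0; apply: (h0_empty uB hD secF indF) => G secG.
by have := section_psd uB symQ secG v; rewrite leNgt v0.
Qed.

Lemma h0_not_in_image D Q alpha : is_divisor D -> line_bundle_iso D Q alpha ->
  ~ in_image_plus_int B Q alpha -> h0 D = 0%E.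
Proof.
move=> hD [symQ [F [secF indF]]] ni; apply: (h0_empty uB hD secF indF) => G secG.
exact/ni/(section_in_image uB symQ secG).
Qed.

Lemma in_image_opp Q alpha : in_image_plus_int B (- Q) (- alpha) <-> in_image_plus_int B Q alpha.
Proof.
have main Q' alpha' : in_image_plus_int B Q' alpha' -> in_image_plus_int B (- Q') (- alpha').
  by move=> [x [a ->]]; exists x, (- a); rewrite gramN mulmxN opprD toRN.
by split=> /main //; rewrite !opprK.
Qed.

(** Representatives of the torsion part of Cok(q), torsion being expressed by solvability over R.
    For nondegenerate Q this is all of Cok(q), so the definite and the semidefinite case share one
    count. *)
Definition coset_system Q (I : Type) (m : I -> Z2) :=
  [/\ forall i j, m i - m j \in int_span Q -> i = j,
      forall i, exists w : V, w *m toR Q = toR (m i)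
    & forall a (w : V), w *m toR Q = toR a -> exists i, a - m i \in int_span Q].

Lemma int_spanN Q (x : Z2) : x \in int_span (- Q) -> x \in int_span Q.
Proof.
move=> /mem_int_spanZ[n1 [n2 [x0 x1]]]; apply/mem_int_spanZ; exists (- n1), (- n2).
by rewrite x0 x1 !mxE !mulrN !mulNr.
Qed.

Lemma coset_systemN Q (I : Type) (m : I -> Z2) : coset_system Q m -> coset_system (- Q) m.
Proof.
have mulN w : w *m toR (- Q) = (- w) *m toR Q by rewrite /toR map_mxN mulmxN mulNmx.
move=> [distinct tors cover]; split=> [i j /int_spanN/distinct//|i|a w].
  by have [w wE] := tors i; exists (- w); rewrite mulN opprK.
by rewrite mulN => /cover[i h]; exists i; apply: int_spanN; rewrite opprK.
Qed.

Lemma h0_cosets D Q alpha (I : finType) (m : I -> Z2) : is_divisor D -> line_bundle_iso D Q alpha ->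
  positive_semidefinite B Q -> in_image_plus_int B Q alpha -> coset_system Q m ->
  h0 D = #|I|%:R%:E.
Proof.
move=> hD [symQ [F [secF indF]]] psdQ [x1 [a1 alphaE]] [distinct tors cover].
(* Shifting by a solution x1 of [alpha = x1 *m gram B Q + toR a1] turns the classes to be counted
   into torsion elements. *)
pose y i := xget 0 [set w : V | w *m toR Q = toR (m i)] *m B - x1.
apply: (h0_classes uB hD symQ secF indF (y := y) (m := fun i => a1 + m i)) => //.
- move=> i; rewrite mulmxBl lattice_mul_gram alphaE toRD.
  have [w wE] := tors i; case: xgetP => [w' _ /= ->|/(_ w)/(_ wE)//].
  by rewrite addrA subrK addrC.
- by move=> i j; rewrite opprD addrACA subrr add0r; exact: distinct.
move=> x a xa; have [|i hi] := cover (a - a1) ((x + x1) *m invmx B).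
  rewrite -gram_lattice mulmxDl toRB -xa alphaE.
  by move: (x *m _) (x1 *m _) => u v; apply: row2P; rewrite !mxE; ring.
by exists i; rewrite opprD addrA.
Qed.

(** Since Q is semidefinite and nonzero, exactly one of Q and -Q takes a negative value, so only one
    of D and -D contributes. *)
Lemma h0_semidefinite D Q alpha (I : finType) (m : I -> Z2) :
  is_divisor D -> line_bundle_iso D Q alpha -> Q != 0 ->
  positive_semidefinite B Q \/ negative_semidefinite B Q ->
  in_image_plus_int B Q alpha -> coset_system Q m ->
  (h0 D + h0 (div_opp D) = #|I|%:R%:E)%E.
Proof.
move=> hD iso Q0 semi im sys; have [hD' iso'] := line_bundle_opp hD iso.
have [v v0] : exists v, real_ext B Q v v != 0.
  apply: contrapT => /forallNP h; move/eqP: Q0; apply; apply: (isotropic_form iso.1) => x.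
  by apply/eqP/negPn/negP; exact: h.
case: semi => [psd|nsd].
  rewrite (h0_cosets hD iso psd im sys) (h0_not_psd hD' iso' (v := v)) ?adde0 //.
  by rewrite real_extN oppr_lt0 lt_def v0 psd.
rewrite (h0_not_psd hD iso (v := v)) ?add0e; last by rewrite lt_def eq_sym v0 nsd.
apply: (h0_cosets hD' iso') (coset_systemN sys); last exact/in_image_opp.
by move=> x; rewrite real_extN oppr_ge0.
Qed.

End RiemannRoch.

Section Cases.
Context {R : realType} (B : 'M[R]_2).
Implicit Types (Q : 'M[int]_2) (alpha : 'rV[R]_2) (D : local_data B).
Hypothesis uB : B \in unitmx.

Lemma index_coset_system Q : \det Q != 0 -> exists (I : finType) (m : I -> 'rV[int]_2),
  #|I|%:Z = `|\det Q| /\ coset_system (R := R) Q m.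
Proof.
move=> Q0; have [I [m [cardI distinct cover]]] := int_span_index Q0.
exists I, m; split=> //; split=> // i.
exists (toR (m i) *m invmx (toR Q)); rewrite mulmxKV //.
by rewrite unitmxE /toR det_map_mx unitfE intr_eq0.
Qed.

Lemma h0_definite D Q alpha : is_divisor D -> line_bundle_iso D Q alpha ->
  0 < \det (gram B Q) -> (h0 D + h0 (div_opp D) = (form_det B Q)%:~R%:E)%E.
Proof.
move=> hD iso d0; have f0 : 0 < form_det B Q.
  by rewrite -(ltr_int R) -sgr_gt0 form_det_sg // sgr_gt0.
have Q0 : \det Q != 0 by rewrite -normr_gt0 -(form_det_norm uB) normr_gt0 gt_eqF.
have [I [m [cardI sys]]] := index_coset_system Q0.
rewrite (h0_semidefinite uB hD iso _ _ _ sys).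
- by rewrite -(gtr0_norm f0) form_det_norm // -cardI.
- by apply: contra_neq Q0 => ->; rewrite det0.
- have q0 : real_ext B Q 0 0 = 0 by rewrite real_extE mul0mx pairing0l.
  have [pos|neg] := det_definite iso.1 d0; [left=> x|right=> x]; have [->|x0] := eqVneq x 0.
  + by rewrite q0.
  + exact/ltW/pos.
  + by rewrite q0.
  exact/ltW/neg.
by exists (alpha *m invmx (gram B Q)), 0; rewrite toR0 addr0 mulmxKV // unitmxE unitfE gt_eqF.
Qed.

(** There is a single class, as the torsion part is trivial. Here Q and -Q are both positive
    semidefinite, so the lemma applies to D and to -D, whence the total 2. *)
Lemma h0_trivial D Q alpha : is_divisor D -> line_bundle_iso D Q alpha -> Q = 0 ->
  (exists a : 'rV[int]_2, alpha = toR a) -> h0 D = 1%:E.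
Proof.
move=> hD iso Q0 [a alphaE].
have toRQ : toR Q = 0 :> 'M[R]_2 by rewrite Q0 /toR map_mx0.
rewrite (h0_cosets (I := unit) (m := fun=> 0) uB hD iso) ?card_unit //.
- by move=> x; rewrite real_extE /gram toRQ !mulmx0 pairing0l.
- by exists 0, a; rewrite mul0mx add0r.
split=> [[] []|_|b w] //; first by exists 0; rewrite mul0mx toR0.
rewrite toRQ mulmx0 => bE; exists tt; rewrite subr0.
by have -> : b = 0; [apply: (@toR_inj R); rewrite -bE toR0 | exact: rpred0].
Qed.

Lemma h0_ge0 D : (0 <= h0 D)%E.
Proof. by apply: le_ereal_inf_tmp => _ [k _ <-]; rewrite lee_fin. Qed.

End Cases.

Theorem corollary48 (R : realType) (B : 'M[R]_2) (hB : B \in unitmx)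
    (hX : tropical_abelian B) (D : local_data B) (hD : is_divisor D) :
  let h : \bar R := (h0 D + h0 (div_opp D))%E in
  let halfD2 : R := (intersection_number D D)%:~R / 2 in
  (halfD2%:E <= h)%E /\
  forall (Q : 'M[int]_2) (alpha : 'rV[R]_2), line_bundle_iso D Q alpha ->
  [/\ positive_definite B Q \/ negative_definite B Q ->
        h = halfD2%:E /\ halfD2 = (form_det B Q)%:~R,

      (positive_semidefinite B Q \/ negative_semidefinite B Q) /\
      eigenvalue (gram B Q) 0 ->
      [/\ Q != 0 -> in_image_plus_int B Q alpha ->
            [/\ h = (torsion_order Q)%:R%:E,
                (halfD2%:E < h)%E & halfD2 = 0],
          Q = 0 -> (exists a : 'rV[int]_2, alpha = toR a) ->
            [/\ h = 2%:R%:E, (halfD2%:E < h)%E & halfD2 = 0]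
        & ~ in_image_plus_int B Q alpha ->
            h = halfD2%:E /\ halfD2 = 0]
    & indefinite B Q ->
        [/\ h = 0%E, (halfD2%:E < h)%E & halfD2 = (form_det B Q)%:~R]].
Proof.
move=> h halfD2.
have halfE Q alpha : line_bundle_iso D Q alpha -> halfD2 = (form_det B Q)%:~R.
  by move=> iso; rewrite /halfD2 (intersection_numberE hB hD iso) mulrC mulKf.
have form0 Q : \det (gram B Q) = 0 -> (form_det B Q)%:~R = 0 :> R.
  by move=> d0; rewrite form_detE // d0 mulr0.
have form_lt0 Q : \det (gram B Q) < 0 -> (form_det B Q)%:~R < 0 :> R.
  by move=> d0; rewrite -sgr_lt0 form_det_sg // sgr_lt0.
split.
  have [Q [alpha iso]] := line_bundle_exists hD hB.
  (* If the determinant is negative or zero, nonnegativity of h^0 is enough; if it is positive, the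
     form is definite and equality holds. *)
  rewrite (halfE _ _ iso); have [d0|d0|d0] := ltgtP (\det (gram B Q)) 0.
  - rewrite (le_trans (_ : _ <= 0)%E) ?adde_ge0 ?h0_ge0 // lee_fin ltW //; exact: form_lt0.
  - by rewrite /h (h0_definite hB hD iso d0).
  by rewrite form0 // adde_ge0 ?h0_ge0.
move=> Q alpha iso; have [hD' iso'] := line_bundle_opp hD iso; have symQ := iso.1.
rewrite (halfE _ _ iso); split.
- move=> def; split=> //; apply: (h0_definite hB hD iso).
  case: def => [pos|neg]; first exact: positive_definite_det.
  have posN : positive_definite B (- Q) by move=> x x0; rewrite real_extN oppr_gt0; exact: neg.
  have := positive_definite_det iso'.1 posN.
  by rewrite gramN -scaleN1r detZ expr2 mulrNN mulr1 mul1r.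
- move=> [semi /eigenvalueP[v]]; rewrite scale0r => vG v0.
  have d0 : \det (gram B Q) = 0 by apply/eqP/det0P; exists v.
  rewrite form0 //; split=> [Q0 im|Q0 [a alphaE]|ni].
  + have [I [m [cardI distinct tors cover]]] := torsion_classes Q R.
    have hE : h = #|I|%:R%:E by apply: (h0_semidefinite hB hD iso Q0 semi im (m := m)).
    have I0 : (0 < #|I|)%N.
      (* The class of zero is always present, which makes the inequality strict. *)
      by have [|i _] := cover 0 0; [rewrite mul0mx toR0 | apply/card_gt0P; exists i].
    by rewrite -cardI hE lte_fin ltr0n.
  + have -> : h = 2%:R%:E.
      rewrite /h (h0_trivial hB hD iso) //; last by exists a.
      rewrite (h0_trivial hB hD' iso') ?Q0 ?oppr0 //; last by exists (- a); rewrite toRN alphaE.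
    by rewrite lte_fin ltr0n.
  have -> : h = 0%E.
    by rewrite /h (h0_not_in_image hB hD iso ni) (h0_not_in_image hB hD' iso') ?adde0 // in_image_opp.
  by [].
move=> ind; have hE : h = 0%E.
  have [[x x0] [y y0]] := ind.
  rewrite /h (h0_not_psd hB hD iso y0) (h0_not_psd hB hD' iso' (v := x)) ?adde0 //.
  by rewrite real_extN oppr_lt0.
by rewrite hE lte_fin; split=> //; apply: form_lt0; exact: indefinite_det.
Qed.
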